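(* Let $D$ be a sound-soft or sound-hard cavity, $\Gamma$ the source curve, $z\in\Gamma$, and $u^s=u^s(\cdot;z)$ the scattered field. Let $\overline{B_R}\subset D$, $\overline D\subset B_\rho$, $\mu=\mathrm{dist}(\partial B_\rho,\partial D)$, $N_0:=\left[\max\left\{\frac{3}{10}(k\rho)^2-1,\,1\right\}\right]$, and $$\sigma_1=\frac{\rho}{R},\qquad \sigma_2=\frac{\rho}{\rho-\mu},\qquad \sigma_3=\frac{\rho-\mu}{R}.$$ Then there exist positive constants $K_1,\dots,K_6$, independent of $N$ and $\delta$, such that for every integer $N\ge N_0$, every $0<\delta<1$ and all noisy data $u^{s,\delta}\in L^2(\partial B_R)$ with $\|u^{s,\delta}-u^s\|_{L^2(\partial B_R)}\le\delta\|u^s\|_{L^2(\partial B_R)}$, $$\|u^s-u_N^{s,\delta}\|_{L^2(\partial B_R)}\le K_1\sigma_1^{-N}+K_2N^{1/2}\delta,$$ $$\|u^s-u_N^{s,\delta}\|_{L^2(\partial D)}\le K_3\sigma_2^{-N}+K_4\sigma_3^{N}\delta,$$ $$\|\partial_\nu u^s-\partial_\nu u_N^{s,\delta}\|_{L^2(\partial D)}\le K_5N\sigma_2^{-N}+K_6N\sigma_3^{N}\delta .$$ Moreover, for $0<\delta<\sigma_1^{-N_0}$ and $N=\left[\frac{1}{\ln\sigma_1}\ln\frac1\delta\right]$, $$\|u^s-u_N^{s,\delta}\|_{L^2(\partial B_R)}\le K_1\delta+\frac{K_2}{\sqrt{\ln\sigma_1}}\,\delta^{1/2},$$ $$\|u^s-u_N^{s,\delta}\|_{L^2(\partial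 D)}\le (K_3+K_4)\,\delta^{\frac{\ln\sigma_2}{\ln\sigma_1}},$$ $$\|\partial_\nu u^s-\partial_\nu u_N^{s,\delta}\|_{L^2(\partial D)}\le \frac{K_5+K_6}{\ln\sigma_1}\,\delta^{\frac{\ln\sigma_2}{\ln\sigma_1}}|\ln\delta| .$$
   Context: Setting: $k>0$ is fixed, $B_r=\{x\in\mathbb{R}^2:|x|<r\}$, and $D\subset\mathbb{R}^2$ is a bounded open simply connected domain with $C^2$ boundary and unit outward normal $\nu$; $k^2$ is not a Dirichlet eigenvalue of $-\Delta$ in $D$. $J_n$ is the Bessel function of the first kind of order $n$, $H_0^{(1)}$ the Hankel function of the first kind of order $0$, and $[\,\cdot\,]$ rounds down to the nearest integer. For $z\in D$ the incident field is $u^i(x;z)=\frac{\mathrm{i}}{4}H_0^{(1)}(k|x-z|)$. The scattered field $u^s=u^s(\cdot;z)\in H^1(D)$ is the solution of $\Delta u^s+k^2u^s=0$ in $D$ with $u^i+u^s=0$ on $\partial D$ (sound-soft) or $\partial(u^i+u^s)/\partial\nu=0$ on $\partial D$ (sound-hard); this problem is assumed to be uniquely solvable. Admissible curve: an open curve $\Gamma$ is called admissible with respect to a domain $\Omega$ if (i) $\Omega\subset D$ is simply connected; (ii) $\partial\Omega$ is analytic homeomorphic to the unit circle $\mathbb{S}^1$; (iii) $k^2$ is not a Dirichlet eigenvalue of $-\Delta$ in $\Omega$; (iv) $\Gamma\subset\partial\Omega$ is a one-dimensional analytic manifold with nonvanishing measure. Here $\Gamma$ and $\Gamma_R$ are admissible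 curves with respect to $\Omega$ and $B_R$, respectively, where $\overline\Omega\subset B_R$ (in particular $k^2$ is not a Dirichlet eigenvalue of $-\Delta$ in $B_R$). It is assumed that $u^s(\cdot;z)$ extends analytically to $B_\rho$ (as a solution of the Helmholtz equation) with trace in $L^2(\partial B_\rho)$. In polar coordinates $x=r(\cos\theta,\sin\theta)$, given noisy data $u^{s,\delta}$ on $\partial B_R$, the approximation is $$u_N^{s,\delta}(x;z)=\sum_{n=-N}^N\hat u_n^\delta(z)\frac{J_n(kr)}{J_n(kR)}\mathrm{e}^{\mathrm{i}n\theta},\qquad \hat u_n^\delta(z)=\frac1{2\pi}\int_0^{2\pi}u^{s,\delta}(R,\theta;z)\mathrm{e}^{-\mathrm{i}n\theta}\,\mathrm{d}\theta,$$ for $R\le r<\rho$. *)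

(* Defs.v *)
From HB Require Import structures.
From mathcomp Require Import all_boot all_order all_algebra.
From mathcomp Require Import all_classical all_reals all_analysis.
From mathcomp Require Export complex.

Set Implicit Arguments.
Unset Strict Implicit.
Unset Printing Implicit Defensive.

Import Order.TTheory GRing.Theory Num.Theory.
Import numFieldNormedType.Exports.

Local Open Scope classical_set_scope.
Local Open Scope ring_scope.
Local Open Scope complex_scope.

(* The plane is the product type [R * R], whose library norm is the sup norm;
   Euclidean lengths are always taken with [enorm].  Complex-valued functions
   are differentiated and integrated through real and imaginary parts. *)

Notation cabs := ComplexField.Normc.normc.

Definition enorm {R : realType} (x : R * R) : R :=
  Num.sqrt (x.1 ^+ 2 + x.2 ^+ 2).

Definition dot {R : realType} (x y : R * R) : R := x.1 * y.1 + x.2 * y.2.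

Definition disk {R : realType} (r : R) : set (R * R) := [set x | enorm x < r].

Definition bdry {R : realType} (A : set (R * R)) : set (R * R) :=
  closure A `\` A°.

Definition set_dist {R : realType} (A B : set (R * R)) : R :=
  inf [set enorm (x - y) | x in A & y in B].

Definition domain {R : realType} (U : set (R * R)) : Prop :=
  [/\ open U, U !=set0 & connected U].

Definition simply_connected {R : realType} (U : set (R * R)) : Prop :=
  connected U /\
  forall f : R -> R * R,
    {within `[0, 1], continuous f} -> f 0 = f 1 -> f @` `[0, 1] `<=` U ->
    exists H : R * R -> R * R,
      [/\ {within `[0, 1] `*` `[0, 1], continuous H},
          H @` (`[0, 1] `*` `[0, 1]) `<=` U,
          forall t, 0 <= t <= 1 -> H (0, t) = f t,
          forall t, 0 <= t <= 1 -> H (1, t) = H (1, 0) &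
          forall s, 0 <= s <= 1 -> H (s, 0) = H (s, 1)].

Definition basis {R : realType} (b : bool) : R * R :=
  if b then (0, 1) else (1, 0).

Fixpoint partials {R : realType} (s : seq bool) (f : R * R -> R) : R * R -> R :=
  if s is b :: s' then fun x => 'D_(basis b) (partials s' f) x else f.

Definition Ck {R : realType} (k : nat) (U : set (R * R)) (f : R * R -> R) :=
  forall s : seq bool, (size s <= k)%N -> forall x, U x ->
    {for x, continuous (partials s f)} /\
    ((size s < k)%N -> forall b, derivable (partials s f) x (basis b)).

Definition smooth {R : realType} (f : R * R -> R) := forall k, Ck k setT f.

Definition lap {R : realType} (f : R * R -> R) (x : R * R) : R :=
  \sum_(b : bool) partials [:: b; b] f x.

(* Absolutely convergent expansion
   f (p + h) = \sum_(i, j) a i j * h.1 ^ i * h.2 ^ j, summed by total degree. *)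
Definition real_analytic {R : realType} (U : set (R * R)) (f : R * R -> R) :=
  forall p, U p -> exists (a : nat -> nat -> R) (r : R), 0 < r /\
    forall h : R * R, enorm h < r ->
      cvgn (series (fun m => \sum_(i < m.+1)
              `| a i (m - i)%N * h.1 ^+ i * h.2 ^+ (m - i) |)) /\
      series (fun m => \sum_(i < m.+1)
              a i (m - i)%N * h.1 ^+ i * h.2 ^+ (m - i)) n @[n --> \oo]
        --> f (p + h).

Definition re_fun {R : realType} {T : Type} (f : T -> R[i]) : T -> R :=
  fun x => complex.Re (f x).
Definition im_fun {R : realType} {T : Type} (f : T -> R[i]) : T -> R :=
  fun x => complex.Im (f x).

Definition cCk {R : realType} (k : nat) (U : set (R * R)) (f : R * R -> R[i]) :=
  Ck k U (re_fun f) /\ Ck k U (im_fun f).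

Definition csmooth {R : realType} (f : R * R -> R[i]) :=
  smooth (re_fun f) /\ smooth (im_fun f).

Definition creal_analytic {R : realType} (U : set (R * R))
    (f : R * R -> R[i]) :=
  real_analytic U (re_fun f) /\ real_analytic U (im_fun f).

Definition cderive {R : realType} (f : R * R -> R[i]) (x v : R * R) : R[i] :=
  'D_v (re_fun f) x +i* 'D_v (im_fun f) x.

Definition clap {R : realType} (f : R * R -> R[i]) (x : R * R) : R[i] :=
  lap (re_fun f) x +i* lap (im_fun f) x.

Definition helmholtz {R : realType} (k : R) (U : set (R * R))
    (u : R * R -> R[i]) :=
  cCk 2 U u /\ forall x, U x -> clap u x + (k ^+ 2)%:C * u x = 0.

Definition dirichlet_eigenvalue {R : realType} (U : set (R * R)) (l : R) :=
  exists v : R * R -> R[i],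
    [/\ cCk 2 U v,
        {within closure U, continuous (re_fun v)} /\
        {within closure U, continuous (im_fun v)},
        forall x, U x -> - clap v x = l%:C * v x,
        forall x, bdry U x -> v x = 0 &
        exists2 x, U x & v x != 0].

Definition velocity {R : realType} (g : R -> R * R) (t : R) : R * R :=
  (derive1 (fun s => (g s).1) t, derive1 (fun s => (g s).2) t).

Definition speed {R : realType} (g : R -> R * R) (t : R) : R :=
  enorm (velocity g t).

(* [g] is a 2 pi-periodic regular parametrisation of the simple closed
   curve [C]; its C^2 or analytic smoothness is required separately. *)
Definition jordan_param {R : realType} (C : set (R * R)) (g : R -> R * R) :=
  [/\ forall t, g (t + 2 * pi) = g t,
      {in `[0, 2 * pi[ &, injective g},
      forall t, velocity g t <> 0 &
      range g = C].

Definition C2_fun {R : realType} (f : R -> R) :=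
  [/\ forall t, derivable f t 1, forall t, derivable (derive1 f) t 1 &
      continuous (derive1 (derive1 f))].

Definition analytic_fun {R : realType} (f : R -> R) :=
  forall t, exists (a : nat -> R) (r : R), 0 < r /\
    forall h, `|h| < r ->
      series (fun m => a m * h ^+ m) n @[n --> \oo] --> f (t + h).

(* The boundary of a bounded simply connected C^2 planar domain is a single
   C^2 Jordan curve, and [g] parametrises it. *)
Definition C2_boundary {R : realType} (D : set (R * R)) (g : R -> R * R) :=
  [/\ jordan_param (bdry D) g, C2_fun (fun t => (g t).1) &
      C2_fun (fun t => (g t).2)].

(* A regular analytic Jordan parametrisation is the same as an analytic
   homeomorphism, with analytic inverse, between the unit circle and the
   boundary. *)
Definition analytic_boundary {R : realType} (D : set (R * R))
    (g : R -> R * R) :=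
  [/\ jordan_param (bdry D) g, analytic_fun (fun t => (g t).1) &
      analytic_fun (fun t => (g t).2)].

Definition outward_unit_normal {R : realType} (D : set (R * R))
    (g : R -> R * R) (nu : R * R -> R * R) :=
  forall t,
    [/\ enorm (nu (g t)) = 1, dot (nu (g t)) (velocity g t) = 0 &
        \forall h \near 0^'+, D (g t - h *: nu (g t)) /\
                              ~ D (g t + h *: nu (g t))].

Definition circle {R : realType} (r t : R) : R * R := (r * cos t, r * sin t).

Definition cint {d} {T : measurableType d} {R : realType}
    (m : {measure set T -> \bar R}) (A : set T) (f : T -> R[i]) : R[i] :=
  Rintegral m A (re_fun f) +i* Rintegral m A (im_fun f).

Definition curve_int {R : realType} (g : R -> R * R) (f : R * R -> R[i])
  : R[i] :=
  cint (@lebesgue_measure R) `[0, 2 * pi]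
       (fun t => f (g t) * (speed g t)%:C).

Definition curve_L2norm {R : realType} (g : R -> R * R) (f : R * R -> R[i])
  : \bar R :=
  ((\int[@lebesgue_measure R]_(t in `[0%R, (2 * pi)%R])
      (cabs (f (g t)) ^+ 2 * speed g t)%R%:E) `^ (2^-1)%R)%E.

Definition curve_L2 {R : realType} (g : R -> R * R) (f : R * R -> R[i]) :=
  [/\ measurable_fun `[0, 2 * pi]
        (re_fun (f \o g) : measurableTypeR R -> R),
      measurable_fun `[0, 2 * pi]
        (im_fun (f \o g) : measurableTypeR R -> R) &
      (curve_L2norm g f < +oo)%E].

(* [measurableTypeR R] is [R] with the Borel structure carried by
   [lebesgue_measure]. *)
Definition leb2 {R : realType} :
    {measure set (measurableTypeR R * measurableTypeR R) -> \bar R} :=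
  @product_measure1 _ _ (measurableTypeR R) (measurableTypeR R) R
    (@lebesgue_measure R) (@lebesgue_measure R).

Definition L2sq {R : realType} (U : set (R * R)) (f : R * R -> R[i]) : \bar R :=
  (\int[leb2]_(x in U) (cabs (f x) ^+ 2)%R%:E)%E.

Definition L2 {R : realType} (U : set (R * R)) (f : R * R -> R[i]) :=
  [/\ measurable_fun U
        (re_fun f : measurableTypeR R * measurableTypeR R -> R),
      measurable_fun U
        (im_fun f : measurableTypeR R * measurableTypeR R -> R) &
      (L2sq U f < +oo)%E].

Definition test_function {R : realType} (U : set (R * R)) (phi : R * R -> R) :=
  smooth phi /\ exists K : set (R * R),
    [/\ compact K, K `<=` U & forall x, ~ K x -> phi x = 0].

(* [u] belongs to H^1(U) and [G] is its weak gradient. *)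
Definition H1 {R : realType} (U : set (R * R)) (u : R * R -> R[i])
    (G : bool -> R * R -> R[i]) :=
  [/\ L2 U u, forall b, L2 U (G b) &
      forall phi, test_function U phi -> forall b,
        cint leb2 U (fun x => u x * (partials [:: b] phi x)%:C) =
        - cint leb2 U (fun x => G b x * (phi x)%:C)].

Definition helmholtz_form {R : realType} (k : R) (U : set (R * R))
    (u : R * R -> R[i]) (G : bool -> R * R -> R[i]) (phi : R * R -> R) : R[i] :=
  cint leb2 U (fun x => \sum_(b : bool) G b x * (partials [:: b] phi x)%:C
                        - (k ^+ 2)%:C * u x * (phi x)%:C).

(* The trace on the curve [g] of the H^1(U) function [u], with weak gradient
   [G], is [w]: [u] is an H^1(U)-limit of functions smooth up to the boundary
   whose boundary values tend to [w] in L^2 of the curve. *)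
Definition H1_trace {R : realType} (U : set (R * R)) (g : R -> R * R)
    (u : R * R -> R[i]) (G : bool -> R * R -> R[i]) (w : R * R -> R[i]) :=
  exists phi : nat -> R * R -> R[i],
    [/\ forall n, csmooth (phi n),
        L2sq U (fun x => phi n x - u x) @[n --> \oo] --> 0%E,
        forall b, L2sq U (fun x => cderive (phi n) x (basis b) - G b x)
                    @[n --> \oo] --> 0%E &
        curve_L2norm g (fun x => phi n x - w x) @[n --> \oo] --> 0%E].

(* [u], defined in the open disk of radius [rho], has a trace in L^2 of the
   bounding circle, attained as the L^2 limit along concentric circles. *)
Definition has_L2_trace {R : realType} (rho : R) (u : R * R -> R[i]) :=
  exists w : R * R -> R[i], curve_L2 (circle rho) w /\
    (\int[@lebesgue_measure R]_(t in `[0%R, (2 * pi)%R])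
       (cabs (u (circle r t) - w (circle rho t)) ^+ 2)%R%:E)%E
      @[r --> rho^'-] --> 0%E.

Definition besselJ_nat {R : realType} (n : nat) (x : R) : R :=
  limn (series (fun m : nat =>
    (-1) ^+ m / (m`! * (m + n)`!)%N%:R * (x / 2) ^+ (2 * m + n)%N)).

(* J_(-n) = (-1)^n J_n, and [Negz m] stands for -(m + 1). *)
Definition besselJ {R : realType} (n : int) (x : R) : R :=
  match n with
  | Posz m => besselJ_nat m x
  | Negz m => (-1) ^+ m.+1 * besselJ_nat m.+1 x
  end.

Definition euler_gamma {R : realType} : R :=
  limn (fun n : nat => series harmonic n - ln n%:R).

(* Here [series harmonic m] is 1 + 1/2 + ... + 1/m. *)
Definition besselY0 {R : realType} (x : R) : R :=
  2 / pi * ((ln (x / 2) + euler_gamma) * besselJ 0 x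
    - limn (series (fun m : nat =>
        (-1) ^+ m * series harmonic m / (m`!)%:R ^+ 2 * (x / 2) ^+ (2 * m)%N))).

Definition hankel0 {R : realType} (x : R) : R[i] :=
  besselJ 0 x +i* besselY0 x.

Definition incident {R : realType} (k : R) (z x : R * R) : R[i] :=
  (0 +i* 4^-1) * hankel0 (k * enorm (x - z)).

Variant cavity_type := SoundSoft | SoundHard.

(* The equation and the sound-hard condition are in weak form, the sound-soft
   condition is in the sense of traces; [g] parametrises the boundary of [D]
   and [nu] is its outward unit normal.  With u^i smooth near the boundary, the
   condition that the total field have zero normal derivative is
   \int_D (grad u . grad phi - k^2 u phi)
     = - \int_(bdry D) (d u^i / d nu) phi ds  for all smooth phi. *)
Definition scattered_field {R : realType} (bc : cavity_type) (k : R)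
    (D : set (R * R)) (g : R -> R * R) (nu : R * R -> R * R) (z : R * R)
    (u : R * R -> R[i]) : Prop :=
  exists G : bool -> R * R -> R[i],
    [/\ H1 D u G,
        forall phi, test_function D phi -> helmholtz_form k D u G phi = 0 &
        match bc with
        | SoundSoft => H1_trace D g u G (fun x => - incident k z x)
        | SoundHard => forall phi, smooth phi ->
            helmholtz_form k D u G phi =
            - curve_int g
                (fun x => cderive (incident k z) x (nu x) * (phi x)%:C)
        end].

Definition uniquely_solvable {R : realType} (bc : cavity_type) (k : R)
    (D : set (R * R)) (g : R -> R * R) (nu : R * R -> R * R) : Prop :=
  forall z, D z ->
    (exists u, scattered_field bc k D g nu z u) /\
    (forall u v, scattered_field bc k D g nu z u ->
       scattered_field bc k D g nu z v ->
       {ae @leb2 R, forall x, D x -> u x = v x}).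

Definition analytic_1manifold {R : realType} (C : set (R * R)) :=
  forall p, C p -> exists (U : set (R * R)) (psi : R * R -> R),
    [/\ open U, U p, real_analytic U psi,
        forall x, U x -> exists b, partials [:: b] psi x != 0 &
        forall x, U x -> (C x <-> psi x = 0)].

(* "Open curve": connected, and relatively open in the boundary of [Om]. *)
Definition admissible {R : realType} (k : R) (D Om C : set (R * R)) : Prop :=
  [/\ [/\ domain Om, Om `<=` D & simply_connected Om],
      ~ dirichlet_eigenvalue Om (k ^+ 2),
      connected C,
      exists2 U, open U & C = bdry Om `&` U &
      analytic_1manifold C /\
      exists2 g : R -> R * R, analytic_boundary Om g &
        (0 < \int[@lebesgue_measure R]_(t in `[0%R, (2 * pi)%R] `&` g @^-1` C)
               (speed g t)%:E)%E].

Definition cexp {R : realType} (t : R) : R[i] := cos t +i* sin t.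

Definition fourier_coef {R : realType} (r : R) (f : R * R -> R[i]) (n : int)
  : R[i] :=
  ((2 * pi)^-1)%:C *
  cint (@lebesgue_measure R) `[0, 2 * pi]
       (fun t => f (circle r t) * cexp (- (n%:~R * t))).

(* e^(i n theta), theta being the polar angle of x != 0, is the n-th power of
   x / |x|; see [fourier_bessel_polar]. *)
Definition angular {R : realType} (n : int) (x : R * R) : R[i] :=
  (x.1 / enorm x +i* (x.2 / enorm x)) ^ n.

Definition fourier_bessel {R : realType} (k r : R) (f : R * R -> R[i]) (N : nat)
    (x : R * R) : R[i] :=
  \sum_(j < (2 * N)%N.+1) let n := (j : nat)%:Z - N%:Z in
    fourier_coef r f n *
    (besselJ n (k * enorm x) / besselJ n (k * r))%:C * angular n x.

Lemma enorm_circle {R : realType} (r t : R) : 0 <= r -> enorm (circle r t) = r.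
Proof.
move=> r0; rewrite /enorm /circle /= !exprMn -mulrDr cos2Dsin2 mulr1.
by rewrite sqrtr_sqr ger0_norm.
Qed.

Lemma cexpX {R : realType} (t : R) (m : nat) : cexp t ^+ m = cexp (m%:R * t).
Proof.
elim: m => [|m IH]; first by rewrite mul0r expr0 /cexp cos0 sin0.
rewrite exprS IH -natr1 mulrDl mul1r /cexp cosD sinD /=.
by apply/eqP; rewrite eq_complex /=; apply/andP; split; apply/eqP;
  rewrite ?[sin t * _]mulrC ?[cos t * _]mulrC // addrC.
Qed.

Lemma cexpXz {R : realType} (t : R) (n : int) : cexp t ^ n = cexp (n%:~R * t).
Proof.
case: n => m; first by rewrite -exprnP cexpX.
rewrite NegzE -exprnN cexpX -[RHS]mul1r.
set s := m.+1%:R * t.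
have -> : (- m.+1%:Z)%:~R * t = - s by rewrite rmorphN mulNr.
have cc : cexp s * cexp (- s) = 1.
  by rewrite /cexp cosN sinN; apply/eqP; rewrite eq_complex /= mulrN opprK
    -!expr2 cos2Dsin2 mulrN addrC [sin s * _]mulrC subrr !eqxx.
have s0 : cexp s != 0.
  by apply/eqP => e; move: cc; rewrite e mul0r => /eqP; rewrite eq_sym oner_eq0.
by apply: (mulfI s0); rewrite mulfV // mul1r cc.
Qed.

Lemma fourier_bessel_polar {R : realType} (k r : R) (f : R * R -> R[i])
    (N : nat) (s t : R) : 0 < s ->
  fourier_bessel k r f N (circle s t) =
  \sum_(j < (2 * N)%N.+1) let n := (j : nat)%:Z - N%:Z in
    fourier_coef r f n *
    (besselJ n (k * s) / besselJ n (k * r))%:C * cexp (n%:~R * t).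
Proof.
move=> s0; have es : enorm (circle s t) = s by rewrite enorm_circle ?ltW.
have ea (n : int) : angular n (circle s t) = cexp (n%:~R * t).
  rewrite -cexpXz /angular es /circle [fst _]/= [snd _]/=.
  have sn : s != 0 by rewrite gt_eqF.
  by rewrite (mulrC s (cos t)) (mulrC s (sin t)) !mulfK.
by rewrite /fourier_bessel es; apply: eq_bigr => j _; rewrite ea.
Qed.

(* Main.v *)
Require Import Defs.
From mathcomp Require Import all_boot all_order all_algebra.
From mathcomp Require Import all_classical all_reals all_analysis.
From mathcomp Require Import complex measurable_realfun.
From mathcomp Require Import ring lra zify.

Set Implicit Arguments.
Unset Strict Implicit.
Unset Printing Implicit Defensive.

Import Order.TTheory GRing.Theory Num.Theory.
Import numFieldNormedType.Exports.

Local Open Scope classical_set_scope.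
Local Open Scope ring_scope.

(* Split the field into real and imaginary parts and expand on circles |x| = r
   in the real orthogonal family cas(n t) = cos(n t) + sin(n t), n in Z.  The
   coefficients of a Helmholtz solution solve Bessel's equation in r, and their
   Wronskian with r^n besselG n (k^2 r^2), a multiple of J_n(k r), vanishes at the
   origin; so they are multiples of J_|n|(k r), for all r < rho.  The L^2 trace on
   |x| = rho bounds them by C (r / rho)^|n|, which gives the truncation error in
   the sup norm, for the field and for its radial and angular derivatives.  The
   data error is amplified by at most C (r / Rad)^|n| mode by mode, and on |x| = Rad
   Bessel's inequality replaces the number of modes by its square root.  Points of
   the boundary of D satisfy Rad < |x| <= rho - mu.  The constants K1, K3 and K5
   carry an extra factor sigma, which absorbs the rounding of N in the last part. *)

(** * Bessel functions as entire functions *)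

(** The zeros of the Bessel functions shape the proof. At [Rad] there is none, since J_n(k Rad) = 0
    would make J_n(k r) cos(n theta) a Dirichlet eigenfunction of the disk; but J_n(k r) may vanish
    between [Rad] and [rho], or at [rho]. Proportionality is therefore stated in cross-multiplied
    form at r = [Rad] and carried outward by uniqueness for the radial system, never by dividing by
    J_n(k r). Bounds uniform in n rest on n! [besselG n s] -> 1: up to finitely many n, J_n(k r) is
    comparable to (k r / 2)^n / n!, so the factorials cancel in every ratio, and the exceptional n
    go into the constants. The cas family is available because J_n(k r) / J_n(k Rad) depends only on
    |n|: with such weights the symmetric partial sums in cas and in exponentials agree, and the real
    and imaginary parts of the field decouple. *)

Definition bessel_coef {R : realType} (n m : nat) : R :=
  (-1) ^+ m / (m`! * (m + n)`!)%N%:R / 4 ^+ m.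

(* J_n(x) = (x/2)^n besselG n (x^2); unlike J_n, besselG n is an entire
   function of x^2, so it is smooth at the origin of the plane. *)
Definition besselG {R : realType} (n : nat) (s : R) : R :=
  limn (pseries (bessel_coef n) s).

Section BesselSeries.
Context {R : realType}.
Implicit Types (s x : R) (n m : nat).

(** Since (m + n)! >= n!, the series is dominated by an exponential one. The factor 1 / n! kept in
    front is what later cancels in ratios. *)
Lemma bessel_coef_le n m s :
  `|bessel_coef n m * s ^+ m| <= n`!%:R^-1 * exp_coeff (`|s| / 4) m.
Proof.
rewrite /bessel_coef /exp_coeff /= !normrM normrX normrN1 expr1n mul1r.
rewrite !normfV !normrX (ger0_norm (ler0n _ _)) (ger0_norm (ler0n _ 4)).
rewrite expr_div_n natrM invfM.
have h : (m + n)`!%:R^-1 <= n`!%:R^-1 :> R.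
  rewrite lef_pV2 ?posrE ?ltr0n ?fact_gt0 // ler_nat.
  by rewrite leq_fact ?leq_addl.
rewrite [leRHS](_ : _ = m`!%:R^-1 * n`!%:R^-1 / 4 ^+ m * `|s| ^+ m); last by ring.
rewrite ler_wpM2r ?exprn_ge0 // ler_wpM2r ?invr_ge0 ?exprn_ge0 //.
by rewrite ler_wpM2l ?invr_ge0.
Qed.

Lemma is_cvg_normed_bessel n s :
  cvgn [normed (pseries (bessel_coef n) s)].
Proof.
apply: (@series_le_cvg _ _ (n`!%:R^-1 *: exp_coeff (`|s| / 4))) => [m|m|m|].
- exact: normr_ge0.
- rewrite -[leRHS]/(_ * _) mulr_ge0 ?invr_ge0 // /exp_coeff /=.
  by rewrite divr_ge0 ?exprn_ge0 ?divr_ge0.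
- exact: bessel_coef_le.
- apply: is_cvg_seriesZ; exact: is_cvg_series_exp_coeff.
Qed.

Lemma is_cvg_bessel n s : cvgn (pseries (bessel_coef n) s).
Proof. exact/normed_cvg/is_cvg_normed_bessel. Qed.

(** Termwise form of G_n' = - G_(n+1) / 4, that is, of (J_n / x^n)' = - J_(n+1) / x^n. *)
Lemma bessel_coef_diffs n :
  pseries_diffs (bessel_coef n) = (- 4^-1) *: bessel_coef n.+1 :> (R^nat).
Proof.
apply/funext => m; rewrite /pseries_diffs /bessel_coef /GRing.scale /=.
rewrite addSnnS factS !natrM !exprS.
have h1 : (m.+1%:R : R) != 0 by rewrite pnatr_eq0.
have h2 : (m`!%:R : R) != 0 by rewrite pnatr_eq0 -lt0n fact_gt0.
have h3 : ((m + n.+1)`!%:R : R) != 0 by rewrite pnatr_eq0 -lt0n fact_gt0.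
have h4 : (4 ^+ m : R) != 0 by rewrite expf_neq0.
by rewrite -[RHS]/(_ * _); field; rewrite ?h4 ?h3 ?h2 ?nat1r ?h1 ?andbT.
Qed.

Lemma pseriesZ (c : R) (f : R^nat) x : pseries (c *: f) x = c *: pseries f x.
Proof.
apply/funext => m; rewrite -[RHS]/(_ * _) /pseries /series /= mulr_sumr.
by apply: eq_bigr => i _; rewrite mulrA.
Qed.

Lemma is_derive_besselG n s :
  is_derive s (1 : R) (besselG n) (- besselG n.+1 s / 4).
Proof.
have -> : - besselG n.+1 s / 4 = limn (pseries (pseries_diffs (bessel_coef n)) s).
  rewrite bessel_coef_diffs pseriesZ limZl_tmp; last exact: is_cvg_bessel.
  by rewrite /besselG -[RHS]/(_ * _); ring.
apply: (@pseries_snd_diffs _ _ (`|s| + 1)).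
- exact: is_cvg_bessel.
- rewrite bessel_coef_diffs pseriesZ; apply: is_cvgZl_tmp; exact: is_cvg_bessel.
- rewrite bessel_coef_diffs.
  have -> : pseries_diffs ((- 4^-1) *: bessel_coef n.+1) =
    (- 4^-1) *: pseries_diffs (bessel_coef n.+1 : R^nat).
    by apply/funext => m; rewrite -[RHS]/(_ * _) -[LHS]/(_ * (_ * _)) mulrCA.
  rewrite bessel_coef_diffs !pseriesZ; do 2 apply: is_cvgZl_tmp.
  exact: is_cvg_bessel.
- by rewrite [ltRHS]ger0_norm ?addr_ge0 // ltrDl.
Qed.

Lemma besselG_bound n s : `|besselG n s| <= n`!%:R^-1 * expR (`|s| / 4).
Proof.
apply: (le_trans (lim_series_norm (@is_cvg_normed_bessel n s))).
rewrite /expR -[_ * _]/(_ *: _) -limZl_tmp; last exact: is_cvg_series_exp_coeff.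
rewrite -(_ : series (n`!%:R^-1 *: exp_coeff (`|s| / 4)) = n`!%:R^-1 *: series (exp_coeff (`|s| / 4))); last first.
  by apply/funext => m; rewrite -[RHS]/(_ * _) /series /= mulr_sumr.
apply: lim_series_le.
- exact: is_cvg_normed_bessel.
- apply: is_cvg_seriesZ; exact: is_cvg_series_exp_coeff.
- move=> m; exact: bessel_coef_le.
Qed.

Lemma besselG0 n : besselG n 0 = n`!%:R^-1 :> R.
Proof.
have : series (fun m => bessel_coef n m * (0:R) ^+ m) @ \oo --> (n`!%:R^-1 : R).
  rewrite -(cvg_shiftS (series _)) /=.
  apply: cvg_near_cst; near=> m.
  rewrite /series /= big_nat_recl // big1 => [|i _].
    by rewrite /bessel_coef !expr0 fact0 mul1n add0n !mul1r divr1 mulr1 addr0.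
  by rewrite exprS mul0r mulr0.
by move/cvg_lim => h; rewrite /besselG; apply: h.
Unshelve. all: by end_near.
Qed.

(* n! besselG n s = 1 - s/(4(n+1)) + ... *)
Lemma besselG_near1 n s :
  `|besselG n s * n`!%:R - 1| <= expR (`|s| / 4) / n.+1%:R.
Proof.
pose f := fun m => bessel_coef n m.+1 * s ^+ m.+1.
have cs := @is_cvg_bessel n s.
have n0 : (n`!%:R : R) != 0 by rewrite pnatr_eq0 -lt0n fact_gt0.
have tail m : pseries (bessel_coef n) s m.+1 = n`!%:R^-1 + series f m.
  rewrite /pseries /series /= big_nat_recl //.
  by rewrite /bessel_coef !expr0 fact0 mul1n add0n !mul1r divr1 mulr1.
(* The quotient n! / (m + 1 + n)! is at most 1 / (n + 1), which supplies the decay in n; what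
   remains is the exponential series without its first term. *)
have le m : `|n`!%:R * f m| <= n.+1%:R^-1 * exp_coeff (`|s| / 4) m.+1.
  rewrite /f /bessel_coef /exp_coeff /= !normrM normrX normrN1 expr1n mul1r.
  rewrite !normfV !normrX (ger0_norm (ler0n _ _)) (ger0_norm (ler0n _ 4)).
  rewrite (ger0_norm (ler0n _ _)) expr_div_n natrM invfM.
  have h : n`!%:R * (m.+1 + n)`!%:R^-1 <= n.+1%:R^-1 :> R.
    rewrite ler_pdivrMr ?ltr0n ?fact_gt0 // mulrC ler_pdivlMr ?ltr0n //.
    by rewrite -natrM ler_nat mulnC -factS leq_fact // addSn ltnS leq_addl.
  rewrite [leLHS](_ : _ = (n`!%:R * (m.+1 + n)`!%:R^-1) * (m.+1`!%:R^-1 / 4 ^+ m.+1 * `|s| ^+ m.+1)); last by ring.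
  rewrite [leRHS](_ : _ = n.+1%:R^-1 * (m.+1`!%:R^-1 / 4 ^+ m.+1 * `|s| ^+ m.+1)); last by ring.
  by rewrite ler_wpM2r // !mulr_ge0 ?invr_ge0 ?exprn_ge0.
have hm (m : nat) : `|n`!%:R * series f m| <= expR (`|s| / 4) / n.+1%:R.
  rewrite /series /= mulr_sumr (le_trans (ler_norm_sum _ _ _)) //.
  apply: le_trans (ler_sum _ (fun i _ => le i)) _.
  rewrite -mulr_sumr mulrC ler_pM2r ?invr_gt0 ?ltr0n //.
  have p i : 0 <= exp_coeff (`|s| / 4) i :> R.
    by rewrite /exp_coeff /= divr_ge0 ?exprn_ge0 ?divr_ge0.
  apply: (@le_trans _ _ (series (exp_coeff (`|s| / 4)) m.+1)).
    by rewrite /series /= [leRHS]big_nat_recl // lerDr.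
  rewrite /expR; apply: nondecreasing_cvgn_le => //.
    by apply: nondecreasing_series.
  exact: is_cvg_series_exp_coeff.
have c1 : (fun m => pseries (bessel_coef n) s m.+1) @ \oo --> besselG n s.
  by rewrite cvg_shiftS.
have c2 : (fun m => `|pseries (bessel_coef n) s m.+1 * n`!%:R - 1|) @ \oo
    --> `|besselG n s * n`!%:R - 1|.
  by apply: cvg_norm; apply: cvgB; [apply: cvgM => //; exact: cvg_cst|exact: cvg_cst].
rewrite -(cvg_lim _ c2) //; apply: limr_le; first by apply/cvg_ex; eexists; exact: c2.
near=> m; rewrite tail mulrDl mulVf // [1 + _]addrC addrK mulrC; exact: hm.
Unshelve. all: by end_near.
Qed.

(** This is the recurrence J_n + J_(n+2) = (2 (n + 1) / x) J_(n+1) with s = x^2. The m-th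
    coefficient of G_n is m + n + 1 times that of G_(n+1), and the weight m amounts to applying s
    d/ds. *)
Lemma besselG_ode n s :
  s / 4 * besselG n.+2 s - n.+1%:R * besselG n.+1 s + besselG n s = 0.
Proof.
(* The series of s G_(n+1)'(s), whose sum is - (s / 4) G_(n+2)(s). *)
pose D m : R := m%:R * bessel_coef n.+1 m * s ^+ m.
have c1 : series D @ \oo --> - (s / 4) * besselG n.+2 s.
  have := @pseries_diffs_equiv _ (bessel_coef n.+1) s.
  rewrite bessel_coef_diffs pseriesZ => /(_ _)/wrap[].
    by apply: is_cvgZl_tmp; exact: is_cvg_bessel.
  rewrite limZl_tmp; last exact: is_cvg_bessel.
  move=> /(cvgZl_tmp (k := s)) h.
  rewrite (_ : - (s / 4) * besselG n.+2 s = s *: (- 4^-1 *: limn (pseries (bessel_coef n.+2) s))); last first.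
    by rewrite -[RHS]/(_ * (_ * _)) /besselG; ring.
  apply: cvg_trans h; apply: near_eq_cvg; near=> m.
  rewrite -[LHS]/(_ * _) /series /= mulr_sumr; apply: eq_bigr => i _.
  by rewrite /D; case: i => [|i]; rewrite ?mul0r ?mulr0 //= exprS; ring.
have c2 : pseries (bessel_coef n.+1) s @ \oo --> besselG n.+1 s by exact: is_cvg_bessel.
have c3 : pseries (bessel_coef n) s @ \oo --> besselG n s by exact: is_cvg_bessel.
have : (fun m => series D m + n.+1%:R * pseries (bessel_coef n.+1) s m) @ \oo --> besselG n s.
  apply: cvg_trans c3; apply: near_eq_cvg; near=> m.
  rewrite /pseries /series /= mulr_sumr -big_split /=; apply: eq_bigr => i _.
  have key : bessel_coef n i = (i%:R + n.+1%:R) * bessel_coef n.+1 i :> R.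
    rewrite -natrD /bessel_coef addnS factS !natrM.
    have h1 : ((i + n).+1%:R : R) != 0 by rewrite pnatr_eq0.
    have h2 : (i`!%:R : R) != 0 by rewrite pnatr_eq0 -lt0n fact_gt0.
    have h3 : ((i + n)`!%:R : R) != 0 by rewrite pnatr_eq0 -lt0n fact_gt0.
    have h4 : (4 ^+ i : R) != 0 by rewrite expf_neq0.
    by field; rewrite h4 h3 h2 -natrD nat1r h1.
  by rewrite key /D; ring.
have h : (fun m => series D m + n.+1%:R * pseries (bessel_coef n.+1) s m) @ \oo -->
   - (s / 4) * besselG n.+2 s + n.+1%:R * besselG n.+1 s.
  by apply: cvgD => //; apply: cvgM => //; exact: cvg_cst.
move=> h'; rewrite -(cvg_lim (@Rhausdorff R) h') (cvg_lim (@Rhausdorff R) h); ring.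
Unshelve. all: by end_near.
Qed.

Lemma besselJ_natE n x : besselJ_nat n x = (x / 2) ^+ n * besselG n (x ^+ 2).
Proof.
rewrite /besselJ_nat /besselG -[RHS]/(_ *: _) -limZl_tmp; last exact: is_cvg_bessel.
set u := series _; set v := (_ *: _); suff -> : u = v by [].
apply/funext => m; rewrite -[RHS]/(_ * _) /pseries /series /= mulr_sumr; apply: eq_bigr => i _.
have -> : (x / 2) ^+ (2 * i + n) = (x / 2) ^+ n * ((x ^+ 2) ^+ i / 4 ^+ i).
  have e : (x / 2) ^+ 2 = x ^+ 2 / 4 by field.
  by rewrite exprD [LHS]mulrC exprM e; congr (_ * _); rewrite expr_div_n.
by rewrite /bessel_coef; ring.
Qed.

End BesselSeries.

(** * Differential calculus in the plane *)

Section Gradient.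
Context {R : realType}.
Implicit Types (f g : R * R -> R) (p q v : R * R) (a b c d : R).

(* Caratheodory's form of differentiability: it turns the product and chain
   rules into algebraic identities between continuous functions. *)
Definition has_grad f p a b := exists al be : R * R -> R,
  [/\ {for p, continuous al}, {for p, continuous be}, al p = a, be p = b &
    \forall q \near p, f q = f p + (q.1 - p.1) * al q + (q.2 - p.2) * be q].

Definition C1on (U : set (R * R)) f fx fy := forall p, U p ->
  [/\ has_grad f p (fx p) (fy p), {for p, continuous fx} &
      {for p, continuous fy}].

Lemma is_derive_cvg (V : normedModType R) (f : V -> R) (x v : V) (l : R) :
  h^-1 *: (f (h *: v + x) - f x) @[h --> 0^'] --> l -> is_derive x v f l.
Proof.
move=> h; split; first by apply/cvg_ex; exists l.
exact/(cvg_lim (@Rhausdorff R) h).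
Qed.

Lemma is_derive_cvgP (V : normedModType R) (f : V -> R) (x v : V) (l : R) :
  is_derive x v f l -> h^-1 *: (f (h *: v + x) - f x) @[h --> 0^'] --> l.
Proof. by case=> df <-. Qed.

Lemma has_grad_continuous f p a b : has_grad f p a b -> {for p, continuous f}.
Proof.
move=> [al [be [ca cb _ _ E]]].
have c : (fun q => f p + (q.1 - p.1) * al q + (q.2 - p.2) * be q) @ p -->
    f p + (p.1 - p.1) * al p + (p.2 - p.2) * be p.
  by do 2?apply: cvgD; do ?[apply: cvgM => //]; do ?[exact: cvg_cst];
   apply: cvgB; try exact: cvg_cst; [exact: cvg_fst|exact: cvg_snd].
rewrite !subrr !mul0r !addr0 in c.
by apply: cvg_trans c; apply: near_eq_cvg; near=> q; apply/esym; near: q.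
Unshelve. all: by end_near.
Qed.

Lemma is_derive1_continuous (u : R -> R) t a :
  is_derive t (1 : R) u a -> {for t, continuous u}.
Proof.
by move=> [du _]; apply/differentiable_continuous/derivable1_diffP.
Qed.

Lemma has_grad_curve f (u w : R -> R) t c d a b :
  is_derive t (1 : R) u c -> is_derive t (1 : R) w d ->
  has_grad f (u t, w t) a b ->
  is_derive t (1 : R) (fun s => f (u s, w s)) (c * a + d * b).
Proof.
move=> du dw [al [be [ca cb <- <- E]]].
have cu := is_derive1_continuous du; have cw := is_derive1_continuous dw.
have cuw : (u s, w s) @[s --> t] --> (u t, w t) by exact: (cvg_pair cu cw).
have sh : h *: (1 : R) + t @[h --> 0^'] --> t.
  have : h *: (1 : R) + t @[h --> (0 : R)] --> (0 : R) *: (1 : R) + t.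
    apply: cvgD; last exact: cvg_cst.
    by apply: (@cvgM _ _ _ _ id (cst 1)); [exact: cvg_id|exact: cvg_cst].
  by rewrite scale0r add0r; apply: cvg_trans; apply: cvg_app; exact: cvg_within.
apply: is_derive_cvg.
have := cvgD (cvgM (is_derive_cvgP du) (cvg_comp _ _ sh (cvg_comp _ _ cuw ca)))
  (cvgM (is_derive_cvgP dw) (cvg_comp _ _ sh (cvg_comp _ _ cuw cb))).
move=> /(_ _ _ _) H; apply: (cvg_trans _ H); apply: near_eq_cvg; near=> h.
have -> : f (u (h *: 1 + t), w (h *: 1 + t)) = f (u t, w t)
   + (u (h *: 1 + t) - u t) * al (u (h *: 1 + t), w (h *: 1 + t))
   + (w (h *: 1 + t) - w t) * be (u (h *: 1 + t), w (h *: 1 + t)).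
  by near: h; exact: (sh _ (cuw _ E)).
rewrite -[RHS]/(_ * _) -[LHS]/(_ * _ * _ + _ * _ * _) /=; ring.
Unshelve. all: by end_near.
Qed.

Lemma has_grad_dir f p v a b : has_grad f p a b ->
  is_derive p v f (v.1 * a + v.2 * b).
Proof.
move=> gf; apply: is_derive_cvg.
have d i : is_derive (0 : R) (1 : R) (fun s => s * i.1 + i.2 : R) (i.1 : R).
  by apply: is_derive_eq; rewrite /GRing.scale /= mulr0 add0r mulr1 addr0.
have := @has_grad_curve f _ _ 0 _ _ a b (d (v.1, p.1)) (d (v.2, p.2)).
rewrite /= !mul0r !add0r -surjective_pairing => /(_ gf)/is_derive_cvgP H.
apply: (cvg_trans _ H); apply: near_eq_cvg; near=> h.
rewrite -[h%:A]/(h * 1) mulr1 addr0 !mul0r !add0r -surjective_pairing.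
by case: (p) (v) => [x y] [x' y'].
Unshelve. all: by end_near.
Qed.

Lemma has_grad_cst c p : has_grad (fun=> c) p 0 0.
Proof.
exists (fun=> 0), (fun=> 0); split => //; try exact: cvg_cst.
by near=> q; rewrite !mulr0 !addr0.
Unshelve. all: by end_near.
Qed.

Lemma has_grad_fst p : has_grad fst p 1 0.
Proof.
exists (fun=> 1), (fun=> 0); split => //; try exact: cvg_cst.
by near=> q; rewrite mulr0 mulr1 addr0 addrC subrK.
Unshelve. all: by end_near.
Qed.

Lemma has_grad_snd p : has_grad snd p 0 1.
Proof.
exists (fun=> 0), (fun=> 1); split => //; try exact: cvg_cst.
by near=> q; rewrite mulr0 mulr1 addr0 addrC subrK.
Unshelve. all: by end_near.
Qed.

Lemma has_gradD f g p a b c d : has_grad f p a b -> has_grad g p c d ->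
  has_grad (fun q => f q + g q) p (a + c) (b + d).
Proof.
move=> [al [be [ca cb <- <- E]]] [al' [be' [ca' cb' <- <- E']]].
exists (fun q => al q + al' q), (fun q => be q + be' q); split => //.
- exact: cvgD.
- exact: cvgD.
- near=> q; rewrite (near E q) // (near E' q) //; ring.
Unshelve. all: by end_near.
Qed.

Lemma has_gradM f g p a b c d : has_grad f p a b -> has_grad g p c d ->
  has_grad (fun q => f q * g q) p (a * g p + f p * c) (b * g p + f p * d).
Proof.
move=> F G; have cg := has_grad_continuous G.
move: F G => [al [be [ca cb <- <- E]]] [al' [be' [ca' cb' <- <- E']]].
exists (fun q => al q * g q + f p * al' q), (fun q => be q * g q + f p * be' q).
split => //.
- by apply: cvgD; apply: cvgM => //; exact: cvg_cst.
- by apply: cvgD; apply: cvgM => //; exact: cvg_cst.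
- near=> q; rewrite (near E q) // [in LHS](near E' q) // [in RHS](near E' q) //; ring.
Unshelve. all: by end_near.
Qed.

Lemma has_grad_comp (u : R -> R) f p c a b :
  is_derive (f p) (1 : R) u c -> has_grad f p a b ->
  has_grad (fun q => u (f q)) p (c * a) (c * b).
Proof.
move=> du F; have cf := has_grad_continuous F.
move: F => [al [be [ca cb <- <- E]]].
(* The difference quotient of [u] at [f p], completed by the derivative [c], is continuous there;
   multiplying it into [al] and [be] gives the new factors. *)
pose th s : R := if s == f p then c else (u s - u (f p)) / (s - f p).
have cth : {for f p, continuous th}.
  have := is_derive_cvgP du => /cvgrPdist_lt h.
  apply/cvgrPdist_lt => e e0; have := h e e0; rewrite /th eqxx.
  move=> /nbhs_ballP[r /= r0 hr].
  apply/nbhs_ballP; exists r => //= s; rewrite /ball /= => sr.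
  case: eqVneq => [_|ne]; first by rewrite subrr normr0.
  have B : ball (0 : R) r (s - f p) by rewrite /ball /= sub0r normrN distrC.
  have := hr _ B; rewrite subr_eq0 => /(_ ne) /=.
  by rewrite -[(s - f p)%:A]/((s - f p) * 1) mulr1 subrK -[_ *: _]/(_ * _) mulrC.
have thE s : u s = u (f p) + (s - f p) * th s.
  rewrite /th; case: eqVneq => [->|ne]; first by rewrite subrr mul0r addr0.
  by rewrite mulrC divfK ?subr_eq0 // addrC subrK.
have cthf : {for p, continuous (fun q => th (f q))} by exact: cvg_comp cf cth.
exists (fun q => th (f q) * al q), (fun q => th (f q) * be q); split.
- exact: cvgM.
- exact: cvgM.
- by rewrite /th eqxx.
- by rewrite /th eqxx.
- near=> q; rewrite thE; have := near E q => /(_ _) Eq; rewrite [in X in X * _]Eq //; ring.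
Unshelve. all: by end_near.
Qed.

Lemma partial_is_derive1 f p : derivable f p (Defs.basis false) ->
  is_derive p.1 (1 : R) (fun s => f (s, p.2)) (partials [:: false] f p).
Proof.
move=> df; have : is_derive p (Defs.basis false) f (partials [:: false] f p) by split.
move=> /is_derive_cvgP h; apply: is_derive_cvg; apply: cvg_trans h.
apply: near_eq_cvg; near=> h; rewrite -surjective_pairing.
case: p {df} => x y; congr (_ *: (f _ - _)).
by congr pair; rewrite /= -[_ *: _]/(_ * _) /= mulr0 add0r.
Unshelve. all: by end_near.
Qed.

Lemma partial_is_derive2 f p : derivable f p (Defs.basis true) ->
  is_derive p.2 (1 : R) (fun s => f (p.1, s)) (partials [:: true] f p).
Proof.
move=> df; have : is_derive p (Defs.basis true) f (partials [:: true] f p) by split.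
move=> /is_derive_cvgP h; apply: is_derive_cvg; apply: cvg_trans h.
apply: near_eq_cvg; near=> h; rewrite -surjective_pairing.
case: p {df} => x y; congr (_ *: (f _ - _)).
by congr pair; rewrite /= -[_ *: _]/(_ * _) /= mulr0 add0r.
Unshelve. all: by end_near.
Qed.

End Gradient.

(** * Euclidean norm, disks and circles *)

Section EuclideanPlane.
Context {R : realType}.
Implicit Types (x y p q : R * R) (r s t : R).

Lemma enorm_ge0 x : 0 <= enorm x.
Proof. exact: sqrtr_ge0. Qed.

Lemma sqr_enorm x : enorm x ^+ 2 = x.1 ^+ 2 + x.2 ^+ 2.
Proof. by rewrite /enorm sqr_sqrtr // addr_ge0 ?sqr_ge0. Qed.

Lemma ler_fst_enorm x : `|x.1| <= enorm x.
Proof. by rewrite /enorm -sqrtr_sqr ler_wsqrtr // lerDl sqr_ge0. Qed.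

Lemma ler_snd_enorm x : `|x.2| <= enorm x.
Proof. by rewrite /enorm -sqrtr_sqr ler_wsqrtr // lerDr sqr_ge0. Qed.

Lemma enorm_le_fst_snd x : enorm x <= `|x.1| + `|x.2|.
Proof.
rewrite -(@ler_pXn2r _ 2) ?nnegrE ?enorm_ge0 ?addr_ge0 //.
rewrite sqr_enorm sqrrD !real_normK ?num_real //.
by rewrite -addrA lerD2l lerDr mulrn_wge0 // mulr_ge0.
Qed.

Lemma enorm_scale s x : enorm (s *: x) = `|s| * enorm x.
Proof.
apply/eqP; rewrite -(@eqrXn2 _ 2) ?enorm_ge0 ?mulr_ge0 ?enorm_ge0 //.
rewrite exprMn !sqr_enorm real_normK ?num_real //; case: x => a b /=.
by apply/eqP; rewrite -[s *: a]/(s * a) -[s *: b]/(s * b); ring.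
Qed.

Lemma dot_le_enorm x y : x.1 * y.1 + x.2 * y.2 <= enorm x * enorm y.
Proof.
apply: le_trans (ler_norm _) _.
rewrite -(@ler_pXn2r _ 2) ?nnegrE ?mulr_ge0 ?enorm_ge0 //.
rewrite exprMn !sqr_enorm real_normK ?num_real //.
rewrite -subr_ge0 (_ : _ - _ = (x.1 * y.2 - x.2 * y.1) ^+ 2) ?sqr_ge0 //.
by ring.
Qed.

Lemma enormD x y : enorm (x + y) <= enorm x + enorm y.
Proof.
rewrite -(@ler_pXn2r _ 2) ?nnegrE ?addr_ge0 ?enorm_ge0 //.
rewrite sqrrD !sqr_enorm /=; have := dot_le_enorm x y; lra.
Qed.

Lemma enorm_continuous : continuous (@enorm R).
Proof.
move=> p; apply: continuous_comp; last exact: sqrt_continuous.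
apply: cvgD; apply: cvgM; by [exact: cvg_fst|exact: cvg_snd].
Qed.

Lemma open_disk r : open (disk r : set (R * R)).
Proof.
rewrite (_ : disk r = enorm @^-1` [set x | x < r]) //.
by apply: open_comp => [x _|]; [exact: enorm_continuous|exact: open_lt].
Qed.

Lemma closed_cdisk r : closed [set x : R * R | enorm x <= r].
Proof.
rewrite (_ : [set x | _] = enorm @^-1` [set x | x <= r]) //.
by apply: preimage_closed => [x _|]; [exact: enorm_continuous|exact: closed_le].
Qed.

Lemma compact_cdisk r : compact [set x : R * R | enorm x <= r].
Proof.
apply: (@subclosed_compact _ _ (`[-r, r] `*` `[-r, r])).
- exact: closed_cdisk.
- by apply: compact_setX; exact: segment_compact.
- move=> x /= xr; split => /=; rewrite in_itv /= -ler_norml;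
   apply: le_trans xr; [exact: ler_fst_enorm|exact: ler_snd_enorm].
Qed.

Lemma enorm_closure_disk r x : closure (disk r) x -> enorm x <= r.
Proof.
have h : (disk r : set (R * R)) `<=` [set x : R * R | enorm x <= r].
  by move=> y /ltW.
by move=> /(closureS h); rewrite -(closure_id _).1 //; exact: closed_cdisk.
Qed.

Lemma closure_diskE r : 0 < r -> closure (disk r) = [set x : R * R | enorm x <= r].
Proof.
move=> r0; apply/seteqP; split => x; first exact: enorm_closure_disk.
rewrite /= => xr.
have c : s *: x @[s --> (1 : R)^'-] --> x.
  have : s *: x @[s --> (1 : R)] --> 1 *: x by apply: cvgZr_tmp; exact: cvg_id.
  by rewrite scale1r; apply: cvg_trans; apply: cvg_app; exact: cvg_within.
apply: (@closed_cvg _ _ (1 : R)^'- _ (fun s => s *: x) _ (@closed_closure _ (disk r)) _ _ c).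
near=> s; apply: subset_closure; rewrite /disk /= enorm_scale.
have s1 : s < 1 by near: s; exact: nbhs_left_lt.
have s0 : 0 < s by near: s; exact: nbhs_left_gt.
rewrite gtr0_norm //; apply: le_lt_trans (_ : s * r < r).
  by rewrite ler_pM2l.
by rewrite gtr_pMl.
Unshelve. all: by end_near.
Qed.

Lemma bdry_diskE r : 0 < r -> bdry (disk r) = [set x : R * R | enorm x = r].
Proof.
move=> r0; rewrite /bdry closure_diskE // ((interior_id _).1 (@open_disk r)).
apply/seteqP; split => x /=.
- by move=> [xr]; rewrite /disk /= => /negP; rewrite -leNgt => rx; apply/le_anti/andP.
- by move=> <-; split; rewrite /disk //= ltxx.
Qed.

Lemma compact_bounded (K : set (R * R)) (f : R * R -> R) : compact K ->
  (forall x, K x -> {for x, continuous f}) ->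
  exists2 M, 0 <= M & forall x, K x -> `|f x| <= M.
Proof.
move=> cK cf; have [->|/set0P[x0 Kx0]] := eqVneq K set0; first by exists 0.
have cf' : {within K, continuous (fun x => `|f x|)}.
  apply: continuous_in_subspaceT => x /set_mem Kx.
  by apply: cvg_norm; exact: cf.
have [x Kx xm] := compact_EVT_max (ex_intro _ x0 Kx0) cK cf'.
by exists `|f x| => // y Ky; apply: xm; exact/mem_set.
Qed.

(** Chord length. It turns a Lipschitz bound in the plane into a bound by |sin ((s - t) / 2)|, the
    form that pointwise convergence of Hartley series asks for. *)
Lemma enorm_circleB r s t : 0 <= r ->
  enorm (circle r s - circle r t) = 2 * r * `|sin ((s - t) / 2)|.
Proof.
move=> r0; apply/eqP; rewrite -(@eqrXn2 _ 2) ?enorm_ge0 ?mulr_ge0 //.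
rewrite sqr_enorm exprMn real_normK ?num_real // /circle /=.
have h1 : 1 - cos (s - t) = 2 * sin ((s - t) / 2) ^+ 2.
  rewrite {1}(_ : s - t = (s - t) / 2 + (s - t) / 2); last by field.
  by rewrite cosD -!expr2 cos2sin2; ring.
have h2 : sin ((s - t) / 2) ^+ 2 = (1 - cos (s - t)) / 2 by rewrite h1; field.
rewrite h2 cosB; apply/eqP.
have c1 := cos2Dsin2 s; have c2 := cos2Dsin2 t.
rewrite (_ : (r * cos s - r * cos t) ^+ 2 + (r * sin s - r * sin t) ^+ 2 =
  r ^+ 2 * ((cos s ^+ 2 + sin s ^+ 2) + (cos t ^+ 2 + sin t ^+ 2)
            - 2 * (cos s * cos t + sin s * sin t))); last by ring.
by rewrite c1 c2; field.
Qed.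

Lemma circle_surj x : exists t, x = circle (enorm x) t.
Proof.
have [x0|x0] := eqVneq (enorm x) 0.
  exists 0; have := ler_fst_enorm x; have := ler_snd_enorm x.
  rewrite x0 !normr_le0 => /eqP h2 /eqP h1.
  by rewrite /circle !mul0r; case: x h1 h2 {x0} => a b /= -> ->.
have p : 0 < enorm x by rewrite lt_neqAle eq_sym x0 enorm_ge0.
set c := x.1 / enorm x.
have c1 : -1 <= c <= 1.
  by rewrite -ler_norml /c normrM normfV (gtr0_norm p) ler_pdivrMr // mul1r ler_fst_enorm.
have e1 : x.1 = enorm x * c by rewrite /c mulrC divfK.
have e2 : `|x.2| = enorm x * Num.sqrt (1 - c ^+ 2).
  apply/eqP; rewrite -(@eqrXn2 _ 2) ?mulr_ge0 ?sqrtr_ge0 ?enorm_ge0 //.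
  have E : 0 <= 1 - c ^+ 2.
    by rewrite subr_ge0 -(real_normK (num_real c)) exprn_ile1 // ler_norml.
  rewrite exprMn [Num.sqrt (1 - _) ^+ 2]sqr_sqrtr // real_normK ?num_real //.
  have -> : x.2 ^+ 2 = enorm x ^+ 2 - x.1 ^+ 2 by rewrite sqr_enorm addrC addKr.
  by rewrite /c expr_div_n mulrBr mulr1 [X in _ == _ - X]mulrC divfK // expf_neq0.
have [h|h] := leP 0 x.2.
- exists (acos c); rewrite /circle acosK ?in_itv //= sin_acos // -e1 -e2 ger0_norm //.
  by case: (x).
- exists (- acos c); rewrite /circle cosN sinN acosK ?in_itv //= sin_acos //.
  by rewrite mulrN -e1 -e2 ltr0_norm // opprK; case: (x).
Qed.

End EuclideanPlane.

(** * C^1 functions, with their radial and angular derivatives *)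

Section C1Functions.
Context {R : realType}.
Implicit Types (f fx fy fxx fxy fyx fyy g gx gy : R * R -> R) (p q v : R * R) (U : set (R * R)) (r s t : R).

Lemma mean_value (u du : R -> R) (x y : R) :
  (forall s, Num.min x y <= s <= Num.max x y -> is_derive s (1 : R) u (du s)) ->
  exists2 s, Num.min x y <= s <= Num.max x y & u y - u x = (y - x) * du s.
Proof.
wlog xy : x y / x <= y => [H|].
  have [xy|] := boolP (x <= y); first exact: H.
  rewrite -ltNge => /ltW yx; rewrite minC maxC => h; have [s hs e] := H _ _ yx h.
  by exists s => //; rewrite -[LHS]opprB e -mulNr opprB.
rewrite (min_idPl xy) (max_idPr xy) => h.
have [s|c|s] := @MVT_segment R u du x y xy.
- by rewrite in_itv /= => /andP[a b]; apply: h; rewrite !ltW.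
- apply: derivable_within_continuous => z; rewrite in_itv /= => hz.
  by have [] := h _ hz.
- by rewrite in_itv /= => hs e; exists s => //; rewrite e mulrC.
Qed.

Lemma between_dist (x y s r : R) : Num.min x y <= s <= Num.max x y ->
  `|x - y| < r -> `|x - s| < r.
Proof.
by have [xy|xy] := leP x y; move=> /andP[a b]; rewrite !ltr_norml => /andP[c d];
   apply/andP; split; lra.
Qed.

(** The path from [p] to [q] passes through (p.1, q.2). The factors [al] and [be] are the difference
    quotients along its horizontal and vertical legs, with the partial derivatives at [p] as values
    when a leg degenerates; the mean value theorem makes them continuous at [p]. *)
Lemma C1_has_grad f fx fy p :
  (\forall q \near p, is_derive q.1 (1 : R) (fun s => f (s, q.2)) (fx q)) ->
  (\forall q \near p, is_derive q.2 (1 : R) (fun s => f (q.1, s)) (fy q)) ->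
  {for p, continuous fx} -> {for p, continuous fy} ->
  has_grad f p (fx p) (fy p).
Proof.
move=> dx dy cx cy.
exists (fun q => if q.1 == p.1 then fx p else (f q - f (p.1, q.2)) / (q.1 - p.1)).
exists (fun q => if q.2 == p.2 then fy p else
   (f (p.1, q.2) - f p) / (q.2 - p.2)).
split; rewrite ?eqxx //.
- apply/cvgrPdist_lt => e e0; rewrite eqxx.
  have ncx : \forall q \near p, `|fx p - fx q| < e.
    by move: cx => /cvgrPdist_lt; apply.
  have [r /= r0 H] := (nbhs_ballP _ _).1 (@filterI _ (nbhs p) _ _ _ dx ncx).
  apply: (@filterS _ (nbhs p) _ _ _ _ (nbhsx_ballx p r r0)) => q [B1 B2].
  case: eqVneq => [_|ne]; first by rewrite subrr normr0.
  have [s Hs|s Hs E] := @mean_value (fun s => f (s, q.2)) (fun s => fx (s, q.2)) p.1 q.1.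
    have [|h _] := H (s, q.2); last exact: h.
    by split => //=; exact: (between_dist Hs).
  rewrite -surjective_pairing in E; rewrite E mulrC mulKf ?subr_eq0 //.
  have [|_ h] := H (s, q.2); last exact: h.
  by split => //=; exact: (between_dist Hs).
- apply/cvgrPdist_lt => e e0; rewrite eqxx.
  have ncy : \forall q \near p, `|fy p - fy q| < e.
    by move: cy => /cvgrPdist_lt; apply.
  have [r /= r0 H] := (nbhs_ballP _ _).1 (@filterI _ (nbhs p) _ _ _ dy ncy).
  apply: (@filterS _ (nbhs p) _ _ _ _ (nbhsx_ballx p r r0)) => q [B1 B2].
  case: eqVneq => [_|ne]; first by rewrite subrr normr0.
  have [s Hs|s Hs E] := @mean_value (fun s => f (p.1, s)) (fun s => fy (p.1, s)) p.2 q.2.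
    have [|h _] := H (p.1, s); last exact: h.
    by split => /=; [exact: ballxx|exact: (between_dist Hs)].
  rewrite -surjective_pairing in E; rewrite E mulrC mulKf ?subr_eq0 //.
  have [|_ h] := H (p.1, s); last exact: h.
  by split => /=; [exact: ballxx|exact: (between_dist Hs)].
- near=> q; case: eqVneq => [e1|n1]; case: eqVneq => [e2|n2].
  + by rewrite (_ : q = p) ?subrr ?mul0r ?addr0 //; exact: injective_projections.
  + rewrite e1 subrr mul0r addr0 [X in _ + X]mulrC divfK ?subr_eq0 //.
    by rewrite -e1 -surjective_pairing addrC subrK.
  + rewrite e2 subrr mul0r addr0 [X in _ + X]mulrC divfK ?subr_eq0 //.
    by rewrite -surjective_pairing addrC subrK.
  + rewrite [X in _ + X + _]mulrC divfK ?subr_eq0 //.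
    by rewrite [X in _ + X]mulrC divfK ?subr_eq0 //; ring.
Unshelve. all: by end_near.
Qed.

Lemma Ck_C1on (U : set (R * R)) f k : open U -> Ck k.+2 U f ->
  C1on U f (partials [:: false] f) (partials [:: true] f) /\
  forall b, C1on U (partials [:: b] f) (partials [:: false; b] f)
    (partials [:: true; b] f).
Proof.
move=> oU cf.
have key (s : seq bool) : (size s < 2)%N -> C1on U (partials s f)
   (partials (false :: s) f) (partials (true :: s) f).
  move=> ss p Up; have [|cfx _] := cf (false :: s) _ p Up; first by rewrite /= (leq_trans ss).
  have [|cfy _] := cf (true :: s) _ p Up; first by rewrite /= (leq_trans ss).
  have nU : \forall q \near p, U q by exact: open_nbhs_nbhs.
  split => //; apply: C1_has_grad => //; near=> q.
  - apply: (@partial_is_derive1 _ (partials s f)).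
    have [||_ h] := cf s _ q; [by apply: leq_trans (ltnW ss) _|by near: q|].
    by apply: h; exact: leq_trans ss _.
  - apply: (@partial_is_derive2 _ (partials s f)).
    have [||_ h] := cf s _ q; [by apply: leq_trans (ltnW ss) _|by near: q|].
    by apply: h; exact: leq_trans ss _.
by split => [|b]; exact: key.
Unshelve. all: by end_near.
Qed.

Lemma C1on_continuous U f fx fy : C1on U f fx fy ->
  forall p, U p -> {for p, continuous f}.
Proof. by move=> h p /h[/has_grad_continuous]. Qed.

Lemma C1onD U f fx fy g gx gy : C1on U f fx fy -> C1on U g gx gy ->
  C1on U (fun q => f q + g q) (fun q => fx q + gx q) (fun q => fy q + gy q).
Proof.
move=> F G p Up; have [a b c] := F p Up; have [a' b' c'] := G p Up.
by split; [exact: has_gradD|exact: cvgD|exact: cvgD].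
Qed.

Lemma C1onM U f fx fy g gx gy : C1on U f fx fy -> C1on U g gx gy ->
  C1on U (fun q => f q * g q) (fun q => fx q * g q + f q * gx q)
    (fun q => fy q * g q + f q * gy q).
Proof.
move=> F G p Up; have [a b c] := F p Up; have [a' b' c'] := G p Up.
have h := has_grad_continuous a; have h' := has_grad_continuous a'.
by split; [exact: has_gradM| |]; apply: cvgD; exact: cvgM.
Qed.

Lemma C1on_cst U (c : R) : C1on U (fun=> c) (fun=> 0) (fun=> 0).
Proof. by move=> p _; split; [exact: has_grad_cst| |]; exact: cvg_cst. Qed.

Lemma C1on_fst U : C1on U fst (fun=> 1) (fun=> 0).
Proof. by move=> p _; split; [exact: has_grad_fst| |]; exact: cvg_cst. Qed.

Lemma C1on_snd U : C1on U snd (fun=> 0) (fun=> 1).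
Proof. by move=> p _; split; [exact: has_grad_snd| |]; exact: cvg_cst. Qed.

(** Closed disks are convex, so the mean value theorem applies on the segment from [q] to [p], and
    the partial derivatives are bounded on the smaller disk by compactness. *)
Lemma C1on_lipschitz f fx fy r rho : r < rho -> C1on (disk rho) f fx fy ->
  exists2 L, 0 <= L & forall p q, enorm p <= r -> enorm q <= r ->
    `|f p - f q| <= L * enorm (p - q).
Proof.
move=> rr F.
have sub p : enorm p <= r -> disk rho p by move=> h; exact: le_lt_trans rr.
have [|M M0 hM] := @compact_bounded _ [set x | enorm x <= r] fx (@compact_cdisk _ r).
  by move=> p /sub/F[].
have [|M' M'0 hM'] := @compact_bounded _ [set x | enorm x <= r] fy (@compact_cdisk _ r).
  by move=> p /sub/F[].
exists (M + M'); first exact: addr_ge0.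
move=> p q pr qr; rewrite mulrDl.
pose c s : R * R := (s * (p - q).1 + q.1, s * (p - q).2 + q.2).
have ec s : 0 <= s <= 1 -> enorm (c s) <= r.
  move=> /andP[s0 s1]; have -> : c s = s *: p + (1 - s) *: q.
    rewrite /c; case: (p) (q) => a b [a' b'].
    rewrite -[RHS]/(s * a + (1 - s) * a', s * b + (1 - s) * b') /=.
    by congr pair; ring.
  apply: le_trans (enormD _ _) _; rewrite !enorm_scale ger0_norm // ger0_norm ?subr_ge0 //.
  apply: le_trans (_ : s * r + (1 - s) * r <= _); last by lra.
  by apply: lerD; apply: ler_wpM2l; rewrite ?subr_ge0.
have da (a b s : R) : is_derive s (1 : R) (fun s : R => s * a + b) a.
  by apply: is_derive_eq; rewrite /GRing.scale /= mulr0 add0r mulr1 addr0.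
have [s hs|s] := @mean_value (fun s => f (c s))
  (fun s => (p - q).1 * fx (c s) + (p - q).2 * fy (c s)) 0 1.
  rewrite min_l // max_r // in hs.
  have [G _ _] := F _ (sub _ (ec _ hs)).
  exact: (has_grad_curve (da _ _ _) (da _ _ _) G).
rewrite min_l // max_r // => hs.
have -> : c 1 = p.
  by rewrite /c; case: (p) (q) => a b [a' b'] /=; rewrite !mul1r !subrK.
have -> : c 0 = q by rewrite /c !mul0r !add0r -surjective_pairing.
move=> ->; rewrite subr0 mul1r; apply: le_trans (ler_normD _ _) _; rewrite !normrM.
by apply: lerD; rewrite mulrC; apply: ler_pM => //;
   [exact: hM (ec _ hs)|exact: ler_fst_enorm|exact: hM' (ec _ hs)|exact: ler_snd_enorm].
Qed.

(* Euler operator r d/dr and angular derivative d/dtheta. *)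
Definition radial fx fy : R * R -> R := fun p => p.1 * fx p + p.2 * fy p.
Definition angularD fx fy : R * R -> R := fun p => p.1 * fy p - p.2 * fx p.

Lemma is_derive_circle_radius f fx fy rho r t : 0 < r < rho ->
  C1on (disk rho) f fx fy ->
  is_derive r (1 : R) (fun s => f (circle s t)) (radial fx fy (circle r t) / r).
Proof.
move=> /andP[r0 rr] F.
have Up : disk rho (circle r t) by rewrite /disk /= enorm_circle // ltW.
have [G _ _] := F _ Up.
have da a : is_derive r (1 : R) (fun s : R => s * a) a.
  by apply: is_derive_eq; rewrite /GRing.scale /= mulr0 add0r mulr1.
have := has_grad_curve (da (cos t)) (da (sin t)) G.
move=> /is_derive_eq; apply; rewrite /radial /circle /=.
by field; rewrite gt_eqF.
Qed.

Lemma is_derive_circle_angle f fx fy rho r t : 0 < r < rho ->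
  C1on (disk rho) f fx fy ->
  is_derive t (1 : R) (fun s => f (circle r s)) (angularD fx fy (circle r t)).
Proof.
move=> /andP[r0 rr] F.
have Up : disk rho (circle r t) by rewrite /disk /= enorm_circle // ltW.
have [G _ _] := F _ Up.
have d1 : is_derive t (1 : R) (fun s : R => r * cos s) (- r * sin t).
  by apply: is_derive_eq; rewrite /GRing.scale /=; ring.
have d2 : is_derive t (1 : R) (fun s : R => r * sin s) (r * cos t).
  by apply: is_derive_eq; rewrite /GRing.scale /=; ring.
have := has_grad_curve d1 d2 G.
move=> /is_derive_eq; apply; rewrite /angularD /circle /=; ring.
Qed.

(* r^2 lap f = radial (radial f) + angular (angular f); the two mixed partials
   enter with opposite signs, so that they need not be equal. *)
Lemma C1on_radial U fx fy fxx fxy fyx fyy :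
  C1on U fx fxx fxy -> C1on U fy fyx fyy ->
  C1on U (radial fx fy)
    (fun p => fx p + (p.1 * fxx p + p.2 * fyx p))
    (fun p => fy p + (p.1 * fxy p + p.2 * fyy p)).
Proof.
move=> X Y; have := C1onD (C1onM (@C1on_fst U) X) (C1onM (@C1on_snd U) Y).
by congr (C1on _ _ _ _); apply/funext => p /=; ring.
Qed.

Lemma C1on_angular U fx fy fxx fxy fyx fyy :
  C1on U fx fxx fxy -> C1on U fy fyx fyy ->
  C1on U (angularD fx fy)
    (fun p => fy p + (p.1 * fyx p - p.2 * fxx p))
    (fun p => - fx p + (p.1 * fyy p - p.2 * fxy p)).
Proof.
move=> X Y; have := C1onD (C1onM (@C1on_fst U) Y)
  (C1onM (@C1on_cst U (-1)) (C1onM (@C1on_snd U) X)).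
by congr (C1on _ _ _ _); apply/funext => p /=; rewrite /angularD; ring.
Qed.

Lemma continuous_circle_angle f fx fy rho r : 0 < r < rho ->
  C1on (disk rho) f fx fy -> continuous (fun t => f (circle r t)).
Proof.
move=> rr F t; have := is_derive_circle_angle t rr F.
exact: is_derive1_continuous.
Qed.

End C1Functions.

(** * Cylindrical waves *)

Section PlaneWaves.
Context {R : realType}.
Variable k : R.
Implicit Types (f fx fy g gx gy : R * R -> R) (p q v : R * R) (r s t : R).

(** The quotient of J_n(k |p|) by (k |p| / 2)^n, extended smoothly through the origin. *)
Definition besselP (n : nat) : R * R -> R :=
  fun p => besselG n (k ^+ 2 * (p.1 ^+ 2 + p.2 ^+ 2)).

(* Real and imaginary parts of (x + i y)^n. *)
Fixpoint zpow (n : nat) p : R * R :=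
  if n is m.+1 then (p.1 * (zpow m p).1 - p.2 * (zpow m p).2,
                     p.1 * (zpow m p).2 + p.2 * (zpow m p).1)
  else (1, 0).

Lemma has_grad_eq f p a b c d : has_grad f p a b -> a = c -> b = d ->
  has_grad f p c d.
Proof. by move=> h <- <-. Qed.

Lemma has_gradZ c f p a b : has_grad f p a b ->
  has_grad (fun q => c * f q) p (c * a) (c * b).
Proof.
by move=> h; apply: (has_grad_eq (has_gradM (has_grad_cst c p) h));
  rewrite mul0r add0r.
Qed.

Lemma has_gradB f g p a b c d : has_grad f p a b -> has_grad g p c d ->
  has_grad (fun q => f q - g q) p (a - c) (b - d).
Proof.
move=> F /(has_gradZ (-1))/(has_gradD F).
by under [X in has_grad X]funext do rewrite mulN1r; rewrite !mulN1r.
Qed.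

Lemma has_grad_besselP n p :
  has_grad (besselP n) p (- (k ^+ 2 / 2) * p.1 * besselP n.+1 p)
    (- (k ^+ 2 / 2) * p.2 * besselP n.+1 p).
Proof.
have h := has_gradZ (k ^+ 2) (has_gradD (has_gradM (has_grad_fst p) (has_grad_fst p))
  (has_gradM (has_grad_snd p) (has_grad_snd p))).
have := has_grad_comp (is_derive_besselG n _) h.
rewrite (_ : (fun q => _) = besselP n); last first.
  by apply/funext => q; rewrite /besselP !expr2.
by move/has_grad_eq; apply; rewrite /besselP !expr2; field.
Qed.

(** The identity d(z^n) = n z^(n-1) dz in real and imaginary parts. At n = 0 the factor [n%:R]
    cancels the conventional value of [n.-1]. *)
Lemma has_grad_zpow n p :
  has_grad (fun q => (zpow n q).1) p (n%:R * (zpow n.-1 p).1)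
     (- (n%:R * (zpow n.-1 p).2)) /\
  has_grad (fun q => (zpow n q).2) p (n%:R * (zpow n.-1 p).2)
     (n%:R * (zpow n.-1 p).1).
Proof.
elim: n => [|n [IH1 IH2]] /=.
  by rewrite !mul0r oppr0; split; exact: has_grad_cst.
have e1 : n%:R * (zpow n p).1 = n%:R * (p.1 * (zpow n.-1 p).1 - p.2 * (zpow n.-1 p).2).
  by case: (n) => [|m] //=; rewrite !mul0r.
have e2 : n%:R * (zpow n p).2 = n%:R * (p.1 * (zpow n.-1 p).2 + p.2 * (zpow n.-1 p).1).
  by case: (n) => [|m] //=; rewrite !mul0r.
split.
- have := has_gradB (has_gradM (has_grad_fst p) IH1) (has_gradM (has_grad_snd p) IH2).
  by move/has_grad_eq; apply; rewrite -nat1r mulrDl mul1r ?e1 ?e2; ring.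
- have := has_gradD (has_gradM (has_grad_fst p) IH2) (has_gradM (has_grad_snd p) IH1).
  by move/has_grad_eq; apply; rewrite -nat1r mulrDl mul1r ?e1 ?e2; ring.
Qed.

Lemma zpow_circle n r t :
  zpow n (circle r t) = (r ^+ n * cos (n%:R * t), r ^+ n * sin (n%:R * t)).
Proof.
elim: n => [|n IH] /=; first by rewrite mul0r cos0 sin0 !mulr1 mulr0.
rewrite IH /= -nat1r mulrDl mul1r cosD sinD exprS.
by congr pair; ring.
Qed.

(* The class is stable under partial derivatives, so membership gives smoothness. *)
Inductive entire : (R * R -> R) -> Prop :=
| entire_cst c : entire (fun=> c)
| entire_fst : entire fst
| entire_snd : entire snd
| entire_besselP n : entire (besselP n)
| entireD f g : entire f -> entire g -> entire (fun q => f q + g q)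
| entireM f g : entire f -> entire g -> entire (fun q => f q * g q).

Lemma entire_grad f : entire f -> exists fx fy,
  [/\ entire fx, entire fy & forall p, has_grad f p (fx p) (fy p)].
Proof.
elim=> {f} [c||| n |f g ef [fx [fy [ex ey F]]] eg [gx [gy [ex' ey' G]]]
  |f g ef [fx [fy [ex ey F]]] eg [gx [gy [ex' ey' G]]]].
- exists (fun=> 0), (fun=> 0); split; try exact: entire_cst.
  by move=> p; exact: has_grad_cst.
- exists (fun=> 1), (fun=> 0); split; try exact: entire_cst.
  by move=> p; exact: has_grad_fst.
- exists (fun=> 0), (fun=> 1); split; try exact: entire_cst.
  by move=> p; exact: has_grad_snd.
- exists (fun p => - (k ^+ 2 / 2) * p.1 * besselP n.+1 p).
  exists (fun p => - (k ^+ 2 / 2) * p.2 * besselP n.+1 p).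
  split; last exact: has_grad_besselP.
  + apply: entireM (entire_besselP _); apply: entireM entire_fst; exact: entire_cst.
  + apply: entireM (entire_besselP _); apply: entireM entire_snd; exact: entire_cst.
- exists (fun q => fx q + gx q), (fun q => fy q + gy q).
  by split => [||p]; [exact: entireD|exact: entireD|exact: has_gradD].
- exists (fun q => fx q * g q + f q * gx q), (fun q => fy q * g q + f q * gy q).
  by split => [||p]; [| |exact: has_gradM]; apply: entireD; exact: entireM.
Qed.

Lemma partial_has_grad f p a b : has_grad f p a b ->
  [/\ partials [:: false] f p = a, partials [:: true] f p = b &
    forall c, derivable f p (Defs.basis c)].
Proof.
move=> F; split.
- by have [_ /= ->] := has_grad_dir (Defs.basis false) F; rewrite mul1r mul0r addr0.
- by have [_ /= ->] := has_grad_dir (Defs.basis true) F; rewrite mul1r mul0r add0r.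
- by move=> c; have [] := has_grad_dir (Defs.basis c) F.
Qed.

Lemma entire_partials (s : seq bool) f : entire f -> entire (partials s f).
Proof.
move=> ef; elim: s => //= b s IH.
have [fx [fy [ex ey F]]] := entire_grad IH.
case: b.
- rewrite (_ : (fun x => _) = fy) //; apply/funext => p.
  by have [_ /= <- _] := partial_has_grad (F p).
- rewrite (_ : (fun x => _) = fx) //; apply/funext => p.
  by have [/= <- _ _] := partial_has_grad (F p).
Qed.

Lemma entire_continuous f : entire f -> continuous f.
Proof.
move=> /entire_grad[fx [fy [_ _ F]]] p; exact: has_grad_continuous (F p).
Qed.

Lemma entire_Ck n U f : entire f -> Ck n U f.
Proof.
move=> ef s _ x _; have es := entire_partials s ef; split.
  exact: entire_continuous.
move=> _ b; have [fx [fy [_ _ F]]] := entire_grad es.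
by have [_ _] := partial_has_grad (F x); exact.
Qed.

Lemma entireB f g : entire f -> entire g -> entire (fun q => f q - g q).
Proof.
move=> ef eg; have := entireD ef (entireM (entire_cst (-1)) eg).
by under [X in entire X]funext do rewrite mulN1r.
Qed.

Lemma entire_zpow n : entire (fun q => (zpow n q).1) /\ entire (fun q => (zpow n q).2).
Proof.
elim: n => [|n [IH1 IH2]] /=; first by split; exact: entire_cst.
split; [apply: entireB|apply: entireD]; apply: entireM => //;
  by [exact: entire_fst|exact: entire_snd].
Qed.

Definition bwave n : R * R -> R := fun q => besselP n q * (zpow n q).1.

(** [bwave n] is a multiple of J_n(k r) cos(n theta). Once both second derivatives are expanded,
    only the recurrence for [besselG] and the identity z^n = z z^(n-1) are left to use. *)
Lemma lap_bwave n p : lap (bwave n) p = - k ^+ 2 * bwave n p.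
Proof.
pose X : R * R -> R := fun q =>
  - (k ^+ 2 / 2) * (q.1 * (besselP n.+1 q * (zpow n q).1)) +
  n%:R * (besselP n q * (zpow n.-1 q).1).
pose Y : R * R -> R := fun q =>
  - (k ^+ 2 / 2) * (q.2 * (besselP n.+1 q * (zpow n q).1)) -
  n%:R * (besselP n q * (zpow n.-1 q).2).
have G q : has_grad (bwave n) q (X q) (Y q).
  apply: has_grad_eq (has_gradM (has_grad_besselP n q) (has_grad_zpow n q).1) _ _;
    rewrite /X /Y; ring.
have eX : partials [:: false] (bwave n) = X.
  by apply/funext => q; have [] := partial_has_grad (G q).
have eY : partials [:: true] (bwave n) = Y.
  by apply/funext => q; have [] := partial_has_grad (G q).
have gX := has_gradD (has_gradZ (- (k ^+ 2 / 2)) (has_gradM (has_grad_fst p)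
   (has_gradM (has_grad_besselP n.+1 p) (has_grad_zpow n p).1)))
   (has_gradZ n%:R (has_gradM (has_grad_besselP n p) (has_grad_zpow n.-1 p).1)).
have gY := has_gradB (has_gradZ (- (k ^+ 2 / 2)) (has_gradM (has_grad_snd p)
   (has_gradM (has_grad_besselP n.+1 p) (has_grad_zpow n p).1)))
   (has_gradZ n%:R (has_gradM (has_grad_besselP n p) (has_grad_zpow n.-1 p).2)).
have [/= X1 _ _] := partial_has_grad gX.
have [_ /= Y2 _] := partial_has_grad gY.
have -> : lap (bwave n) p = partials [:: true] (partials [:: true] (bwave n)) p +
   partials [:: false] (partials [:: false] (bwave n)) p.
  by rewrite /lap big_bool.
rewrite eX eY /= X1 Y2.
have e1 : n%:R * (zpow n p).1 = n%:R * (p.1 * (zpow n.-1 p).1 - p.2 * (zpow n.-1 p).2).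
  by case: (n) => [|m] //=; rewrite !mul0r.
have := besselG_ode n (k ^+ 2 * (p.1 ^+ 2 + p.2 ^+ 2)).
rewrite -/(besselP n.+2 p) -/(besselP n.+1 p) -/(besselP n p) => ode.
apply/eqP; rewrite -subr_eq0 /bwave; apply/eqP.
move: ode e1; rewrite -[n.+1%:R]nat1r => ode /eqP; rewrite -subr_eq0 => /eqP e1.
(* The defect is a combination of the left-hand side of the recurrence and of n (z^n - z z^(n-1)),
   both zero. *)
transitivity (k ^+ 2 * (zpow n p).1 *
   (k ^+ 2 * (p.1 ^+ 2 + p.2 ^+ 2) / 4 * besselP n.+2 p
     - (1 + n%:R) * besselP n.+1 p + besselP n p)
  + k ^+ 2 * besselP n.+1 p * (n%:R * (zpow n p).1 -
     n%:R * (p.1 * (zpow n.-1 p).1 - p.2 * (zpow n.-1 p).2))); first by field.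
by rewrite ode e1 !mulr0 addr0.
Qed.

(** If the value vanished, [bwave n] would be zero on the circle of radius [Rad], hence a Dirichlet
    eigenfunction of the disk for k^2. *)
Lemma besselP_neq0 n (Rad : R) : 0 < k -> 0 < Rad ->
  ~ dirichlet_eigenvalue (disk Rad) (k ^+ 2) ->
  besselG n (k ^+ 2 * Rad ^+ 2) != 0.
Proof.
move=> k0 R0; apply: contra_notN => /eqP G0.
have ev : entire (bwave n) by apply: entireM; [exact: entire_besselP|exact: (entire_zpow n).1].
have lap0 p : lap (fun=> 0 : R) p = 0.
  have h := partial_has_grad (has_grad_cst 0 _).
  have e b : partials [:: b] (fun=> 0 : R) = (fun=> 0 : R).
    by apply/funext => q; have [h1 h2 _] := h q; case: b.
  rewrite /lap big_bool.
  rewrite -[partials [:: true; true] _]/(partials [:: true] (partials [:: true] _)).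
  rewrite -[partials [:: false; false] _]/(partials [:: false] (partials [:: false] _)).
  by rewrite !e /= addr0.
exists (fun p => (bwave n p +i* 0)%C); split.
- by split; apply: entire_Ck => //; exact: entire_cst.
- split; apply: continuous_subspaceT; last by move=> x; exact: cvg_cst.
  exact: entire_continuous.
- move=> p _; rewrite /clap.
  rewrite (_ : re_fun _ = bwave n) // (_ : im_fun _ = (fun=> 0)) // lap0 lap_bwave.
  by apply/eqP; rewrite eq_complex /=; apply/andP; split; apply/eqP; ring.
- move=> p; rewrite bdry_diskE //= => pR.
  by rewrite /bwave /besselP -sqr_enorm pR G0 mul0r.
(* Nontriviality is tested on the positive first axis near the origin: there [besselP n] is close to
   1 / n! and the angular factor is cos 0 = 1. *)
- have cG : besselP n (s, 0) @[s --> (0 : R)] --> besselP n (0, 0).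
    have c0 : (s, 0 : R) @[s --> (0 : R)] --> ((0, 0) : R * R).
      have c1 : s @[s --> (0 : R)] --> (0 : R) by exact: cvg_id.
      have c2 : (0 : R) @[s --> (0 : R)] --> (0 : R) by exact: cvg_cst.
      exact: (cvg_pair c1 c2).
    have cB : {for (0, 0), continuous (besselP n)}.
      exact: entire_continuous (entire_besselP n) _.
    have := cvg_comp _ _ c0 cB; exact.
  have G00 : besselP n (0, 0) != 0.
    by rewrite /besselP /= expr0n addr0 mulr0 besselG0 invr_eq0 pnatr_eq0 -lt0n fact_gt0.
  have nG : \forall s \near (0 : R)^'+, besselP n (s, 0) != 0.
    apply: cvg_within; exact: (cvgr_neq0 _ cG).
  near (0 : R)^'+ => s.
  have s0 : 0 < s by near: s; exact: nbhs_right_gt.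
  have sR : s < Rad by near: s; exact: nbhs_right_lt.
  have ec : (s, 0) = circle s 0 by rewrite /circle cos0 sin0 mulr1 mulr0.
  exists (s, 0); first by rewrite /disk /= ec enorm_circle // ltW.
  rewrite eq_complex /= eqxx andbT /bwave mulf_neq0 //; first by near: s.
  by rewrite ec zpow_circle /= mulr0 cos0 mulr1 expf_neq0 // gt_eqF.
Unshelve. all: by end_near.
Qed.

Definition cas (t : R) := cos t + sin t.

(* r^|n| cas(n theta) in Cartesian coordinates, for n of either sign. *)
Definition hcas (n : int) q : R :=
  (zpow `|n|%N q).1 + (if n is Posz _ then 1 else -1) * (zpow `|n|%N q).2.

Lemma hcas_circle n r t : hcas n (circle r t) = r ^+ `|n|%N * cas (n%:~R * t).
Proof.
rewrite /hcas zpow_circle /= /cas; case: n => m /=.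
  by rewrite mul1r mulrDr.
have -> : (Negz m)%:~R * t = - (m.+1%:R * t) by rewrite NegzE rmorphN mulNr.
by rewrite cosN sinN /=; ring.
Qed.

Definition bcas n : R * R -> R := fun q => besselP `|n|%N q * hcas n q.

(** The derivative of cas(n t) is n cas(- n t), so the angular derivative exchanges [hcas n] and
    [hcas (- n)]; the radial one acts only on r^|n| G_|n|(k^2 r^2). *)
Lemma bcas_grad n p : exists gx gy : R, [/\ has_grad (bcas n) p gx gy,
  p.1 * gx + p.2 * gy = (`|n|%N%:R * besselP `|n|%N p -
     k ^+ 2 * (p.1 ^+ 2 + p.2 ^+ 2) / 2 * besselP `|n|%N.+1 p) * hcas n p &
  p.1 * gy - p.2 * gx = n%:~R * besselP `|n|%N p * hcas (- n) p].
Proof.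
set sg : R := if n is Posz _ then 1 else -1.
have [h1 h2] := has_grad_zpow `|n|%N p.
have := has_gradM (has_grad_besselP `|n|%N p) (has_gradD h1 (has_gradZ sg h2)).
set gx := (X in has_grad _ _ X _); set gy := (X in has_grad _ _ _ X) => G.
exists gx, gy; split => //.
- rewrite /gx /gy /hcas -/sg.
  case: (absz n) => [|m] /=; first by rewrite !mul0r; field.
  by field.
- rewrite /gx /gy /hcas abszN -/sg.
  have -> : n%:~R = sg * `|n|%N%:R :> R.
    rewrite /sg; case: (n) => m; first by rewrite mul1r.
    by rewrite NegzE mulN1r abszN absz_nat rmorphN.
  have e2 : sg * sg = 1 by rewrite /sg; case: (n) => _; rewrite ?mulrNN mulr1.
  (* The case n = 0 is separate because - 0 is again [Posz 0], so that the sign [sg] does not change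
     under negation. *)
  have [->|n0] := eqVneq n 0; first by rewrite /= !mul0r !mulr0; field.
  have -> : (if - n is Posz _ then 1 else -1) = - sg.
    rewrite /sg; case: (n) n0 => [[|m]|m] //= _.
    by rewrite opprK.
  case: (absz n) => [|m] /=; first by rewrite !mul0r !mulr0; field.
  apply/eqP; rewrite -subr_eq0; apply/eqP.
  transitivity ((sg * sg - 1) * (m.+1%:R * besselP m.+1 p *
    (p.1 * (zpow m p).2 + p.2 * (zpow m p).1))); first by field.
  by rewrite e2 subrr mul0r.
Qed.

End PlaneWaves.

(** * Square integrable functions on [0, 2 pi] and Hartley series *)

Section SquareIntegrable.
Context {R : realType}.
Notation mu := (@lebesgue_measure R).
Notation T := (measurableTypeR R).
Notation I := (`[0, 2 * pi]%classic : set T).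
Implicit Types (f g d : R -> R) (t c : R).

Definition sqint f :=
  measurable_fun I (f : T -> R) /\ mu.-integrable I (EFin \o (fun t => f t ^+ 2)).

Definition ip f g : R := \int[mu]_(t in I) (f t * g t).

Lemma measurable_I : measurable I.
Proof. exact: measurable_itv. Qed.

Lemma mu_I : mu I = (2 * pi)%:E.
Proof.
rewrite lebesgue_measure_itv /= lte_fin mulr_gt0 ?pi_gt0 //.
by rewrite oppr0 adde0.
Qed.

Lemma integrable_ext (F G : R -> \bar R) : F =1 G ->
  mu.-integrable I F -> mu.-integrable I G.
Proof. by move=> /funext ->. Qed.

Lemma continuous_integrable f : continuous f -> mu.-integrable I (EFin \o f).
Proof.
move=> cf; apply: continuous_compact_integrable; first exact: segment_compact.
exact: continuous_subspaceT.
Qed.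

Lemma continuous_measurable_I f : continuous f -> measurable_fun I (f : T -> R).
Proof.
by move=> cf; apply: measurable_funTS; exact: continuous_measurable_fun.
Qed.

Lemma sqint_continuous f : continuous f -> sqint f.
Proof.
move=> cf; split; first exact: continuous_measurable_I.
by apply: continuous_integrable => t; apply: cvgM; exact: cf.
Qed.

(** Zeros of [f] are allowed, with the convention that 0 has inverse 0; the quotient in the
    convergence proof of Hartley series has such points. *)
Lemma measurable_funV (f : T -> R) : measurable_fun I f ->
  measurable_fun I (fun t => (f t)^-1 : R).
Proof.
move=> mf; apply: (@measurableT_comp _ _ _ _ _ _ (GRing.inv : T -> T)) => //.
rewrite -(setUv [set (0 : R)]); apply/measurable_funU => //.
  exact: measurableC.
split; first by apply: (@eq_measurable_fun _ _ _ _ _ (cst (0 : R))) => // x;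
  rewrite inE /= => ->; rewrite invr0.
apply: open_continuous_measurable_fun.
  by apply: closed_openC; exact: closed_eq.
by move=> x; rewrite inE /= => /eqP x0; exact: inv_continuous.
Qed.

Lemma integrable_dominated f g : measurable_fun I (f : T -> R) ->
  mu.-integrable I (EFin \o g) -> (forall t, I t -> `|f t| <= g t) ->
  mu.-integrable I (EFin \o f).
Proof.
move=> mf ig fg; apply: (le_integrable measurable_I _ _ ig); first exact/measurable_EFinP.
by move=> t It /=; rewrite lee_fin (le_trans (fg _ It)) // ler_norm.
Qed.

Lemma integrable_bounded f c : measurable_fun I (f : T -> R) ->
  (forall t, I t -> `|f t| <= c) -> mu.-integrable I (EFin \o f).
Proof.
move=> mf fc; apply: (@integrable_dominated _ (fun=> c)) => //.
by apply: continuous_integrable => t; exact: cvg_cst.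
Qed.

Lemma sqint_bounded f c : measurable_fun I (f : T -> R) ->
  (forall t, I t -> `|f t| <= c) -> sqint f.
Proof.
move=> mf fc; split => //; apply: (@integrable_bounded _ (c ^+ 2)).
  by apply: measurable_funM.
by move=> t It; rewrite normrX lerXn2r ?nnegrE ?(le_trans _ (fc _ It)).
Qed.

Lemma integrable_mul f g : sqint f -> sqint g ->
  mu.-integrable I (EFin \o (fun t => f t * g t)).
Proof.
move=> [mf f2] [mg g2].
apply: (@integrable_dominated _ (fun t => f t ^+ 2 + g t ^+ 2)).
- exact: measurable_funM.
- have := integrableD measurable_I f2 g2.
  by move=> H; apply: (integrable_ext _ H) => t.
- move=> t _; rewrite normrM -(real_normK (num_real (f t))) -(real_normK (num_real (g t))).
  have := sqr_ge0 (`|f t| - `|g t|).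
  have := sqr_ge0 `|f t|; have := sqr_ge0 `|g t|; nra.
Qed.

Lemma sqintZ c f : sqint f -> sqint (fun t => c * f t).
Proof.
move=> [mf f2]; split; first by apply: measurable_funM.
have := integrableZl measurable_I (c ^+ 2) f2.
by move=> H; apply: (integrable_ext _ H) => t /=; rewrite -EFinM exprMn.
Qed.

Lemma sqintD f g : sqint f -> sqint g -> sqint (fun t => f t + g t).
Proof.
move=> sf sg; have fg := integrable_mul sf sg.
move: sf sg => [mf f2] [mg g2].
split; first exact: measurable_funD.
have := integrableD measurable_I (integrableD measurable_I f2 g2)
  (integrableZl measurable_I 2 fg).
move=> H; apply: (integrable_ext _ H) => t /=.
by rewrite -EFinM -!EFinD; congr EFin; ring.
Qed.

Lemma sqintB f g : sqint f -> sqint g -> sqint (fun t => f t - g t).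
Proof.
move=> sf sg; have := sqintD sf (sqintZ (-1) sg).
by under [X in sqint X]funext do rewrite mulN1r.
Qed.

Lemma ipC f g : ip f g = ip g f.
Proof. by rewrite /ip; apply: eq_Rintegral => t _; rewrite mulrC. Qed.

Lemma ipDl f g h : sqint f -> sqint g -> sqint h ->
  ip (fun t => f t + g t) h = ip f h + ip g h.
Proof.
move=> sf sg sh; rewrite /ip -RintegralD; [|exact: measurable_I|exact: integrable_mul..].
by apply: eq_Rintegral => t _; rewrite mulrDl.
Qed.

Lemma ipZl c f h : sqint f -> sqint h -> ip (fun t => c * f t) h = c * ip f h.
Proof.
move=> sf sh; rewrite /ip -RintegralZl; [|exact: measurable_I|exact: integrable_mul].
by apply: eq_Rintegral => t _; rewrite mulrA.
Qed.

Lemma ip_ge0 f : 0 <= ip f f.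
Proof. by apply: Rintegral_ge0 => t _; rewrite -expr2 sqr_ge0. Qed.

(** The family has common squared norm [c]. Subtracting from [d] its projection on [e M] lowers the
    squared norm by exactly that term and leaves the earlier coefficients unchanged, so induction on
    M applies. *)
Lemma bessel_inequality (e : nat -> R -> R) c d M : 0 < c ->
  (forall i, sqint (e i)) ->
  (forall i j, ip (e i) (e j) = if i == j then c else 0) -> sqint d ->
  \sum_(i < M) ip d (e i) ^+ 2 <= c * ip d d.
Proof.
move=> c0 se oe; elim: M d => [|M IH] d sd.
  by rewrite big_ord0 mulr_ge0 ?ip_ge0 // ltW.
pose a := ip d (e M) / c.
pose d' t := d t + (- a) * e M t.
have sa := sqintZ (- a) (se M).
have sd' : sqint d' by exact: sqintD.
have i1 i : (i < M)%N -> ip d' (e i) = ip d (e i).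
  move=> iM; rewrite /d' ipDl // ipZl // oe gtn_eqF //.
  by rewrite mulr0 addr0.
have i2 : ip d' d' = ip d d - ip d (e M) ^+ 2 / c.
  rewrite {1}/d' ipDl // ipZl // [ip d d']ipC [ip (e M) d']ipC.
  rewrite /d' !ipDl // !ipZl // oe eqxx [ip (e M) d]ipC /a.
  by field; rewrite gt_eqF.
have := IH _ sd'; rewrite i2 big_ord_recr /= mulrBr [c * (_ / c)]mulrC divfK ?gt_eqF //.
rewrite -lerBrDr; apply: le_trans; apply: ler_sum => i _.
by rewrite i1.
Qed.

Lemma bessel_coef_cvg0 (e : nat -> R -> R) c d : 0 < c ->
  (forall i, sqint (e i)) ->
  (forall i j, ip (e i) (e j) = if i == j then c else 0) -> sqint d ->
  ip d (e n) @[n --> \oo] --> (0 : R).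
Proof.
move=> c0 se oe sd.
have h : cvgn (series (fun n => ip d (e n) ^+ 2)).
  apply: nondecreasing_is_cvgn.
    by apply: nondecreasing_series => i _ _; exact: sqr_ge0.
  exists (c * ip d d) => _ [n _ <-].
  by rewrite /series /= big_mkord; exact: bessel_inequality.
have h2 := cvg_series_cvg_0 h.
have h3 := cvg_comp _ _ h2 (@sqrt_continuous R 0).
apply/norm_cvg0P; rewrite sqrtr0 in h3.
apply: cvg_trans h3; apply: near_eq_cvg; near=> n => /=.
by rewrite sqrtr_sqr.
Unshelve. all: by end_near.
Qed.

Lemma Rintegral_derive (F f : R -> R) :
  (forall t, is_derive t (1 : R) F (f t)) -> continuous f ->
  \int[mu]_(t in I) f t = F (2 * pi) - F 0.
Proof.
move=> dF cf; rewrite /Rintegral (@continuous_FTC2 _ f F) //.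
- by rewrite mulr_gt0 ?pi_gt0.
- exact: continuous_subspaceT.
- split.
  + by move=> t _; have [] := dF t.
  + apply: cvg_at_right_filter; exact: is_derive1_continuous (dF 0).
  + apply: cvg_at_left_filter; exact: is_derive1_continuous (dF _).
- by move=> t _; rewrite derive1E; have [_] := dF t.
Qed.

Lemma cos_intmul_2pi (n : int) : cos (n%:~R * (2 * pi)) = 1 :> R.
Proof.
have h (m : nat) : cos (m%:R * (2 * pi)) = 1 :> R.
  elim: m => [|m IH]; first by rewrite mul0r cos0.
  by rewrite -natr1 mulrDl mul1r [2 * pi]mulr_natl cosD2pi -[pi *+ 2]mulr_natl IH.
case: n => m; first exact: h.
by rewrite NegzE rmorphN mulNr cosN h.
Qed.

Lemma sin_intmul_2pi (n : int) : sin (n%:~R * (2 * pi)) = 0 :> R.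
Proof.
have := cos2Dsin2 (n%:~R * (2 * pi) : R).
by rewrite cos_intmul_2pi expr1n -[RHS]addr0 => /addrI/eqP; rewrite sqrf_eq0 => /eqP.
Qed.

Lemma Rintegral_cos (n : int) :
  \int[mu]_(t in I) cos (n%:~R * t) = if n == 0 then 2 * pi else 0.
Proof.
have [->|n0] := eqVneq n 0.
  rewrite (@eq_Rintegral _ _ _ _ _ (fun=> 1)) => [|t _]; last by rewrite mul0r cos0.
  rewrite (Rintegral_cst _ measurable_I) mul1r.
  by rewrite -[RHS]/(fine (2 * pi)%:E); congr fine; exact: mu_I.
have n0' : (n%:~R : R) != 0 by rewrite intr_eq0.
have d t : is_derive t (1 : R) (fun t => n%:~R^-1 * sin (n%:~R * t)) (cos (n%:~R * t)).
  by apply: is_derive_eq; rewrite /GRing.scale /=; field.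
have c : continuous (fun t : R => cos (n%:~R * t)).
  by move=> t; apply: continuous_comp; [apply: mulrl_continuous|exact: continuous_cos].
by rewrite (Rintegral_derive d c) sin_intmul_2pi !mulr0 sin0 mulr0 subrr.
Qed.

Lemma Rintegral_sin (n : int) : \int[mu]_(t in I) sin (n%:~R * t) = 0.
Proof.
have [->|n0] := eqVneq n 0.
  rewrite (@eq_Rintegral _ _ _ _ _ (fun=> 0)) => [|t _]; last by rewrite mul0r sin0.
  by rewrite (Rintegral_cst _ measurable_I) mul0r.
have n0' : (n%:~R : R) != 0 by rewrite intr_eq0.
have d t : is_derive t (1 : R) (fun t => - n%:~R^-1 * cos (n%:~R * t)) (sin (n%:~R * t)).
  by apply: is_derive_eq; rewrite /GRing.scale /=; field.
have c : continuous (fun t : R => sin (n%:~R * t)).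
  by move=> t; apply: continuous_comp; [apply: mulrl_continuous|exact: continuous_sin].
by rewrite (Rintegral_derive d c) cos_intmul_2pi mulr0 cos0 subrr.
Qed.

End SquareIntegrable.

(** * Sums over the integers from -N to N *)

Section SymmetricSums.
Context {V : zmodType}.
Implicit Types (F : int -> V).

(** Indexed exactly as in [fourier_bessel], so that the two match term by term. *)
Definition symsum (N : nat) F : V := \sum_(j < (2 * N)%N.+1) F ((j : nat)%:Z - N%:Z).

Lemma symsumE N F :
  symsum N F = F 0 + \sum_(i < N) (F i.+1%:Z + F (- i.+1%:Z)).
Proof.
elim: N => [|N IH].
  by rewrite /symsum big_ord_recl !big_ord0 !addr0.
have -> : symsum N.+1 F = symsum N F + (F N.+1%:Z + F (- N.+1%:Z)).
  rewrite /symsum mulnS big_ord_recl big_ord_recr /= [LHS]addrC -[LHS]addrA; congr (_ + _).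
  - apply: eq_bigr => i _; congr F; rewrite /bump /=; lia.
  - by congr (F _ + F _); rewrite /bump /=; lia.
by rewrite IH [in RHS]big_ord_recr /= [RHS]addrA.
Qed.

(** The exponential and the cas form of a partial sum differ by a summand odd in n, which this
    removes. *)
Lemma symsum_odd N F : F 0 = 0 -> (forall n, F (- n) = - F n) -> symsum N F = 0.
Proof.
move=> F0 FN; rewrite symsumE F0 add0r big1 // => i _.
by rewrite FN subrr.
Qed.

Lemma eq_symsum N F G : F =1 G -> symsum N F = symsum N G.
Proof. by move=> FG; apply: eq_bigr => i _; exact: FG. Qed.

Lemma symsumD N F G : symsum N (fun n => F n + G n) = symsum N F + symsum N G.
Proof. exact: big_split. Qed.

End SymmetricSums.

(** * Hartley series: orthogonality, pointwise convergence, remainder *)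

Section Hartley.
Context {R : realType}.
Notation mu := (@lebesgue_measure R).
Notation T := (measurableTypeR R).
Notation I := (`[0, 2 * pi]%classic : set T).
Implicit Types (f g d : R -> R) (s t th c L : R) (n m : int) (N M : nat).

(* The functions cas (n t), n of either sign, form a single real orthogonal
   family equivalent to the exponentials. *)
Definition casn n t : R := cas (n%:~R * t).

Definition har f n : R := (2 * pi)^-1 * ip f (casn n).

Definition harsum N f th : R := symsum N (fun n => har f n * casn n th).

Lemma cas_le2 t : `|cas t| <= 2 :> R.
Proof.
apply: le_trans (ler_normD _ _) _.
by have := cos_max t; have := sin_max t; lra.
Qed.

Lemma continuous_casn n : continuous (casn n).
Proof.
by move=> t; apply: cvgD; apply: continuous_comp;
  [exact: mulrl_continuous|exact: continuous_cos
  |exact: mulrl_continuous|exact: continuous_sin].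
Qed.

Lemma sqint_casn n : sqint (casn n).
Proof. exact/sqint_continuous/continuous_casn. Qed.

Lemma continuous_cos_int n : continuous (fun t : R => cos (n%:~R * t)).
Proof.
by move=> t; apply: continuous_comp; [exact: mulrl_continuous|exact: continuous_cos].
Qed.

Lemma continuous_sin_int n : continuous (fun t : R => sin (n%:~R * t)).
Proof.
by move=> t; apply: continuous_comp; [exact: mulrl_continuous|exact: continuous_sin].
Qed.

Lemma ip_casn n m : ip (casn n) (casn m) = if n == m then 2 * pi else 0.
Proof.
(* The product identity cas a cas b = cos (a - b) + sin (a + b). *)
transitivity (\int[mu]_(t in I) (cos ((n - m)%:~R * t) + sin ((n + m)%:~R * t))).
  apply: eq_Rintegral => t _.
  have -> : (n - m)%:~R * t = n%:~R * t - m%:~R * t by rewrite rmorphB mulrBl.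
  have -> : (n + m)%:~R * t = n%:~R * t + m%:~R * t by rewrite rmorphD mulrDl.
  by rewrite /casn /cas cosB sinD; ring.
rewrite RintegralD ?Rintegral_cos ?Rintegral_sin ?addr0 ?subr_eq0 //.
- exact/continuous_integrable/continuous_cos_int.
- exact/continuous_integrable/continuous_sin_int.
Qed.

Lemma har_bessel d N : sqint d ->
  symsum N (fun n => har d n ^+ 2) <= (2 * pi)^-1 * ip d d.
Proof.
move=> sd; have p0 : 0 < 2 * pi :> R by rewrite mulr_gt0 ?pi_gt0.
have oe i j : ip (casn (i%:Z - N%:Z)) (casn (j%:Z - N%:Z)) =
    if i == j then 2 * pi else 0 :> R.
  by rewrite ip_casn; congr (if _ then _ else _); lia.
have h := bessel_inequality (2 * N).+1 p0 (fun i => sqint_casn (i%:Z - N%:Z)) oe sd.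
have -> : symsum N (fun n => har d n ^+ 2) =
    (2 * pi) ^- 2 * \sum_(i < (2 * N).+1) ip d (casn (i%:Z - N%:Z)) ^+ 2.
  by rewrite /symsum mulr_sumr; apply: eq_bigr => i _; rewrite /har exprMn exprVn.
apply: le_trans (_ : (2 * pi) ^- 2 * (2 * pi * ip d d) <= _).
  by rewrite ler_pM2l // invr_gt0 exprn_gt0.
by rewrite mulrA expr2 invfM mulfVK ?gt_eqF.
Qed.

Lemma har_sqr_le d n : sqint d -> har d n ^+ 2 <= (2 * pi)^-1 * ip d d.
Proof.
move=> sd; have := har_bessel `|n|%N sd; apply: le_trans.
rewrite /symsum.
have [j [jn hj]] : exists j : nat, j%:Z - `|n|%N%:Z = n /\ (j < (2 * `|n|).+1)%N.
  by exists (absz (n + `|n|)); lia.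
rewrite (bigD1 (Ordinal hj)) //= jn lerDl; apply: sumr_ge0 => i _; exact: sqr_ge0.
Qed.

Lemma ip_sum d (e : nat -> R -> R) (a : nat -> R) M : sqint d ->
  (forall i, sqint (e i)) ->
  sqint (fun t => \sum_(j < M) a j * e j t) /\
  ip d (fun t => \sum_(j < M) a j * e j t) = \sum_(j < M) a j * ip d (e j).
Proof.
move=> sd se; elim: M => [|M [IH1 IH2]].
  split; first by under [X in sqint X]funext do rewrite big_ord0;
    apply: sqint_continuous => t; exact: cvg_cst.
  rewrite big_ord0 /ip (@eq_Rintegral _ _ _ _ _ (fun=> 0)) => [|t _].
    by rewrite (Rintegral_cst _ measurable_I) mul0r.
  by rewrite big_ord0 mulr0.
have E : (fun t => \sum_(j < M.+1) a j * e j t) =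
  (fun t => (\sum_(j < M) a j * e j t) + a M * e M t).
  by apply/funext => t; rewrite big_ord_recr.
rewrite E; split; first by apply: sqintD => //; exact: sqintZ.
rewrite ipC ipDl //; last exact: sqintZ.
by rewrite ipZl // ipC IH2 [ip (e M) d]ipC big_ord_recr.
Qed.

(** The terms n and -n add up to 2 cos (n (t - th)), and multiplication by sin ((t - th) / 2) makes
    the sum telescope. The product form stays meaningful where the sine vanishes. *)
Lemma dirichlet_kernel N t th :
  symsum N (fun n => casn n th * casn n t) * sin ((t - th) / 2) =
  sin ((N%:R + 2^-1) * (t - th)).
Proof.
have two n : casn n th * casn n t + casn (- n) th * casn (- n) t =
    2 * cos (n%:~R * (t - th)).
  have -> : n%:~R * (t - th) = n%:~R * t - n%:~R * th by rewrite mulrBr.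
  have e s : (- n)%:~R * s = - (n%:~R * s) by rewrite rmorphN mulNr.
  by rewrite /casn /cas !e !cosN !sinN cosB; ring.
rewrite symsumE; elim: N => [|N IH].
  rewrite big_ord0 addr0 /casn /cas !mul0r cos0 sin0 add0r addr0 !mul1r.
  by rewrite mulrC.
rewrite big_ord_recr addrA mulrDl IH two /=.
set x := t - th.
have -> : (N.+1%:R + 2^-1) * x = N.+1%:~R * x + x / 2 by rewrite mulrDl [_ / 2]mulrC.
have -> : (N%:R + 2^-1) * x = N.+1%:~R * x - x / 2.
  by rewrite -[N.+1%:~R]/(N.+1%:R) -natr1; field.
by rewrite sinB sinD; ring.
Qed.

Definition hsin th N t : R := sin ((N%:R + 2^-1) * (t - th)).

Lemma continuous_hsin th N : continuous (hsin th N).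
Proof.
move=> t; apply: continuous_comp; last exact: continuous_sin.
apply: continuous_comp; last exact: mulrl_continuous.
by apply: cvgB; [exact: cvg_id|exact: cvg_cst].
Qed.

(** The frequencies are half-integers, but a product of two such sines is half the difference of
    cosines at the integer frequencies N - M and N + M + 1; the second is never 0. *)
Lemma ip_hsin th N M : ip (hsin th N) (hsin th M) = if N == M then pi else 0.
Proof.
pose C n t : R := cos (n%:~R * (t - th)).
have CE n t : C n t = cos (n%:~R * th) * cos (n%:~R * t) + sin (n%:~R * th) * sin (n%:~R * t).
  have -> : C n t = cos (n%:~R * t - n%:~R * th) by rewrite /C mulrBr.
  by rewrite cosB; ring.
have iC n : \int[mu]_(t in I) C n t = if n == 0 then 2 * pi else 0.
  transitivity (\int[mu]_(t in I) (cos (n%:~R * th) * cos (n%:~R * t) +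
      sin (n%:~R * th) * sin (n%:~R * t))); first by apply: eq_Rintegral => t _.
  rewrite RintegralD; [|exact: measurable_I|..].
  - rewrite !RintegralZl; [|exact: measurable_I|exact/continuous_integrable/continuous_sin_int
      |exact: measurable_I|exact/continuous_integrable/continuous_cos_int].
    rewrite Rintegral_cos Rintegral_sin mulr0 addr0.
    by case: eqVneq => [->|_]; rewrite ?mulr0 // mul0r cos0 mul1r.
  - apply: continuous_integrable => t; apply: cvgM; [exact: cvg_cst|exact: continuous_cos_int].
  - apply: continuous_integrable => t; apply: cvgM; [exact: cvg_cst|exact: continuous_sin_int].
have cC n : continuous (C n).
  move=> t; apply: continuous_comp; last exact: continuous_cos.
  apply: continuous_comp; last exact: mulrl_continuous.
  by apply: cvgB; [exact: cvg_id|exact: cvg_cst].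
transitivity (\int[mu]_(t in I) (2^-1 * (C (N%:Z - M%:Z) t - C (N%:Z + M%:Z + 1) t))).
  apply: eq_Rintegral => t _; rewrite /hsin /C.
  have -> : (N%:Z - M%:Z)%:~R * (t - th) =
    (N%:R + 2^-1) * (t - th) - (M%:R + 2^-1) * (t - th).
    by rewrite rmorphB /=; ring.
  have -> : (N%:Z + M%:Z + 1)%:~R * (t - th) =
    (N%:R + 2^-1) * (t - th) + (M%:R + 2^-1) * (t - th).
    by rewrite !rmorphD /=; field.
  by rewrite cosB cosD; field.
rewrite RintegralZl; [|exact: measurable_I|].
  rewrite RintegralB; [|exact: measurable_I|exact/continuous_integrable/cC..].
  rewrite !iC subr_eq0 eqz_nat; have -> : (N%:Z + M%:Z + 1 == 0) = false by lia.
  by case: eqVneq => _; rewrite subr0; field.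
by apply: continuous_integrable => t; apply: cvgB; exact: cC.
Qed.

(* Chernoff's argument: [f - f th] is divisible by [sin ((t - th) / 2)] with a
   bounded quotient, which turns the Dirichlet kernel into an orthogonal
   sequence, to which Bessel's inequality applies. *)
Lemma harsum_cvg f th L : measurable_fun I (f : T -> R) ->
  (forall t, `|f t - f th| <= L * `|sin ((t - th) / 2)|) ->
  harsum N f th @[N --> \oo] --> f th.
Proof.
move=> mf fL.
pose g t := (f t - f th) * (sin ((t - th) / 2))^-1.
(* At a zero of the sine the hypothesis forces f t = f th, which agrees with the value 0 that the
   inverse convention gives to [g]. *)
have gE t : f t = f th + g t * sin ((t - th) / 2).
  rewrite /g; have [s0|s0] := eqVneq (sin ((t - th) / 2)) 0.
    have := fL t; rewrite s0 normr0 mulr0 mulr0 addr0 normr_le0 subr_eq0.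
    by move/eqP.
  by rewrite mulfVK // addrC subrK.
have L0 : 0 <= L.
  have := fL (th + pi); rewrite [th + pi]addrC addrK sin_pihalf normr1 mulr1.
  by apply: le_trans; exact: normr_ge0.
have gL t : `|g t| <= L.
  rewrite /g normrM normfV; have [s0|s0] := eqVneq (sin ((t - th) / 2)) 0.
    by rewrite s0 normr0 invr0 mulr0.
  by rewrite ler_pdivrMr ?normr_gt0.
have chalf : continuous (fun t : R => sin ((t - th) / 2)).
  move=> t; apply: continuous_comp; last exact: continuous_sin.
  by apply: cvgM; [apply: cvgB; [exact: cvg_id|exact: cvg_cst]|exact: cvg_cst].
have mg : measurable_fun I (g : T -> R).
  apply: measurable_funM; first by apply: measurable_funB => //; exact: measurable_cst.
  by apply: measurable_funV; exact: continuous_measurable_I.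
have sg : sqint g by exact: sqint_bounded (fun t _ => gL t).
have pi2 : 0 < 2 * pi :> R by rewrite mulr_gt0 ?pi_gt0.
have sf : sqint f.
  apply: (@sqint_bounded _ _ (`|f th| + L)) => // t _.
  rewrite gE; apply: le_trans (ler_normD _ _) _; rewrite lerD2l normrM.
  rewrite -[leRHS]mulr1; apply: ler_pM => //.
  by rewrite ler_norml sin_geN1 sin_le1.
(* With D the Dirichlet kernel, the partial sum at [th] is (2 pi)^-1 <f, D>, and it equals 1 for the
   constant 1. Writing f = f th + g sin leaves only the coefficient of [g] against [hsin th N]. *)
have key N : harsum N f th = f th + (2 * pi)^-1 * ip g (hsin th N).
  pose D t := symsum N (fun n => casn n th * casn n t).
  have [sD _] := @ip_sum f (fun j => casn (j%:Z - N%:Z)) (fun j => casn (j%:Z - N%:Z) th) (2 * N).+1 sf (fun j => sqint_casn _).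
  have E1 d : sqint d -> (2 * pi)^-1 * ip d D = harsum N d th.
    move=> sd; have [_] := @ip_sum d (fun j => casn (j%:Z - N%:Z)) (fun j => casn (j%:Z - N%:Z) th) (2 * N).+1 sd (fun j => sqint_casn _).
    rewrite /D /symsum => ->; rewrite /harsum /symsum mulr_sumr; apply: eq_bigr => i _.
    by rewrite /har; ring.
  have s1 : sqint (fun=> 1 : R) by apply: sqint_continuous => t; exact: cvg_cst.
  have E2 : harsum N (fun=> 1) th = 1.
    have c0 : casn 0 = (fun=> 1 : R).
      by apply/funext => t; rewrite /casn /cas mul0r cos0 sin0 addr0.
    have h n : har (fun=> 1) n = if n == 0 then 1 else 0.
      rewrite /har -c0 ip_casn eq_sym; case: eqVneq => _; last by rewrite mulr0.
      by rewrite mulVf // gt_eqF.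
    rewrite /harsum symsumE h eqxx c0 mul1r big1 ?addr0 // => i _.
    by rewrite !h oppr_eq0 /= !mul0r addr0.
  have shs : sqint (hsin th N) by exact/sqint_continuous/continuous_hsin.
  rewrite -(E1 _ sf); transitivity ((2 * pi)^-1 * (f th * ip (fun=> 1) D + ip g (hsin th N))).
    congr (_ * _); rewrite -ipZl //.
    rewrite /ip -RintegralD; [|exact: measurable_I| |exact: integrable_mul].
    - apply: eq_Rintegral => t _; rewrite [in LHS]gE mulr1 mulrDl; congr (_ + _).
      by rewrite -mulrA; congr (_ * _); rewrite mulrC dirichlet_kernel.
    - apply: (@integrable_mul _ (fun=> f th * 1)) => //.
      by apply: sqint_continuous => t; exact: cvg_cst.
  by rewrite mulrDr mulrCA E1 // E2 mulr1.
have cz : ip g (hsin th N) @[N --> \oo] --> (0 : R).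
  apply: (@bessel_coef_cvg0 _ (hsin th) pi) => //.
  - exact: pi_gt0.
  - by move=> i; exact/sqint_continuous/continuous_hsin.
  - by move=> i j; rewrite ip_hsin.
have h : f th + (2 * pi)^-1 * ip g (hsin th N) @[N --> \oo] --> f th + (2 * pi)^-1 * 0.
  by apply: cvgD; [exact: cvg_cst|apply: cvgM => //; exact: cvg_cst].
rewrite mulr0 addr0 in h.
by apply: cvg_trans h; apply: near_eq_cvg; near=> N; rewrite key.
Unshelve. all: by end_near.
Qed.

(** Compare two partial sums and let the longer one converge. The factor 4 is the bound 2 on cas
    times the two signs of n. *)
Lemma harsum_tail f th L (b : nat -> R) N B : measurable_fun I (f : T -> R) ->
  (forall t, `|f t - f th| <= L * `|sin ((t - th) / 2)|) ->
  (forall n, `|har f n| <= b `|n|%N) ->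
  (forall M, \sum_(N <= i < M) b i.+1 <= B) ->
  `|f th - harsum N f th| <= 4 * B.
Proof.
move=> mf fL hb hB; have h := harsum_cvg mf fL.
have c : (fun M => `|harsum M f th - harsum N f th|) @ \oo --> `|f th - harsum N f th|.
  by apply: cvg_norm; apply: cvgB => //; exact: cvg_cst.
rewrite -(cvg_lim (@Rhausdorff R) c); apply: limr_le.
  by apply/cvg_ex; eexists; exact: c.
near=> M; have NM : (N <= M)%N by near: M; exact: nbhs_infty_ge.
have F n : `|har f n * casn n th| <= 2 * b `|n|%N.
  by rewrite normrM mulrC; apply: ler_pM => //; exact: cas_le2.
rewrite /harsum !symsumE opprD addrACA subrr add0r.
rewrite -!(big_mkord xpredT (fun i => har f i.+1 * casn i.+1 th + har f (- i.+1%:Z) * casn (- i.+1%:Z) th)).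
rewrite (big_cat_nat (leq0n N) NM) /= [X in X - _]addrC addrK.
apply: le_trans (ler_norm_sum _ _ _) _.
apply: le_trans (_ : 4 * \sum_(N <= i < M) b i.+1 <= _); last first.
  by rewrite ler_wpM2l.
rewrite mulr_sumr; apply: ler_sum => i _.
apply: le_trans (ler_normD _ _) _.
have := F i.+1%:Z; have := F (- i.+1%:Z); rewrite abszN absz_nat; lra.
Unshelve. all: by end_near.
Qed.

End Hartley.

(** * The radial equation *)

Section RadialODE.
Context {R : realType}.
Notation mu := (@lebesgue_measure R).
Notation T := (measurableTypeR R).
Notation I := (`[0, 2 * pi]%classic : set T).
Implicit Types (f fx fy : R * R -> R) (r s t c k rho : R) (n : int).

Lemma har_bound (f : R -> R) n c : measurable_fun I (f : T -> R) ->
  (forall t, `|f t| <= c) -> `|har f n| <= c.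
Proof.
move=> mf fc; have c0 : 0 <= c by apply: le_trans (fc 0).
have p0 : 0 < 2 * pi :> R by rewrite mulr_gt0 ?pi_gt0.
have sf : sqint f by apply: sqint_bounded mf (fun t _ => fc t).
rewrite -(@ler_pXn2r _ 2) ?nnegrE // real_normK ?num_real //.
apply: le_trans (har_sqr_le n sf) _.
rewrite ler_pdivrMl // -[leRHS]/(2 * pi * c ^+ 2).
have -> : 2 * pi * c ^+ 2 = \int[mu]_(t in I) (c ^+ 2).
  rewrite (Rintegral_cst _ measurable_I) [RHS]mulrC; congr (_ * _).
  by rewrite -[LHS]/(fine (2 * pi)%:E); congr fine; apply/esym; exact: mu_I.
apply: le_Rintegral; first exact: measurable_I.
- exact: integrable_mul.
- by apply: continuous_integrable => t; exact: cvg_cst.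
- move=> t _; rewrite -expr2 -(real_normK (num_real (f t))).
  by rewrite lerXn2r ?nnegrE.
Qed.

Lemma continuous_circle f r t : {for circle r t, continuous f} ->
  {for t, continuous (fun t => f (circle r t))}.
Proof.
move=> cf.
have c1 : r * cos s @[s --> t] --> r * cos t.
  by apply: cvgM; [exact: cvg_cst|exact: continuous_cos].
have c2 : r * sin s @[s --> t] --> r * sin t.
  by apply: cvgM; [exact: cvg_cst|exact: continuous_sin].
exact: (cvg_comp _ _ (cvg_pair c1 c2) cf).
Qed.

Lemma is_derive_casn n t : is_derive t (1 : R) (casn n) (n%:~R * casn (- n) t).
Proof.
have -> : casn n = (fun t => cos (n%:~R * t) + sin (n%:~R * t)) by [].
apply: is_derive_eq; rewrite /GRing.scale /= /casn /cas rmorphN !mulNr cosN sinN.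
ring.
Qed.

Lemma continuous_radial f fx fy rho p : C1on (disk rho) f fx fy ->
  disk rho p -> {for p, continuous (radial fx fy)} /\ {for p, continuous (angularD fx fy)}.
Proof.
move=> F Up; have [_ cx cy] := F _ Up.
by split; [apply: cvgD|apply: cvgB]; apply: cvgM => //;
  by [exact: cvg_fst|exact: cvg_snd].
Qed.

Lemma disk_circle rho r t : 0 < r < rho -> disk rho (circle r t).
Proof. by move=> /andP[r0 rr]; rewrite /disk /= enorm_circle // ltW. Qed.

(** Differentiation under the integral sign. The division by r appears because [radial] is r
    d/dr. *)
Lemma is_derive_har f fx fy rho r n : 0 < r < rho -> C1on (disk rho) f fx fy ->
  is_derive r (1 : R) (fun s => har (fun t => f (circle s t)) n)
    (har (fun t => radial fx fy (circle r t)) n / r).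
Proof.
move=> /andP[r0 rr] F.
(* On the radii between [u] and [v], both 1 / s and the radial derivative are bounded uniformly in
   the angle, which provides the dominating constant. *)
pose u := r / 2; pose v := (r + rho) / 2.
have u0 : 0 < u by rewrite /u; lra.
have uv s : `]u, v[%classic s -> u < s < v /\ 0 < s < rho.
  rewrite /= in_itv /= => /andP[us sv]; rewrite us sv; split=> //.
  by rewrite /u /v in us sv u0 *; apply/andP; split; lra.
have Ir : `]u, v[%classic r by rewrite /= in_itv /= /u /v; apply/andP; split; lra.
have [|M M0 hM] := @compact_bounded _ [set x | enorm x <= v] (radial fx fy) (@compact_cdisk _ v).
  move=> p /= pv; have Up : disk rho p.
    by rewrite /disk /=; apply: le_lt_trans pv _; rewrite /v; lra.
  by have [] := continuous_radial F Up.
pose ff s t := f (circle s t) * casn n t.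
have cf s : 0 < s < rho -> continuous (fun t => f (circle s t)).
  by move=> sr; exact: continuous_circle_angle sr F.
have dff s t : 0 < s < rho ->
  is_derive s (1 : R) (ff ^~ t) (radial fx fy (circle s t) / s * casn n t).
  move=> sr; have h := is_derive_circle_radius t sr F.
  have := is_deriveM h (is_derive_cst (casn n t) s (1 : R)).
  by move=> /is_derive_eq; apply; rewrite /GRing.scale /=; ring.
have h1 s : `]u, v[%classic s -> mu.-integrable I (EFin \o ff s).
  move=> /uv[_ sr]; apply: continuous_integrable => t.
  by apply: cvgM; [exact: cf|exact: continuous_casn].
have h2 s t : `]u, v[%classic s -> I t -> derivable (ff ^~ t) s 1.
  by move=> /uv[_ sr] _; have [] := dff s t sr.
have h3 t : 0 <= M / u * 2 by rewrite mulr_ge0 // divr_ge0 // ltW.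
have h4 : mu.-integrable I (EFin \o (fun=> M / u * 2)).
  by apply: continuous_integrable => t; exact: cvg_cst.
have h5 s t : `]u, v[%classic s -> I t -> `|partial1of2 ff s t| <= M / u * 2.
  move=> /uv[/andP[us sv] /[dup] sr /andP[s0 srho]] _.
  rewrite partial1of2E; have [_ ->] := dff s t sr.
  rewrite normrM; apply: ler_pM => //; last exact: cas_le2.
  rewrite normrM normfV (gtr0_norm s0); apply: ler_pM => //.
  - by rewrite invr_ge0 ltW.
  - by apply: hM; rewrite /= enorm_circle ltW.
  - by rewrite lef_pV2 ?posrE // ltW.
have H := cvg_differentiation_under_integral measurable_I Ir h1 h2 h3 h4 h5.
have D : is_derive r (1 : R) (fun s => ip (fun t => f (circle s t)) (casn n))
    (ip (fun t => radial fx fy (circle r t)) (casn n) / r).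
  apply: is_derive_cvg.
  have -> : ip (fun t => radial fx fy (circle r t)) (casn n) / r =
     \int[mu]_(t in I) partial1of2 ff r t.
    rewrite mulrC /ip -RintegralZl; [|exact: measurable_I|].
      apply: eq_Rintegral => t _; rewrite partial1of2E.
      have [|_ ->] := dff r t; first by rewrite r0.
      by ring.
    apply: continuous_integrable => t; apply: cvgM; last exact: continuous_casn.
    have Up : disk rho (circle r t) by apply: disk_circle; rewrite r0.
    exact: (continuous_circle (continuous_radial F Up).1).
  apply: cvg_trans H; apply: near_eq_cvg; near=> h.
  by rewrite -[h%:A]/(h * 1) mulr1.
have := is_deriveZ (2 * pi)^-1 D.
by move=> /is_derive_eq; apply; rewrite -[LHS]/(_ * _) /har mulrA.
Unshelve. all: by end_near.
Qed.

(** Integration by parts over a full period: the boundary terms cancel, and differentiating cas(n t)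
    produces n cas(- n t). *)
Lemma har_angular f fx fy rho r n : 0 < r < rho -> C1on (disk rho) f fx fy ->
  har (fun t => angularD fx fy (circle r t)) n =
  - n%:~R * har (fun t => f (circle r t)) (- n).
Proof.
move=> rr F.
have cf : continuous (fun t => f (circle r t)) by exact: continuous_circle_angle rr F.
have cT : continuous (fun t => angularD fx fy (circle r t)).
  move=> t; have Up : disk rho (circle r t) by exact: disk_circle.
  exact: (continuous_circle (continuous_radial F Up).2).
have d t : is_derive t (1 : R) (fun t => f (circle r t) * casn n t)
    (angularD fx fy (circle r t) * casn n t + n%:~R * (f (circle r t) * casn (- n) t)).
  have := is_deriveM (is_derive_circle_angle t rr F) (is_derive_casn n t).
  by move=> /is_derive_eq; apply; rewrite /GRing.scale /=; ring.
have c : continuous (fun t => angularD fx fy (circle r t) * casn n t +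
    n%:~R * (f (circle r t) * casn (- n) t)).
  move=> t; apply: cvgD; first by apply: cvgM; [exact: cT|exact: continuous_casn].
  apply: cvgM; first exact: cvg_cst.
  by apply: cvgM; [exact: cf|exact: continuous_casn].
have := Rintegral_derive d c.
have -> : f (circle r (2 * pi)) * casn n (2 * pi) - f (circle r 0) * casn n 0 = 0.
  rewrite /casn /cas cos_intmul_2pi sin_intmul_2pi mulr0 cos0 sin0.
  have [c2 s2] : cos (2 * pi) = 1 :> R /\ sin (2 * pi) = 0 :> R.
    by have := @cos_intmul_2pi R 1; have := @sin_intmul_2pi R 1; rewrite mul1r.
  by rewrite /circle c2 s2 cos0 sin0 subrr.
rewrite RintegralD; [|exact: measurable_I|..]; last 2 first.
- by apply: integrable_mul; [exact: sqint_continuous|exact: sqint_casn].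
- apply: continuous_integrable => t; apply: cvgM; first exact: cvg_cst.
  by apply: cvgM; [exact: cf|exact: continuous_casn].
rewrite RintegralZl; [|exact: measurable_I|]; last first.
  by apply: integrable_mul; [exact: sqint_continuous|exact: sqint_casn].
move=> /eqP; rewrite addr_eq0 => /eqP E.
by rewrite /har /ip E; ring.
Qed.

Lemma constant_on_interval (u : R -> R) (a b : R) :
  (forall s, a < s < b -> is_derive s (1 : R) u 0) ->
  forall x y, a < x < b -> a < y < b -> u x = u y.
Proof.
move=> du x y xab yab; have [s hs|s _] := @mean_value _ u (fun=> 0) x y.
  apply: du; move: xab yab hs => /andP[? ?] /andP[? ?].
  by case: (leP x y) => _ /andP[? ?]; apply/andP; split; lra.
by rewrite mulr0 => /eqP; rewrite subr_eq0 => /eqP.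
Qed.

(* The Wronskian of two solutions of [r (r u')' = (c - k^2 r^2) u] is constant;
   boundedness of the solutions at the origin makes it zero. *)
Lemma wronskian0 (A P j p : R -> R) rho c k C : 0 < rho ->
  (forall r, 0 < r < rho -> is_derive r (1 : R) A (P r / r)) ->
  (forall r, 0 < r < rho -> is_derive r (1 : R) P ((c - k ^+ 2 * r ^+ 2) * A r / r)) ->
  (forall r, 0 < r < rho -> is_derive r (1 : R) j (p r / r)) ->
  (forall r, 0 < r < rho -> is_derive r (1 : R) p ((c - k ^+ 2 * r ^+ 2) * j r / r)) ->
  (forall r, 0 < r < rho / 2 ->
     [/\ `|A r| <= C, `|j r| <= C, `|P r| <= C * r & `|p r| <= C * r]) ->
  forall r, 0 < r < rho -> A r * p r - P r * j r = 0.
Proof.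
move=> rho0 dA dP dj dp bd r rr; apply/eqP; rewrite -normr_le0; apply/ler_addgt0Pr => e e0.
pose W s := A s * p s - P s * j s.
have dW s : 0 < s < rho -> is_derive s (1 : R) W 0.
  move=> sr; have h := is_deriveB (is_deriveM (dA s sr) (dp s sr)) (is_deriveM (dP s sr) (dj s sr)).
  by move: h => /is_derive_eq; apply; rewrite /GRing.scale /=; ring.
have C0 : 0 <= C.
  have [|h _ _ _] := bd (rho / 4); first by apply/andP; split; lra.
  exact: le_trans h.
(* A radius in the range of the bounds and so small that |W s| <= 2 C^2 s <= e; the summand 1 keeps
   the denominator positive when C = 0. *)
pose s := Num.min (rho / 4) (e / (2 * C ^+ 2 + 1)).
have D0 : 0 < 2 * C ^+ 2 + 1 by rewrite ltr_wpDl // mulr_ge0 ?sqr_ge0.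
have s0 : 0 < s by rewrite lt_min divr_gt0 ?divr_gt0.
have s1 : s <= rho / 4 by rewrite ge_min lexx.
have s2 : s <= e / (2 * C ^+ 2 + 1) by rewrite ge_min lexx orbT.
have -> : A r * p r - P r * j r = W s.
  by apply: (constant_on_interval dW) => //; apply/andP; split; lra.
have [|h1 h2 h3 h4] := bd s; first by apply/andP; split; lra.
rewrite add0r; apply: le_trans (ler_normB _ _) _; rewrite !normrM.
apply: le_trans (_ : C * (C * s) + C * s * C <= _).
  by apply: lerD; apply: ler_pM.
move: s2; rewrite ler_pdivlMr //; have := sqr_ge0 C; nra.
Qed.

(** Uniqueness for the Cauchy problem away from the singular point r = 0, by an energy argument: the
    constant K dominates the coefficients of the system on [r0, rho), so (h^2 + H^2) exp(- K s)
    cannot grow. *)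
Lemma linear_ode_zero (h H : R -> R) rho c k r0 : 0 < r0 -> 0 <= c ->
  (forall r, 0 < r < rho -> is_derive r (1 : R) h (H r / r)) ->
  (forall r, 0 < r < rho -> is_derive r (1 : R) H ((c - k ^+ 2 * r ^+ 2) * h r / r)) ->
  h r0 = 0 -> H r0 = 0 -> forall r, r0 <= r < rho -> h r = 0 /\ H r = 0.
Proof.
move=> r00 c0 dh dH h0 H0 r /andP[r0r rr].
pose K := (1 + c + k ^+ 2 * rho ^+ 2) / r0.
pose F s := (h s ^+ 2 + H s ^+ 2) * expR (- K * s).
pose dFv s := (2 * h s * H s * (1 + c - k ^+ 2 * s ^+ 2) / s - K * (h s ^+ 2 + H s ^+ 2)) * expR (- K * s).
have dF s : 0 < s < rho -> is_derive s (1 : R) F (dFv s).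
  move=> sr; have d1 := dh s sr; have d2 := dH s sr.
  have -> : F = (fun s => (h s * h s + H s * H s) * expR (- K * s)).
    by apply/funext => z; rewrite /F !expr2.
  have d3 : is_derive s (1 : R) (fun s => expR (- K * s)) (- K * expR (- K * s)).
    by apply: is_derive_eq; rewrite /GRing.scale /=; ring.
  have := is_deriveM (is_deriveD (is_deriveM d1 d1) (is_deriveM d2 d2)) d3.
  move=> /is_derive_eq; apply.
  by rewrite -[(h * h + H * H) s]/(h s * h s + H s * H s) /dFv /GRing.scale /=; ring.
have [s hs|s] := @mean_value _ F dFv r0 r.
  by apply: dF; move: hs; rewrite (min_idPl r0r) (max_idPr r0r) => /andP[? ?]; apply/andP; split; lra.
rewrite (min_idPl r0r) (max_idPr r0r) => /andP[r0s sr].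
rewrite {2}/F h0 H0 expr0n addr0 mul0r subr0 => E.
have s0 : 0 < s by exact: lt_le_trans r0s.
(* By the mean value theorem F r is (r - r0) times the derivative at [s]. That derivative is
   nonpositive, since 2 |h H| <= h^2 + H^2 and 1 / s <= 1 / r0. *)
have : F r <= 0.
  rewrite E /dFv mulr_ge0_le0 ?subr_ge0 // pmulr_lle0 ?expR_gt0 // subr_le0.
  rewrite ler_pdivrMr //; apply: le_trans (_ : (h s ^+ 2 + H s ^+ 2) * (1 + c + k ^+ 2 * rho ^+ 2) <= _).
    have ks : 0 <= k ^+ 2 * s ^+ 2 by rewrite mulr_ge0 ?sqr_ge0.
    have ks' : k ^+ 2 * s ^+ 2 <= k ^+ 2 * rho ^+ 2.
      rewrite ler_wpM2l ?sqr_ge0 // lerXn2r ?nnegrE; lra.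
    have q1 := sqr_ge0 (h s - H s); have q2 := sqr_ge0 (h s + H s).
    set X := 1 + c - _; have X1 : - (1 + c + k ^+ 2 * rho ^+ 2) <= X by rewrite /X; lra.
    have X2 : X <= 1 + c + k ^+ 2 * rho ^+ 2 by rewrite /X; lra.
    move: X1 X2; set Y := 1 + c + _ => X1 X2.
    have := mulr_ge0 q1 (_ : 0 <= Y + X); have := mulr_ge0 q2 (_ : 0 <= Y - X).
    move=> /(_ _)/wrap[]; first lra. move=> h1 /(_ _)/wrap[]; first lra.
    move=> h2; nra.
  rewrite [leRHS](_ : _ = (h s ^+ 2 + H s ^+ 2) * (1 + c + k ^+ 2 * rho ^+ 2) * (s / r0)); last by rewrite /K; ring.
  rewrite ler_peMr // ?ler_pdivlMr ?mul1r //.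
  have q1 := sqr_ge0 (h s); have q2 := sqr_ge0 (H s).
  have q3 : 0 <= k ^+ 2 * rho ^+ 2 by rewrite mulr_ge0 ?sqr_ge0.
  by apply: mulr_ge0; lra.
rewrite /F pmulr_lle0 ?expR_gt0 // => E0.
have a := sqr_ge0 (h r); have b := sqr_ge0 (H r).
by split; apply/eqP; rewrite -sqrf_eq0; apply/eqP; lra.
Qed.

End RadialODE.

(** * Bessel's equation for the coefficients of a Helmholtz solution *)

Section HelmholtzCoefficients.
Context {R : realType}.
Notation mu := (@lebesgue_measure R).
Notation T := (measurableTypeR R).
Notation I := (`[0, 2 * pi]%classic : set T).
Implicit Types (r s t c k rho Rad M : R) (n : int) (m N : nat).

(** J_m(k r) without its factor (k / 2)^m, which cancels in all ratios; [besselr_radial] is its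
    image under r d/dr. *)
Definition besselr k m r : R := r ^+ m * besselG m (k ^+ 2 * r ^+ 2).

Definition besselr_radial k m r : R :=
  r ^+ m * (m%:R * besselG m (k ^+ 2 * r ^+ 2)
            - k ^+ 2 * r ^+ 2 / 2 * besselG m.+1 (k ^+ 2 * r ^+ 2)).

Lemma is_derive_besselG_sqr k m r :
  is_derive r (1 : R) (fun s => besselG m (k ^+ 2 * s ^+ 2))
    (- (k ^+ 2 * r / 2) * besselG m.+1 (k ^+ 2 * r ^+ 2)).
Proof.
have d : is_derive r (1 : R) (fun s => k ^+ 2 * s ^+ 2 : R) (2 * k ^+ 2 * r).
  by apply: is_derive_eq; rewrite /GRing.scale /=; ring.
have := @is_derive1_comp _ (besselG m) (fun s => k ^+ 2 * s ^+ 2) r _ _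
  (is_derive_besselG m _) d.
by move=> /is_derive_eq; apply; rewrite /GRing.scale /=; field.
Qed.

Lemma is_derive_pow m r : r != 0 ->
  is_derive r (1 : R) (fun s : R => s ^+ m) (m%:R * r ^+ m / r).
Proof.
move=> r0; case: m => [|m].
  rewrite !mul0r (_ : (fun s => s ^+ 0) = cst 1); first exact: is_derive_cst.
  by apply/funext => s; rewrite expr0.
split; first exact: exprn_derivable.
by rewrite exp_derive /GRing.scale /= exprS; field.
Qed.

Lemma is_derive_besselr k m r : 0 < r ->
  is_derive r (1 : R) (besselr k m) (besselr_radial k m r / r).
Proof.
move=> r0; have rn : r != 0 by rewrite gt_eqF.
have := is_deriveM (is_derive_pow m rn) (is_derive_besselG_sqr k m r).
move=> /is_derive_eq; apply; rewrite /besselr_radial /GRing.scale /=.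
by field.
Qed.

(** Bessel's equation r (r j')' = (m^2 - k^2 r^2) j; the recurrence [besselG_ode] expresses G_m
    through G_(m+1) and G_(m+2), after which both sides agree. *)
Lemma is_derive_besselr_radial k m r : 0 < r ->
  is_derive r (1 : R) (besselr_radial k m)
    ((m%:R ^+ 2 - k ^+ 2 * r ^+ 2) * besselr k m r / r).
Proof.
move=> r0; have rn : r != 0 by rewrite gt_eqF.
have E : besselr_radial k m =
  (fun s => m%:R * besselr k m s - k ^+ 2 / 2 * (s ^+ m.+2 * besselG m.+1 (k ^+ 2 * s ^+ 2))).
  by apply/funext => s; rewrite /besselr_radial /besselr !exprS; field.
rewrite E.
have := is_deriveB (is_deriveM (is_derive_cst (m%:R : R) r (1 : R)) (is_derive_besselr k m r0))
  (is_deriveM (is_derive_cst (k ^+ 2 / 2 : R) r (1 : R))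
     (is_deriveM (is_derive_pow m.+2 rn) (is_derive_besselG_sqr k m.+1 r))).
move=> /is_derive_eq; apply.
have := besselG_ode m (k ^+ 2 * r ^+ 2); rewrite /besselr_radial /besselr /GRing.scale /=.
move=> /eqP; rewrite addrC -subr_eq0 subr0 => /eqP ode.
have -> : besselG m (k ^+ 2 * r ^+ 2) = m.+1%:R * besselG m.+1 (k ^+ 2 * r ^+ 2)
  - k ^+ 2 * r ^+ 2 / 4 * besselG m.+2 (k ^+ 2 * r ^+ 2) by lra.
rewrite -[m.+2%:R]natr1 -[m.+1%:R]natr1 !exprS.
by field.
Qed.

(** The dependence on m is explicit: 1 / m!, the power r^m and, for the derivative, one factor m +
    1; the rest depends only on k and [rho]. *)
Lemma besselr_bound k m r rho : 0 <= r <= rho ->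
  `|besselr k m r| <= m`!%:R^-1 * expR (k ^+ 2 * rho ^+ 2 / 4) * r ^+ m /\
  `|besselr_radial k m r| <=
    m`!%:R^-1 * expR (k ^+ 2 * rho ^+ 2 / 4) * (1 + k ^+ 2 * rho ^+ 2) * m.+1%:R * r ^+ m.
Proof.
move=> /andP[r0 rr]; have rho0 := le_trans r0 rr.
have s2 : k ^+ 2 * r ^+ 2 <= k ^+ 2 * rho ^+ 2.
  by rewrite ler_wpM2l ?sqr_ge0 // lerXn2r ?nnegrE.
have s0 : 0 <= k ^+ 2 * r ^+ 2 by rewrite mulr_ge0 ?sqr_ge0.
have G i : `|besselG i (k ^+ 2 * r ^+ 2)| <= i`!%:R^-1 * expR (k ^+ 2 * rho ^+ 2 / 4).
  apply: le_trans (besselG_bound _ _) _; rewrite ler_wpM2l ?invr_ge0 // ler_expR.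
  by rewrite ger0_norm // ler_pM2r ?invr_gt0.
set E := expR _ in G *; have E0 : 0 <= E by exact: expR_ge0.
have f0 : 0 <= m`!%:R^-1 :> R by rewrite invr_ge0.
split; rewrite normrM normrX (ger0_norm r0) mulrC ler_wpM2r ?exprn_ge0 //.
apply: le_trans (ler_normB _ _) _; rewrite !(normrM, normfV, normrX).
rewrite (ger0_norm (ler0n _ m)) (ger0_norm (ler0n _ 2)).
rewrite -!expr2 !real_normK ?num_real //.
have G1 : `|besselG m.+1 (k ^+ 2 * r ^+ 2)| <= m`!%:R^-1 * E.
  apply: le_trans (G _) _; rewrite ler_wpM2r // lef_pV2 ?posrE ?ltr0n ?fact_gt0 //.
  by rewrite ler_nat leq_fact.
have h1 : m%:R * `|besselG m (k ^+ 2 * r ^+ 2)| <= m%:R * (m`!%:R^-1 * E).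
  by rewrite ler_wpM2l.
have h2 : k ^+ 2 * r ^+ 2 / 2 * `|besselG m.+1 (k ^+ 2 * r ^+ 2)| <=
   k ^+ 2 * rho ^+ 2 * (m`!%:R^-1 * E).
  by apply: ler_pM => //; lra.
apply: le_trans (lerD h1 h2) _; rewrite -mulrDl mulrC -[leRHS]mulrA.
rewrite ler_wpM2l ?mulr_ge0 // -natr1.
have m0 : 0 <= m%:R :> R by [].
set q := k ^+ 2 * rho ^+ 2 in s2 *; have q0 : 0 <= q by exact: le_trans s2.
by have := mulr_ge0 m0 q0; lra.
Qed.

(** The boundedness at the origin that the Wronskian argument requires. The linear factor s in the
    last bound comes from r^m when m > 0, and from the term k^2 r^2 when m = 0. *)
Lemma besselr_near0 k m rho : exists K, [/\ 0 <= K,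
  forall s, 0 <= s <= rho -> `|besselr k m s| <= K &
  forall s, 0 <= s <= rho -> `|besselr_radial k m s| <= K * s].
Proof.
pose E := expR (k ^+ 2 * rho ^+ 2 / 4) : R.
have E0 : 0 <= E by exact: expR_ge0.
have [rho0|rhoN] := leP 0 rho; last first.
  by exists 0; split => // s /andP[a b]; move: (le_trans a b); rewrite leNgt rhoN.
have K1 s : 0 <= s <= rho -> `|besselr k m s| <= m`!%:R^-1 * E * rho ^+ m.
  move=> /[dup] sr /andP[s0 s1]; apply: le_trans (besselr_bound k m sr).1 _.
  by rewrite ler_wpM2l ?mulr_ge0 ?invr_ge0 // lerXn2r ?nnegrE.
have [K2 K20 hK2] : exists2 K, 0 <= K & forall s, 0 <= s <= rho -> `|besselr_radial k m s| <= K * s.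
  case: m {K1} => [|m].
    have q0 : 0 <= k ^+ 2 by exact: sqr_ge0.
    exists (k ^+ 2 * rho * E); first by do 2?apply: mulr_ge0.
    move=> s /[dup] sr /andP[s0 s1].
    rewrite /besselr_radial expr0 mul1r mul0r sub0r normrN.
    have g : `|besselG 1 (k ^+ 2 * s ^+ 2)| <= E.
      apply: le_trans (besselG_bound _ _) _; rewrite [1`!](_ : _ = 1%N) // invr1 mul1r.
      rewrite ler_expR ger0_norm ?(mulr_ge0 _ (sqr_ge0 _)) // ler_pM2r ?invr_gt0 //.
      by rewrite ler_wpM2l ?sqr_ge0 // lerXn2r ?nnegrE.
    have p0 : 0 <= k ^+ 2 * s ^+ 2 / 2 by do 2?apply: mulr_ge0 => //; exact: sqr_ge0.
    rewrite normrM (ger0_norm p0).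
    rewrite [leRHS](_ : _ = (k ^+ 2 * rho * s) * E); last by ring.
    apply: ler_pM => //.
    have ss : s ^+ 2 / 2 <= rho * s.
      have := mulr_ge0 s0 (_ : 0 <= rho - s); rewrite subr_ge0 => /(_ s1).
      have := sqr_ge0 s; rewrite expr2; lra.
    by rewrite -[leLHS]mulrA -[leRHS]mulrA; exact: ler_wpM2l.
  exists (m.+1`!%:R^-1 * E * (1 + k ^+ 2 * rho ^+ 2) * m.+2%:R * rho ^+ m).
    by rewrite !mulr_ge0 ?invr_ge0 ?exprn_ge0 // addr_ge0 // mulr_ge0 ?sqr_ge0.
  move=> s /[dup] sr /andP[s0 s1]; apply: le_trans (besselr_bound k m.+1 sr).2 _.
  rewrite [s ^+ m.+1]exprSr mulrA ler_wpM2r //; apply: ler_wpM2l; last by rewrite lerXn2r ?nnegrE.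
  by rewrite !mulr_ge0 ?invr_ge0 // addr_ge0 // mulr_ge0 ?sqr_ge0.
exists (m`!%:R^-1 * E * rho ^+ m + K2); split => [|s sr|s sr].
- by rewrite addr_ge0 // !mulr_ge0 ?invr_ge0 ?exprn_ge0.
- by apply: le_trans (K1 _ sr) _; rewrite lerDl.
- apply: le_trans (hK2 _ sr) _; rewrite ler_wpM2r //; first by case/andP: sr.
  by rewrite lerDr !mulr_ge0 ?invr_ge0 ?exprn_ge0.
Qed.

Lemma finite_bound (f : nat -> R) N : exists2 C, 0 <= C & forall m, (m < N)%N -> f m <= C.
Proof.
exists (\sum_(i < N) `|f i|); first exact: sumr_ge0.
move=> m mN; rewrite (bigD1 (Ordinal mN)) //=.
by apply: le_trans (ler_norm _) _; rewrite lerDl sumr_ge0.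
Qed.

(** Since |m! G_m(s) - 1| <= exp(|s| / 4) / (m + 1), the value m! |G_m(s)| is at least 1/2 as soon
    as the right side is at most 1/2. This applies also at s = k^2 rho^2, where finitely many G_m
    may vanish. *)
Lemma besselG_lower_large s :
  exists N, forall m, (N <= m)%N -> m`!%:R^-1 <= 2 * `|besselG m s|.
Proof.
exists (Num.truncn (2 * expR (`|s| / 4))) => m Nm.
have f0 : 0 < m`!%:R :> R by rewrite ltr0n fact_gt0.
rewrite -[leLHS]mul1r ler_pdivrMr //.
have h1 : expR (`|s| / 4) / m.+1%:R <= 2^-1.
  rewrite ler_pdivrMr ?ltr0n // ler_pdivlMl // ltW //.
  by rewrite -truncn_le_nat.
have := le_trans (besselG_near1 m s) h1.
rewrite -[X in _ <= _ * X](ger0_norm (ltW f0)) -mulrA -normrM.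
have := ler_norm (1 - besselG m s * m`!%:R); rewrite distrC.
have := ler_norm (besselG m s * m`!%:R); lra.
Qed.

Lemma besselG_lower s : (forall m, besselG m s != 0) ->
  exists2 C, 0 < C & forall m, m`!%:R^-1 <= C * `|besselG m s|.
Proof.
move=> nz; have [N hN] := besselG_lower_large s.
have [C C0 hC] := finite_bound (fun m => m`!%:R^-1 / `|besselG m s|) N.
exists (C + 2); first by rewrite ltr_wpDl.
move=> m; rewrite -ler_pdivrMr ?normr_gt0 //.
have [mN|Nm] := ltnP m N; first by rewrite (le_trans (hC _ mN)) // lerDl.
by rewrite ler_pdivrMr ?normr_gt0 // (le_trans (hN _ Nm)) // ler_wpM2r // lerDr.
Qed.

Definition helmholtz_in k rho (a ax ay : R * R -> R) := exists axx axy ayx ayy,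
  [/\ C1on (disk rho) a ax ay, C1on (disk rho) ax axx axy,
      C1on (disk rho) ay ayx ayy &
      forall p, disk rho p -> axx p + ayy p = - k ^+ 2 * a p].

(** In polar form r^2 lap a = (r d/dr)^2 a + (d/dtheta)^2 a. The equation replaces the left side by
    - k^2 r^2 a, and two angular integrations by parts send n to - n and back, with total factor -
    n^2. *)
Lemma is_derive_har_radial k rho a ax ay n r : helmholtz_in k rho a ax ay ->
  0 < r < rho ->
  is_derive r (1 : R) (fun s => har (fun t => radial ax ay (circle s t)) n)
    (((`|n|%N%:R) ^+ 2 - k ^+ 2 * r ^+ 2) * har (fun t => a (circle r t)) n / r).
Proof.
move=> [axx [axy [ayx [ayy [A X Y lap]]]]] rr.
have XR := C1on_radial X Y; have XT := C1on_angular X Y.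
have := is_derive_har n rr XR; move=> /is_derive_eq; apply; congr (_ / r).
set U := fun t => radial _ _ _.
have cU : continuous U.
  move=> t; exact: (continuous_circle (continuous_radial XR (disk_circle t rr)).1).
set V := fun t => angularD (fun p => ay p + (p.1 * ayx p - p.2 * axx p))
  (fun p => - ax p + (p.1 * ayy p - p.2 * axy p)) (circle r t).
have cV : continuous V.
  move=> t; exact: (continuous_circle (continuous_radial XT (disk_circle t rr)).2).
have ca := continuous_circle_angle rr A.
(* Here [U] is the second radial and [V] the second angular derivative on the circle; adding them
   cancels the mixed and first-order terms. *)
have E t : U t = - (k ^+ 2 * r ^+ 2) * a (circle r t) + (-1) * V t.
  have l := lap _ (disk_circle t rr).
  have e : (circle r t).1 ^+ 2 + (circle r t).2 ^+ 2 = r ^+ 2.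
    by rewrite -sqr_enorm enorm_circle // ltW; case/andP: rr.
  have -> : - (k ^+ 2 * r ^+ 2) * a (circle r t) =
    r ^+ 2 * (axx (circle r t) + ayy (circle r t)) by rewrite l; ring.
  rewrite -e /U /V /radial /angularD; ring.
have -> : U = (fun t => - (k ^+ 2 * r ^+ 2) * a (circle r t) + (-1) * V t) by exact/funext.
have sa := sqint_continuous ca; have sV := sqint_continuous cV.
rewrite /har ipDl ?ipZl //; try exact: sqint_casn; try exact: sqintZ.
rewrite mulrDr mulrCA -/(har _ n) [X in _ + X]mulrCA -/(har V n).
rewrite (har_angular n rr XT) (har_angular (- n) rr A) opprK rmorphN opprK /=.
have -> : (n%:~R : R) = (if n is Posz _ then 1 else -1) * `|n|%N%:R.
  case: (n) => m; first by rewrite mul1r.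
  by rewrite NegzE mulN1r abszN absz_nat rmorphN.
by case: (n) => m; ring.
Unshelve. all: by [].
Qed.

(** The cross-multiplied differences [h] and [H] solve the radial system. At [Rad], h vanishes
    trivially and H is minus the Wronskian, hence zero; uniqueness then keeps both zero up to [rho],
    across any zero of J_n(k r). *)
Lemma har_proportional k rho a ax ay n Rad r : helmholtz_in k rho a ax ay ->
  0 < Rad -> Rad <= r < rho ->
  har (fun t => a (circle r t)) n * besselr k `|n|%N Rad =
  har (fun t => a (circle Rad t)) n * besselr k `|n|%N r /\
  har (fun t => radial ax ay (circle r t)) n * besselr k `|n|%N Rad =
  har (fun t => a (circle Rad t)) n * besselr_radial k `|n|%N r.
Proof.
move=> Hh R0 /[dup] Rr /andP[Rr1 rr]; have := Hh.
move=> [axx [axy [ayx [ayy [A X Y lap]]]]].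
have rho0 : 0 < rho by exact: lt_trans (lt_le_trans R0 Rr1) rr.
pose F s := har (fun t => a (circle s t)) n.
pose P s := har (fun t => radial ax ay (circle s t)) n.
have dF s : 0 < s < rho -> is_derive s (1 : R) F (P s / s).
  by move=> sr; exact: is_derive_har A.
have dP s (sr : 0 < s < rho) := is_derive_har_radial n Hh sr.
have dj s (sr : 0 < s < rho) := is_derive_besselr k `|n|%N (proj1 (andP sr)).
have dp s (sr : 0 < s < rho) := is_derive_besselr_radial k `|n|%N (proj1 (andP sr)).
(* On the disk of radius rho / 2 the field and its gradient are bounded; the radial derivative
   carries the factor |x| = s. *)
have bd : exists C, forall s, 0 < s < rho / 2 ->
   [/\ `|F s| <= C, `|besselr k `|n|%N s| <= C, `|P s| <= C * s &
       `|besselr_radial k `|n|%N s| <= C * s].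
  have sub p : enorm p <= rho / 2 -> disk rho p.
    by move=> h; apply: le_lt_trans h _; lra.
  have [|M1 M10 h1] := @compact_bounded _ [set x | enorm x <= rho / 2] a (@compact_cdisk _ _).
    by move=> p /sub Up; exact: (C1on_continuous A Up).
  have [|M2 M20 h2] := @compact_bounded _ [set x | enorm x <= rho / 2] ax (@compact_cdisk _ _).
    by move=> p /sub Up; exact: (C1on_continuous X Up).
  have [|M3 M30 h3] := @compact_bounded _ [set x | enorm x <= rho / 2] ay (@compact_cdisk _ _).
    by move=> p /sub Up; exact: (C1on_continuous Y Up).
  have [K [K0 hK1 hK2]] := besselr_near0 k `|n|%N rho.
  exists (M1 + M2 + M3 + K) => s /andP[s0 sr].
  have ec t : enorm (circle s t) <= rho / 2 by rewrite enorm_circle ltW.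
  have srho : 0 < s < rho by apply/andP; split; lra.
  have s0rho : 0 <= s <= rho by apply/andP; split; lra.
  split.
  - apply: le_trans (_ : M1 <= _); last by lra.
    apply: har_bound => [|t]; last exact: h1 (ec t).
    exact: continuous_measurable_I (continuous_circle_angle srho A).
  - by apply: le_trans (hK1 _ s0rho) _; lra.
  - apply: le_trans (_ : (M2 + M3) * s <= _); last by rewrite ler_pM2r //; lra.
    apply: har_bound => [|t].
      apply: continuous_measurable_I => t.
      exact: (continuous_circle (continuous_radial A (disk_circle t srho)).1).
    rewrite /radial mulrDl; apply: le_trans (ler_normD _ _) _; rewrite !normrM.
    have es : enorm (circle s t) = s by rewrite enorm_circle // ltW.
    apply: lerD; rewrite mulrC; apply: ler_pM => //.
    + exact: h2 (ec t).
    + by rewrite -normrM; have := ler_fst_enorm (circle s t); rewrite es.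
    + exact: h3 (ec t).
    + by rewrite -normrM; have := ler_snd_enorm (circle s t); rewrite es.
  - by apply: le_trans (hK2 _ s0rho) _; rewrite ler_pM2r //; lra.
move: bd => [C bd].
have W := wronskian0 rho0 dF dP dj dp bd.
pose h s := F s * besselr k `|n|%N Rad - F Rad * besselr k `|n|%N s.
pose H s := P s * besselr k `|n|%N Rad - F Rad * besselr_radial k `|n|%N s.
have dh s : 0 < s < rho -> is_derive s (1 : R) h (H s / s).
  move=> sr; have := is_deriveB (is_deriveM (dF s sr) (is_derive_cst (besselr k `|n|%N Rad) s (1 : R)))
    (is_deriveM (is_derive_cst (F Rad) s (1 : R)) (dj s sr)).
  by move=> /is_derive_eq; apply; rewrite /H /GRing.scale /=; ring.
have dH s : 0 < s < rho -> is_derive s (1 : R) H ((`|n|%N%:R ^+ 2 - k ^+ 2 * s ^+ 2) * h s / s).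
  move=> sr; have := is_deriveB (is_deriveM (dP s sr) (is_derive_cst (besselr k `|n|%N Rad) s (1 : R)))
    (is_deriveM (is_derive_cst (F Rad) s (1 : R)) (dp s sr)).
  by move=> /is_derive_eq; apply; rewrite /h /F /GRing.scale /=; ring.
have h0 : h Rad = 0 by rewrite /h subrr.
have H0 : H Rad = 0.
  have RR : 0 < Rad < rho by rewrite R0 (le_lt_trans Rr1 rr).
  by rewrite /H; have := W _ RR; lra.
have [] := linear_ode_zero R0 (sqr_ge0 _) dh dH h0 H0 Rr.
by rewrite /h /H => /eqP; rewrite subr_eq0 => /eqP -> /eqP; rewrite subr_eq0 => /eqP ->.
Qed.

End HelmholtzCoefficients.

(** * Error estimates for real fields *)

Section CoefficientDecay.
Context {R : realType}.
Implicit Types (r s t c k rho Rad M q : R) (n : int) (m N : nat).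

(** The coefficient is [c n] times [besselr]. A bound near r = [rho] limits |c n| by a multiple of
    |n|! / rho^|n|, and the upper bound of [besselr] at r turns this into (r / rho)^|n|. *)
Lemma har_decay k rho Rad a ax ay r0 M : 0 < Rad < rho ->
  helmholtz_in k rho a ax ay ->
  (forall m, besselG m (k ^+ 2 * Rad ^+ 2) != 0) ->
  r0 < rho ->
  (forall r n, r0 < r < rho -> `|har (fun t => a (circle r t)) n| <= M) ->
  exists2 C, 0 <= C & forall r n, Rad <= r < rho ->
    `|har (fun t => a (circle r t)) n| <= C * (r / rho) ^+ `|n|%N /\
    `|har (fun t => radial ax ay (circle r t)) n| <=
      C * `|n|%N.+1%:R * (r / rho) ^+ `|n|%N.
Proof.
move=> /andP[R0 Rrho] Hh nz r0rho hM; have rho0 := lt_trans R0 Rrho.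
have jR m : besselr k m Rad != 0 by rewrite mulf_neq0 // expf_neq0 // gt_eqF.
pose c n := har (fun t => a (circle Rad t)) n / besselr k `|n|%N Rad.
have e r n (Rr : Rad <= r < rho) :
    har (fun t => a (circle r t)) n = c n * besselr k `|n|%N r /\
    har (fun t => radial ax ay (circle r t)) n = c n * besselr_radial k `|n|%N r.
  have [h1 h2] := har_proportional n Hh R0 Rr.
  by split; apply: (mulIf (jR `|n|%N)); rewrite ?h1 ?h2 /c;
    field; exact: jR.
(* The coefficients are controlled only for r < [rho]; continuity of [besselr] carries the bound to
   [rho] itself. *)
have b n : `|c n| * `|besselr k `|n|%N rho| <= M.
  have cj : (fun s => `|c n| * `|besselr k `|n|%N s|) @ rho^'- -->
      `|c n| * `|besselr k `|n|%N rho|.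
    apply: cvg_at_left_filter; apply: cvgM; first exact: cvg_cst.
    apply: cvg_norm; exact: is_derive1_continuous (is_derive_besselr _ _ rho0).
  rewrite -(cvg_lim (@Rhausdorff R) cj); apply: limr_le.
    by apply/cvg_ex; eexists; exact: cj.
  near=> s.
  have s1 : r0 < s by near: s; exact: nbhs_left_gt.
  have s2 : Rad < s by near: s; exact: nbhs_left_gt.
  have s3 : s < rho by near: s; exact: nbhs_left_lt.
  rewrite -normrM; have [|<- _] := e s n; first by rewrite ltW.
  by apply: hM; rewrite s1.
have M0 : 0 <= M by apply: le_trans (b 0); rewrite mulr_ge0.
have [N hN] := besselG_lower_large (k ^+ 2 * rho ^+ 2).
(* For small |n| the function [besselr] may vanish at [rho] and the bound above says nothing; these
   finitely many [c n], of both signs of n, are bounded by brute force. *)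
have [C0 C00 hC0] := finite_bound (fun m => (`|c m%:Z| + `|c (- m%:Z)|) * (rho ^+ m / m`!%:R)) N.
have fr m : 0 <= rho ^+ m / m`!%:R by rewrite divr_ge0 // exprn_ge0 // ltW.
pose C1 := C0 + 2 * M.
have C10 : 0 <= C1 by rewrite addr_ge0 // mulr_ge0.
have hc n : `|c n| * (rho ^+ `|n|%N / `|n|%N`!%:R) <= C1.
  have [nN|Nn] := ltnP `|n|%N N.
    apply: le_trans (_ : C0 <= _); last by rewrite lerDl mulr_ge0.
    apply: le_trans (hC0 _ nN); rewrite ler_wpM2r //.
    by case: (n) => m; rewrite ?NegzE ?abszN absz_nat ?lerDl ?lerDr.
  apply: le_trans (_ : 2 * M <= _); last by rewrite lerDr.
  apply: le_trans (_ : 2 * (`|c n| * `|besselr k `|n|%N rho|) <= _); last first.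
    by rewrite ler_wpM2l.
  rewrite [leRHS]mulrCA ler_wpM2l // /besselr normrM normrX (gtr0_norm rho0).
  by rewrite [leRHS]mulrCA ler_wpM2l ?hN // exprn_ge0 // ltW.
pose E := expR (k ^+ 2 * rho ^+ 2 / 4).
have E0 : 0 <= E by exact: expR_ge0.
pose Q := 1 + k ^+ 2 * rho ^+ 2.
have Q1 : 1 <= Q by rewrite lerDl mulr_ge0 ?sqr_ge0.
exists (C1 * E * Q) => [|r n Rr].
  by rewrite !mulr_ge0 // (le_trans _ Q1).
have [-> ->] := e r n Rr; case/andP: Rr => Rr rr.
have rp : 0 <= r by apply: le_trans Rr; exact: ltW.
have [|B1 B2] := @besselr_bound R k `|n|%N r rho; first by rewrite rp ltW.
have X : `|c n| * (`|n|%N`!%:R^-1 * r ^+ `|n|%N) <= C1 * (r / rho) ^+ `|n|%N.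
  have -> : `|n|%N`!%:R^-1 * r ^+ `|n|%N =
     (rho ^+ `|n|%N / `|n|%N`!%:R) * (r / rho) ^+ `|n|%N.
    rewrite expr_div_n; have rn : rho ^+ `|n|%N != 0 by rewrite expf_neq0 // gt_eqF.
    have fn : `|n|%N`!%:R != 0 :> R by rewrite pnatr_eq0 -lt0n fact_gt0.
    by field; rewrite rn fn.
  by rewrite mulrA ler_wpM2r // exprn_ge0 // divr_ge0 // ltW.
have P0 : 0 <= (r / rho) ^+ `|n|%N by rewrite exprn_ge0 // divr_ge0 // ltW.
split; rewrite normrM.
- apply: le_trans (ler_wpM2l (normr_ge0 _) B1) _.
  rewrite [leLHS](_ : _ = E * (`|c n| * (`|n|%N`!%:R^-1 * r ^+ `|n|%N))); last by rewrite /E; ring.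
  apply: le_trans (ler_wpM2l E0 X) _.
  rewrite [leRHS](_ : _ = E * (C1 * (r / rho) ^+ `|n|%N) * Q); last by ring.
  by rewrite ler_peMr // !mulr_ge0.
- apply: le_trans (ler_wpM2l (normr_ge0 _) B2) _.
  rewrite [leLHS](_ : _ = E * Q * `|n|%N.+1%:R * (`|c n| * (`|n|%N`!%:R^-1 * r ^+ `|n|%N))); last by rewrite /E /Q; ring.
  rewrite [leRHS](_ : _ = E * Q * `|n|%N.+1%:R * (C1 * (r / rho) ^+ `|n|%N)); last by ring.
  by rewrite ler_wpM2l // !mulr_ge0 // (le_trans _ Q1).
Unshelve. all: by end_near.
Qed.

(** The upper bound at r and the lower bound at [Rad] both carry 1 / m!, so only (r / Rad)^m
    survives, with a constant uniform in m and r. *)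
Lemma besselr_ratio k rho Rad : 0 < Rad ->
  (forall m, besselG m (k ^+ 2 * Rad ^+ 2) != 0) ->
  exists2 C, 0 <= C & forall r m, 0 <= r <= rho ->
    `|besselr k m r / besselr k m Rad| <= C * (r / Rad) ^+ m /\
    `|besselr_radial k m r / besselr k m Rad| <= C * m.+1%:R * (r / Rad) ^+ m.
Proof.
move=> R0 nz; have [C C0 hC] := besselG_lower nz.
pose E := expR (k ^+ 2 * rho ^+ 2 / 4).
have E0 : 0 <= E by exact: expR_ge0.
pose Q := 1 + k ^+ 2 * rho ^+ 2.
have Q1 : 1 <= Q by rewrite lerDl mulr_ge0 ?sqr_ge0.
exists (C * E * Q) => [|r m rr]; first by rewrite !mulr_ge0 ?(le_trans _ Q1) // ltW.
have [B1 B2] := besselr_bound k m rr; case/andP: rr => r0 rr.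
have P0 : 0 <= (r / Rad) ^+ m by rewrite exprn_ge0 // divr_ge0 // ltW.
have X : m`!%:R^-1 * r ^+ m / `|besselr k m Rad| <= C * (r / Rad) ^+ m.
  rewrite /besselr normrM normrX (gtr0_norm R0) ler_pdivrMr; last first.
    by rewrite mulr_gt0 ?exprn_gt0 ?normr_gt0.
  rewrite expr_div_n (_ : _ * (_ * _) = C * `|besselG m (k ^+ 2 * Rad ^+ 2)| * r ^+ m).
    by rewrite ler_wpM2r ?exprn_ge0.
  by field; rewrite expf_neq0 // gt_eqF.
have J0 : 0 <= `|besselr k m Rad|^-1 by rewrite invr_ge0.
split; rewrite normrM normfV.
- apply: le_trans (ler_wpM2r J0 B1) _.
  rewrite [leLHS](_ : _ = E * (m`!%:R^-1 * r ^+ m / `|besselr k m Rad|)); last by rewrite /E; ring.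
  apply: le_trans (ler_wpM2l E0 X) _.
  rewrite [leRHS](_ : _ = E * (C * (r / Rad) ^+ m) * Q); last by ring.
  by rewrite ler_peMr // !mulr_ge0 // ltW.
- apply: le_trans (ler_wpM2r J0 B2) _.
  rewrite [leLHS](_ : _ = E * Q * m.+1%:R * (m`!%:R^-1 * r ^+ m / `|besselr k m Rad|)); last by rewrite /E /Q; ring.
  rewrite [leRHS](_ : _ = E * Q * m.+1%:R * (C * (r / Rad) ^+ m)); last by ring.
  by rewrite ler_wpM2l // !mulr_ge0 // (le_trans _ Q1).
Qed.

Lemma geometric_tail q N (M : nat) : 0 <= q < 1 ->
  \sum_(N <= i < M) q ^+ i.+1 <= q ^+ N / (1 - q).
Proof.
move=> /andP[q0 q1]; have d0 : 0 < 1 - q by rewrite subr_gt0.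
have [NM|MN] := leqP N M; last first.
  by rewrite (big_geq (ltnW MN)) divr_ge0 ?exprn_ge0 ?(ltW d0).
rewrite ler_pdivlMr // mulr_suml.
under eq_bigr => i _ do rewrite mulrBr mulr1 -exprSr -opprB.
rewrite sumrN telescope_sumr // opprB.
apply: le_trans (_ : q ^+ N.+1 <= _); first by rewrite lerBlDr lerDl exprn_ge0.
by rewrite exprS ler_piMl ?exprn_ge0 // ltW.
Qed.

(* Bernoulli: j p^j <= p / (1 - p). *)
Lemma natr_expr_le q j : 0 < q < 1 -> j%:R * q ^+ j <= q / (1 - q).
Proof.
move=> /andP[q0 q1]; have d0 : 0 < 1 - q by rewrite subr_gt0.
have h : 1 + j%:R * (q^-1 - 1) <= q^-1 ^+ j.
  have h0 : 0 <= q^-1 - 1 by rewrite subr_ge0 invf_ge1 // ltW.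
  elim: j => [|j IH]; first by rewrite mul0r addr0 expr0.
  rewrite exprS; apply: le_trans (_ : q^-1 * (1 + j%:R * (q^-1 - 1)) <= _); last first.
    by rewrite ler_wpM2l // invr_ge0 ltW.
  set y := q^-1 - 1 in h0 *; have -> : q^-1 = 1 + y by rewrite /y addrC subrK.
  rewrite -natr1; have := mulr_ge0 (mulr_ge0 (ler0n R j) h0) h0; lra.
rewrite exprVn in h; have qj : 0 < q ^+ j by rewrite exprn_gt0.
have h2 : j%:R * (q^-1 - 1) * q ^+ j <= 1.
  by rewrite -ler_pdivlMr // mul1r (le_trans _ h) // lerDr.
rewrite ler_pdivlMr //; have -> : j%:R * q ^+ j * (1 - q) = (j%:R * (q^-1 - 1) * q ^+ j) * q.
  by field; rewrite gt_eqF.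
by rewrite ler_piMl // ltW.
Qed.

(** Write q = p^2: one power p^(j+1) absorbs the linear weight, the other is summed geometrically.
    The weight i + 2 is |n| + 1 at |n| = i + 1. *)
Lemma arith_geometric_tail q : 0 < q < 1 -> exists2 K, 0 <= K &
  forall N (M : nat), (0 < N)%N -> \sum_(N <= i < M) i.+2%:R * q ^+ i.+1 <= K * N%:R * q ^+ N.
Proof.
move=> /andP[q0 q1]; pose p := Num.sqrt q.
have p0 : 0 < p by rewrite sqrtr_gt0.
have pq : q = p ^+ 2 by rewrite sqr_sqrtr // ltW.
have p1 : p < 1 by rewrite -sqrtr1 ltr_sqrt.
pose L := 3 + p / (1 - p).
have d0 : 0 < 1 - p by rewrite subr_gt0.
have L0 : 0 <= L by rewrite addr_ge0 // divr_ge0 // ltW.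
exists (L / (1 - p)) => [|N M N0]; first by rewrite divr_ge0 // ltW.
have [NM|MN] := leqP N M; last first.
  by rewrite (big_geq (ltnW MN)) !mulr_ge0 ?invr_ge0 ?exprn_ge0 ?(ltW d0) ?(ltW q0).
rewrite -{1}[N]add0n big_addn.
apply: le_trans (_ : \sum_(0 <= j < M - N) (N%:R * q ^+ N * L) * p ^+ j.+1 <= _); last first.
  rewrite -mulr_sumr.
  have := @geometric_tail p 0 (M - N); rewrite expr0 mul1r => /(_ _)/wrap[]; first by rewrite p1 ltW.
  move=> h; rewrite [leRHS](_ : _ = N%:R * q ^+ N * L * (1 - p)^-1); last by ring.
  by rewrite ler_wpM2l // !mulr_ge0 // exprn_ge0 // ltW.
apply: ler_sum => j _.
have Nr : 1 <= N%:R :> R by rewrite ler1n.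
have -> : q ^+ (j + N).+1 = q ^+ N * (p ^+ j.+1 * p ^+ j.+1).
  by rewrite -addSn exprD mulrC; congr (_ * _); rewrite pq -expr2 -!exprM mulnC.
(* Split j + N + 2 into j + 1, handled by [natr_expr_le], and N + 1 <= 3 N; this gives the two
   summands of [L]. *)
have h : (j + N).+2%:R * p ^+ j.+1 <= N%:R * L.
  have h1 := natr_expr_le j.+1 (_ : 0 < p < 1); rewrite p0 p1 in h1; move: (h1 isT) => {}h1.
  have h2 : p ^+ j.+1 <= 1 by rewrite exprn_ile1 // ltW.
  have -> : (j + N).+2%:R = j.+1%:R + (1 + N%:R) :> R by rewrite -[1 + N%:R]/(1%:R + _) -!natrD; congr (_%:R); lia.
  rewrite mulrDl /L mulrDr [leRHS]addrC; apply: lerD.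
    by apply: le_trans h1 _; rewrite ler_peMl // divr_ge0 // ltW.
  by have := exprn_ge0 j.+1 (ltW p0); nra.
rewrite [leLHS](_ : _ = q ^+ N * p ^+ j.+1 * ((j + N).+2%:R * p ^+ j.+1)); last by ring.
rewrite [leRHS](_ : _ = q ^+ N * p ^+ j.+1 * (N%:R * L)); last by ring.
by rewrite ler_wpM2l // mulr_ge0 // exprn_ge0 // ltW.
Qed.

Lemma symsum_norm_le N (F : int -> R) (b : nat -> R) :
  (forall n, `|F n| <= b `|n|%N) ->
  `|symsum N F| <= 2 * \sum_(i < N.+1) b i.
Proof.
move=> hF; rewrite symsumE big_ord_recl.
have b0 : 0 <= b 0%N by apply: le_trans (hF 0).
apply: le_trans (ler_normD _ _) _; rewrite mulrDr; apply: lerD.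
  by apply: le_trans (hF 0) _; rewrite ler_peMl // ler1n.
apply: le_trans (ler_norm_sum _ _ _) _; rewrite mulr_sumr; apply: ler_sum => i _.
apply: le_trans (ler_normD _ _) _.
have := hF i.+1%:Z; have := hF (- i.+1%:Z); rewrite abszN !absz_nat lift0; lra.
Qed.

Lemma geometric_growth s N : 1 < s ->
  \sum_(i < N.+1) s ^+ i <= s / (s - 1) * s ^+ N.
Proof.
move=> s1; have d0 : 0 < s - 1 by rewrite subr_gt0.
rewrite mulrAC ler_pdivlMr // mulrC -subrX1 exprS lerBlDr lerDl ler01 //.
Qed.

End CoefficientDecay.

(** * Truncation error and data error on a single circle *)

Section PointwiseErrors.
Context {R : realType}.
Notation T := (measurableTypeR R).
Notation I := (`[0, 2 * pi]%classic : set T).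
Implicit Types (r s t c k rho Rad q : R) (n : int) (m N : nat).

Lemma bcas_circle k n r t : 0 <= r ->
  bcas k n (circle r t) = besselr k `|n|%N r * casn n t.
Proof.
move=> r0; rewrite /bcas /besselP hcas_circle -sqr_enorm enorm_circle //.
by rewrite /besselr /casn; ring.
Qed.

Lemma bcas_grad_circle k n r t : 0 <= r ->
  exists gx gy : R, [/\ has_grad (bcas k n) (circle r t) gx gy,
  (circle r t).1 * gx + (circle r t).2 * gy = besselr_radial k `|n|%N r * casn n t &
  (circle r t).1 * gy - (circle r t).2 * gx = n%:~R * besselr k `|n|%N r * casn (- n) t].
Proof.
move=> r0; have [gx [gy [G h1 h2]]] := bcas_grad k n (circle r t).
exists gx, gy; split => //.
- rewrite h1 /besselP -sqr_enorm enorm_circle // hcas_circle /besselr_radial /casn; ring.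
- rewrite h2 /besselP -sqr_enorm enorm_circle // hcas_circle abszN /besselr /casn; ring.
Qed.

(** The Hartley form of [fourier_bessel] for one real component; dividing by [besselr] at [Rad]
    gives each mode amplitude [h n] on the circle |x| = Rad. *)
Definition wavesum k Rad (h : int -> R) N : R * R -> R :=
  fun x => symsum N (fun n => h n / besselr k `|n|%N Rad * bcas k n x).

Lemma wavesum_grad k Rad h N r t : 0 <= r ->
  exists gx gy : R, [/\ has_grad (wavesum k Rad h N) (circle r t) gx gy,
  (circle r t).1 * gx + (circle r t).2 * gy =
    symsum N (fun n => h n * (besselr_radial k `|n|%N r / besselr k `|n|%N Rad) * casn n t) &
  (circle r t).1 * gy - (circle r t).2 * gx =
    symsum N (fun n => h n * (n%:~R * (besselr k `|n|%N r / besselr k `|n|%N Rad)) * casn (- n) t)].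
Proof.
move=> r0; rewrite /wavesum /symsum; elim: (2 * N).+1 => [|M [gx [gy [G h1 h2]]]].
  exists 0, 0; rewrite !big_ord0 !mulr0 addr0 subr0; split => //.
  by under [X in has_grad X]funext do rewrite big_ord0; exact: has_grad_cst.
set n := M%:Z - N%:Z; set c := h n / besselr k `|n|%N Rad.
have [gx' [gy' [G' h1' h2']]] := bcas_grad_circle k n t r0.
exists (gx + c * gx'), (gy + c * gy'); split.
- under [X in has_grad X]funext do rewrite big_ord_recr.
  by apply: has_gradD => //; exact: has_gradZ.
- rewrite big_ord_recr /= -h1 -/n.
  rewrite [X in _ = _ + X](_ : _ = c * (besselr_radial k `|n|%N r * casn n t)).
    by rewrite -h1' /=; ring.
  by rewrite /c; ring.
- rewrite big_ord_recr /= -h2 -/n.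
  rewrite [X in _ = _ + X](_ : _ = c * (n%:~R * besselr k `|n|%N r * casn (- n) t)).
    by rewrite -h2' /=; ring.
  by rewrite /c; ring.
Qed.

Lemma harB (f g : R -> R) n : sqint f -> sqint g ->
  har (fun t => f t - g t) n = har f n - har g n.
Proof.
move=> sf sg; rewrite /har -mulrBr; congr (_ * _).
have -> : (fun t => f t - g t) = (fun t => f t + -1 * g t).
  by apply/funext => t; rewrite mulN1r.
rewrite ipDl ?ipZl ?mulN1r //; try exact: sqint_casn.
exact: sqintZ.
Qed.

Lemma symsumN (V : zmodType) N (F : int -> V) : symsum N (fun n => F (- n)) = symsum N F.
Proof.
rewrite !symsumE oppr0; congr (_ + _); apply: eq_bigr => i _.
by rewrite opprK addrC.
Qed.

(** The weight [n0] is 1 for the field and |n| + 1 for its derivatives. The pointwise convergence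
    hypothesis comes from the Lipschitz bound and the chord length, and r <= [rho1] makes the
    estimate uniform in r. *)
Lemma harsum_circle_tail rho a fx fy (n0 : nat -> R) (C : R) r rho1 N t :
  C1on (disk rho) a fx fy -> 0 < r <= rho1 -> rho1 < rho -> (0 <= C) ->
  (forall n, `|har (fun t => a (circle r t)) n| <= C * n0 `|n|%N * (r / rho) ^+ `|n|%N) ->
  (forall m, 0 <= n0 m) ->
  forall B, (forall M : nat, \sum_(N <= i < M) n0 i.+1 * (rho1 / rho) ^+ i.+1 <= B) ->
  `|a (circle r t) - harsum N (fun t => a (circle r t)) t| <= 4 * (C * B).
Proof.
move=> A /andP[r0 rr] rho1rho C0 hH n00 B hB.
have rho0 : 0 < rho by lra.
have rrho : r < rho by exact: le_lt_trans rr rho1rho.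
have [L L0 hL] := C1on_lipschitz rrho A.
apply: (@harsum_tail _ _ _ (L * (2 * r)) (fun i => C * n0 i * (rho1 / rho) ^+ i)).
- by apply: continuous_measurable_I; apply: continuous_circle_angle A; rewrite r0.
- move=> s; have := hL (circle r s) (circle r t).
  by rewrite enorm_circleB ?enorm_circle ?(ltW r0) // !mulrA => /(_ (lexx _) (lexx _)).
- move=> n; apply: le_trans (hH n) _; rewrite ler_wpM2l ?mulr_ge0 //.
  rewrite lerXn2r ?nnegrE ?divr_ge0 ?(ltW r0) ?(ltW rho0) //; first lra.
  by rewrite ler_pM2r ?invr_gt0.
- move=> M; rewrite (eq_bigr (fun i => C * (n0 i.+1 * (rho1 / rho) ^+ i.+1))) => [|i _].
    by rewrite -mulr_sumr ler_wpM2l.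
  by rewrite mulrA.
Qed.

(** Cauchy-Schwarz against the constant vector, through 2 |F| (D / w) <= F^2 + (D / w)^2 with w =
    sqrt M, the weight for which both resulting sums are at most w D / 2. *)
Lemma sum_abs_le M (D : R) (F : nat -> R) : 0 <= D ->
  \sum_(i < M) F i ^+ 2 <= D ^+ 2 -> \sum_(i < M) `|F i| <= Num.sqrt M%:R * D.
Proof.
move=> D0 h; have [M0|M0] := posnP M.
  by rewrite M0 big_ord0 mulr_ge0.
have [D0'|Dp] := eqVneq D 0.
  rewrite D0' mulr0; rewrite D0' expr0n /= in h; apply: sumr_le0 => i _.
  have : F i ^+ 2 <= 0.
    apply: le_trans h; rewrite (bigD1 i) //= lerDl; apply: sumr_ge0 => j _; exact: sqr_ge0.
  by rewrite normr_le0 -sqrf_eq0 => h'; apply/eqP/le_anti; rewrite h' sqr_ge0.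
have {Dp} Dp : 0 < D by rewrite lt_neqAle eq_sym Dp.
set w := Num.sqrt M%:R; have w0 : 0 < w by rewrite sqrtr_gt0 ltr0n.
have w2 : w ^+ 2 = M%:R by rewrite sqr_sqrtr.
apply: le_trans (_ : \sum_(i < M) (D / w / 2 + F i ^+ 2 * (w / D / 2)) <= _).
  apply: ler_sum => i _.
  have := sqr_ge0 (`|F i| - D / w); rewrite sqrrB real_normK ?num_real // => q.
  have q2 : `|F i| * (D / w) * 2 <= F i ^+ 2 + (D / w) ^+ 2 by lra.
  have p : 0 < w / D / 2 by rewrite !divr_gt0.
  have := ler_wpM2r (ltW p) q2.
  have -> : `|F i| * (D / w) * 2 * (w / D / 2) = `|F i| by field; rewrite !gt_eqF.
  move=> /le_trans; apply; rewrite mulrDl addrC lerD2r le_eqVlt; apply/orP; left; apply/eqP.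
  by field; rewrite !gt_eqF.
have sc : \sum_(i < M) (D / w / 2) = w ^+ 2 * (D / w / 2).
  by rewrite sumr_const card_ord w2 mulr_natl.
rewrite big_split /= sc -mulr_suml.
have p : 0 <= w / D / 2 by rewrite !divr_ge0 // ltW.
apply: le_trans (lerD (lexx _) (ler_wpM2r p h)) _.
by rewrite le_eqVlt; apply/orP; left; apply/eqP; field; rewrite !gt_eqF.
Qed.

(** No mode is amplified on the data circle. The 2 N + 1 <= 4 N modes give 2 sqrt N by
    Cauchy-Schwarz, and the bound on cas another factor 2. *)
Lemma noise_circle (e : R -> R) (D : R) N t : sqint e -> 0 <= D -> ip e e <= D ^+ 2 ->
  (0 < N)%N ->
  `|symsum N (fun n => har e n * casn n t)| <= 4 * Num.sqrt N%:R * D.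
Proof.
move=> se D0 eD N0.
have p1 : (2 * pi)^-1 <= 1 :> R.
  rewrite invf_le1 ?mulr_gt0 ?pi_gt0 //; have := @pi_ge2 R; lra.
have pp : 0 <= (2 * pi)^-1 :> R by rewrite invr_ge0 mulr_ge0 ?pi_ge0.
have hb : symsum N (fun n => har e n ^+ 2) <= D ^+ 2.
  apply: le_trans (har_bessel N se) _; apply: le_trans eD.
  by rewrite ler_piMl ?ip_ge0.
have := @sum_abs_le (2 * N).+1 D (fun j => har e (j%:Z - N%:Z)) D0 hb.
move=> h; rewrite /symsum; apply: le_trans (ler_norm_sum _ _ _) _.
apply: le_trans (_ : 2 * (Num.sqrt (2 * N).+1%:R * D) <= _).
  apply: le_trans (ler_wpM2l (ler0n _ 2) h); rewrite mulr_sumr; apply: ler_sum => i _.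
  by rewrite normrM mulrC; apply: ler_wpM2r => //; exact: cas_le2.
rewrite [leRHS](_ : _ = 2 * (2 * Num.sqrt N%:R * D)); last by ring.
rewrite ler_wpM2l // ler_wpM2r //.
have -> : 2 = Num.sqrt 4 :> R by rewrite (_ : 4 = 2 ^+ 2) ?sqrtr_sqr ?ger0_norm //; ring.
by rewrite -sqrtrM // ler_wsqrtr // -natrM ler_nat; lia.
Qed.

Lemma har_le_ip (e : R -> R) (D : R) n : sqint e -> 0 <= D -> ip e e <= D ^+ 2 ->
  `|har e n| <= D.
Proof.
move=> se D0 eD.
have p1 : (2 * pi)^-1 <= 1 :> R.
  rewrite invf_le1 ?mulr_gt0 ?pi_gt0 //; have := @pi_ge2 R; lra.
rewrite -(@ler_pXn2r _ 2) ?nnegrE // real_normK ?num_real //.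
by apply: le_trans (har_sqr_le n se) _; apply: le_trans eD; rewrite ler_piMl ?ip_ge0.
Qed.

Lemma noise_growth (e : R -> R) (D C s x : R) N (w : int -> R) (c : int -> R) :
  sqint e -> 0 <= D -> ip e e <= D ^+ 2 -> 1 < s -> 0 <= C -> 0 <= x ->
  (forall n, `|c n| <= 2) ->
  (forall n, (`|n| <= N)%N -> `|w n| <= C * x * s ^+ `|n|%N) ->
  `|symsum N (fun n => har e n * w n * c n)| <= 4 * C * (s / (s - 1)) * (x * s ^+ N * D).
Proof.
move=> se D0 eD s1 C0 x0 c2 hw.
(* The bound on [w] is known only for |n| <= N; cutting off outside this range changes no term of
   the sum and yields a bound for all n. *)
pose F n := if (`|n| <= N)%N then har e n * w n * c n else 0.
have -> : symsum N (fun n => har e n * w n * c n) = symsum N F.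
  by apply: eq_bigr => i _; rewrite /F; case: ifP => //; have := ltn_ord i; lia.
apply: le_trans (@symsum_norm_le _ N F (fun i => 2 * C * x * D * s ^+ i) _) _.
  move=> n; rewrite /F; case: ifP => hn; last first.
    by rewrite normr0 !mulr_ge0 // exprn_ge0 //; lra.
  rewrite (normrM (har e n * w n)) (normrM (har e n)).
  apply: le_trans (_ : D * (C * x * s ^+ `|n|%N) * 2 <= _).
    apply: ler_pM; rewrite ?mulr_ge0 //.
    by apply: ler_pM; rewrite ?hw ?(har_le_ip _ se D0 eD).
  by rewrite le_eqVlt; apply/orP; left; apply/eqP; ring.
rewrite -mulr_sumr.
rewrite [leRHS](_ : _ = 2 * (2 * C * x * D * (s / (s - 1) * s ^+ N))); last by ring.
by rewrite ler_wpM2l // ler_wpM2l ?mulr_ge0 // geometric_growth.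
Qed.

End PointwiseErrors.

(** * Pointwise error of the wave sum for a real field *)

Section RealError.
Context {R : realType}.
Notation T := (measurableTypeR R).
Notation I := (`[0, 2 * pi]%classic : set T).
Implicit Types (r s t c k rho Rad q D : R) (n : int) (m N : nat).

Lemma natr_le_double m N : (0 < N)%N -> (m <= N)%N ->
  m.+1%:R <= 2 * N%:R :> R /\ m%:R <= 2 * N%:R :> R.
Proof. by move=> N0 mN; rewrite -natrM !ler_nat; lia. Qed.

(** For an error e in the gradient, r^2 (v . e) = (v . x) (x . e) + (x ^ v) (x ^ e), where ^ is the
    planar cross product; so bounds on the radial and angular errors control every direction. *)
Lemma gradient_from_polar (x v : R * R) r (a1 a2 b1 b2 B : R) :
  0 < r -> enorm x = r -> enorm v <= 1 ->
  `|x.1 * a1 + x.2 * a2 - (x.1 * b1 + x.2 * b2)| <= B ->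
  `|x.1 * a2 - x.2 * a1 - (x.1 * b2 - x.2 * b1)| <= B ->
  `|v.1 * a1 + v.2 * a2 - (v.1 * b1 + v.2 * b2)| <= 4 / r * B.
Proof.
move=> r0 ex v1; set eR := x.1 * a1 + _ - _; set eT := x.1 * a2 - _ - _ => bR bT.
have ex2 : x.1 ^+ 2 + x.2 ^+ 2 = r ^+ 2 by rewrite -sqr_enorm ex.
have x1 : `|x.1| <= r by rewrite -ex ler_fst_enorm.
have x2 : `|x.2| <= r by rewrite -ex ler_snd_enorm.
have vv1 := le_trans (ler_fst_enorm v) v1; have vv2 := le_trans (ler_snd_enorm v) v1.
have -> : v.1 * a1 + v.2 * a2 - (v.1 * b1 + v.2 * b2) =
   ((v.1 * x.1 + v.2 * x.2) * eR + (v.2 * x.1 - v.1 * x.2) * eT) / r ^+ 2.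
  rewrite -ex2 /eR /eT; field.
  by rewrite ex2 expf_neq0 // gt_eqF.
have y1 : `|v.1 * x.1 + v.2 * x.2| <= 2 * r.
  apply: le_trans (ler_normD _ _) _; rewrite (_ : 2 * r = 1 * r + 1 * r); last by ring.
  by rewrite !normrM; apply: lerD; apply: ler_pM.
have y2 : `|v.2 * x.1 - v.1 * x.2| <= 2 * r.
  apply: le_trans (ler_normB _ _) _; rewrite (_ : 2 * r = 1 * r + 1 * r); last by ring.
  by rewrite !normrM; apply: lerD; apply: ler_pM.
rewrite normrM normfV (ger0_norm (sqr_ge0 r)) ler_pdivrMr ?exprn_gt0 //.
have -> : 4 / r * B * r ^+ 2 = 2 * r * B + 2 * r * B by field; rewrite gt_eqF.
by apply: le_trans (ler_normD _ _) _; rewrite !normrM; apply: lerD; apply: ler_pM.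
Qed.

(** Splitting the data into exact trace plus noise splits the wave sum. By proportionality the exact
    part is, on each circle, the partial Hartley sum of the field there, so its error is a series
    tail; the noise part is estimated mode by mode. *)
Lemma wavesum_error k rho Rad rho1 a ax ay r0 M :
  0 < Rad -> Rad < rho1 < rho -> helmholtz_in k rho a ax ay ->
  (forall m, besselG m (k ^+ 2 * Rad ^+ 2) != 0) -> r0 < rho ->
  (forall r n, r0 < r < rho -> `|har (fun t => a (circle r t)) n| <= M) ->
  exists2 K, 0 <= K & forall N d D, (0 < N)%N -> sqint d -> 0 <= D ->
    ip (fun t => d t - a (circle Rad t)) (fun t => d t - a (circle Rad t)) <= D ^+ 2 ->
    let V := wavesum k Rad (har d) N in
    [/\ forall t, `|a (circle Rad t) - V (circle Rad t)| <=
          K * ((Rad / rho) ^+ N + Num.sqrt N%:R * D),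
        forall r t, Rad <= r <= rho1 -> `|a (circle r t) - V (circle r t)| <=
          K * ((rho1 / rho) ^+ N + (rho1 / Rad) ^+ N * D) &
        forall r t v, Rad <= r <= rho1 -> enorm v <= 1 ->
          exists2 l, is_derive (circle r t) v V l &
          `|v.1 * ax (circle r t) + v.2 * ay (circle r t) - l| <=
          K * (N%:R * (rho1 / rho) ^+ N + N%:R * (rho1 / Rad) ^+ N * D)].
Proof.
move=> R0 /andP[R1 r1rho] Hh nz r0rho hM.
have Rrho : 0 < Rad < rho by rewrite R0 (lt_trans R1).
have rho0 : 0 < rho by lra.
have [C C0 hC] := har_decay Rrho Hh nz r0rho hM.
have [Q Q0 hQ] := besselr_ratio rho R0 nz.
have [axx [axy [ayx [ayy [A X Y lap]]]]] := Hh.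
have XR := C1on_radial X Y; have XT := C1on_angular X Y.
have q01 : 0 < rho1 / rho < 1.
  by rewrite divr_gt0 ?ltr_pdivrMr ?mul1r //; lra.
have q01' : 0 < Rad / rho < 1.
  by rewrite divr_gt0 ?ltr_pdivrMr ?mul1r //; lra.
have s1' : 1 < rho1 / Rad by rewrite ltr_pdivlMr // mul1r.
have [G G0 hG] := arith_geometric_tail q01.
pose q := rho1 / rho; pose s := rho1 / Rad.
have s1 : 1 < s := s1'.
pose g (x : R) := (1 - x)^-1.
have g0 (x : R) : 0 < x < 1 -> 0 <= g x by move=> ?; rewrite invr_ge0; lra.
have jR m : besselr k m Rad != 0 by rewrite mulf_neq0 // expf_neq0 // gt_eqF.
(* Used with r2 = [Rad] on the data circle, for the better rate Rad / rho, and with r2 = [rho1] on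
   the annulus. *)
have tail0 (r2 : R) r t N : Rad <= r <= r2 -> 0 < r2 / rho < 1 -> r2 < rho ->
    `|a (circle r t) - harsum N (fun t => a (circle r t)) t| <=
    4 * (C * g (r2 / rho)) * (r2 / rho) ^+ N.
  move=> /andP[ra rb] q2 r2rho.
  rewrite [leRHS](_ : _ = 4 * (C * ((r2 / rho) ^+ N / (1 - r2 / rho)))); last by rewrite /g; ring.
  apply: (@harsum_circle_tail _ rho a ax ay (fun=> 1) C r r2) => //.
  - by rewrite (lt_le_trans R0 ra).
  - move=> n; rewrite mulr1; apply: (hC r n _).1; rewrite ra /=; lra.
  - move=> M'; under eq_bigr do rewrite mul1r.
    by apply: geometric_tail; case/andP: q2 => /ltW -> ->.
have tailR r t N : Rad <= r <= rho1 -> (0 < N)%N ->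
    `|radial ax ay (circle r t) - harsum N (fun t => radial ax ay (circle r t)) t| <=
    4 * (C * G) * (N%:R * q ^+ N).
  move=> /andP[ra rb] N0.
  rewrite [leRHS](_ : _ = 4 * (C * (G * N%:R * q ^+ N))); last by ring.
  apply: (@harsum_circle_tail _ rho _ _ _ (fun i => i.+1%:R) C r rho1 N t XR) => //.
  - by rewrite (lt_le_trans R0 ra).
  - by move=> n; apply: (hC r n _).2; rewrite ra /=; lra.
  - by move=> M'; exact: hG.
have tailT r t N : Rad <= r <= rho1 -> (0 < N)%N ->
    `|angularD ax ay (circle r t) - harsum N (fun t => angularD ax ay (circle r t)) t| <=
    4 * (C * G) * (N%:R * q ^+ N).
  move=> /andP[ra rb] N0.
  have r0' : 0 < r by rewrite (lt_le_trans R0 ra).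
  have rr : 0 < r < rho by rewrite r0' /=; lra.
  rewrite [leRHS](_ : _ = 4 * (C * (G * N%:R * q ^+ N))); last by ring.
  apply: (@harsum_circle_tail _ rho _ _ _ (fun i => i.+1%:R) C r rho1 N t XT) => //.
  - by rewrite r0'.
  - move=> n; rewrite (har_angular n rr A) normrM normrN.
    have [|h _] := hC r (- n) _; first by rewrite ra /=; lra.
    rewrite abszN in h; rewrite [leRHS](_ : _ = `|n|%N.+1%:R * (C * (r / rho) ^+ `|n|%N)); last by ring.
    apply: ler_pM => //; rewrite -intr_norm -[leLHS]/(`|n|%N%:R) ler_nat //.
  - by move=> M'; exact: hG.
(* The factor 4 / Rad comes from recovering the gradient, with r >= [Rad]; 2 * Q appears because |n|
   and |n| + 1 are at most 2 N for |n| <= N. *)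
pose K0 := 4 / Rad * (4 * (C * G) + 4 * (2 * Q) * (s / (s - 1))).
have Z1 : 0 <= C * g (Rad / rho) by rewrite mulr_ge0 // g0.
have Z2 : 0 <= C * g q by rewrite mulr_ge0 // g0.
have Z3 : 0 <= Q * (s / (s - 1)).
  by rewrite mulr_ge0 // divr_ge0; rewrite /s; lra.
have CG := mulr_ge0 C0 G0.
have Z4 : 0 <= K0.
  apply: mulr_ge0; first by rewrite divr_ge0 // ltW.
  by move: Z3 CG; clear; lra.
have [K [K00 k1 k2 k3 [k4 k5]]] : exists K, [/\ 0 <= K, 4 * (C * g (Rad / rho)) <= K,
    4 * (C * g q) <= K, 4 <= K & 4 * Q * (s / (s - 1)) <= K /\ K0 <= K].
  exists (4 * (C * g (Rad / rho)) + 4 * (C * g q) + 4 + 4 * Q * (s / (s - 1)) + K0).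
  by move: Z1 Z2 Z3 Z4; clear; move: (g _) (g _) K0 => ? ? ? *; do !split; lra.
exists K => //.
move=> N d D N0 sd D0 eD V.
pose e t := d t - a (circle Rad t).
have sa : sqint (fun t => a (circle Rad t)).
  by apply: sqint_continuous; exact: continuous_circle_angle Rrho A.
have se : sqint e by exact: sqintB.
have hd n : har d n = har e n + har (fun t => a (circle Rad t)) n.
  by rewrite /e harB // subrK.
have prop r n (Rr : Rad <= r < rho) := har_proportional n Hh R0 Rr.
(* Noise plus the Hartley partial sum of [a] on the circle of radius r itself. *)
have VE r t : Rad <= r < rho -> V (circle r t) =
    symsum N (fun n => har e n * (besselr k `|n|%N r / besselr k `|n|%N Rad) * casn n t)
    + harsum N (fun t => a (circle r t)) t.
  move=> Rr; rewrite /V /wavesum /harsum -symsumD; apply: eq_symsum => n.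
  have rp : 0 <= r by case/andP: Rr => h _; apply: le_trans h; exact: ltW.
  rewrite bcas_circle // hd.
  have -> : har (fun t => a (circle r t)) n =
    har (fun t => a (circle Rad t)) n * besselr k `|n|%N r / besselr k `|n|%N Rad.
    by rewrite -(prop r n Rr).1 mulfK.
  by ring.
have c2 n t : `|casn n t| <= 2 :> R by exact: cas_le2.
have SN0 : 0 <= Num.sqrt N%:R * D by rewrite mulr_ge0 ?sqrtr_ge0.
have qN : 0 <= q ^+ N by rewrite exprn_ge0 //; case/andP: q01 => /ltW.
have RN : 0 <= (Rad / rho) ^+ N by rewrite exprn_ge0 //; case/andP: q01' => /ltW.
have sN : 0 <= s ^+ N * D by rewrite mulr_ge0 // exprn_ge0 // (le_trans ler01) // ltW.
have ratio r n : Rad <= r <= rho1 ->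
    `|besselr k `|n|%N r / besselr k `|n|%N Rad| <= Q * s ^+ `|n|%N /\
    `|besselr_radial k `|n|%N r / besselr k `|n|%N Rad| <= Q * `|n|%N.+1%:R * s ^+ `|n|%N.
  move=> /andP[ra rb]; have rp : 0 <= r by apply: le_trans ra; exact: ltW.
  have [|h1 h2] := hQ r `|n|%N; first by rewrite rp (le_trans rb) // ltW.
  have h3 : (r / Rad) ^+ `|n|%N <= s ^+ `|n|%N.
    by rewrite lerXn2r ?nnegrE ?divr_ge0 ?ler_pM2r ?invr_gt0 ?(ltW R0) ?(le_trans rp rb).
  split; [apply: le_trans h1 _|apply: le_trans h2 _]; rewrite ler_wpM2l //.
  by rewrite mulr_ge0.
split.
- move=> t; have Rr : Rad <= Rad < rho by rewrite lexx; case/andP: Rrho.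
  rewrite VE // opprD addrCA addrC; apply: le_trans (ler_normB _ _) _.
  have h := @tail0 Rad Rad t N; rewrite !lexx in h.
  have {}h := h isT q01' (proj2 (andP Rrho)).
  have h2 := noise_circle t se D0 eD N0.
  rewrite (_ : symsum N _ = symsum N (fun n => har e n * casn n t)); last first.
    by apply: eq_symsum => n; rewrite divff // mulr1.
  apply: le_trans (lerD h h2) _; rewrite mulrDr; apply: lerD.
    exact: ler_wpM2r.
  by rewrite -mulrA ler_wpM2r.
- move=> r t Rr; have Rr' : Rad <= r < rho by case/andP: Rr => -> rb; rewrite (le_lt_trans rb).
  rewrite VE // opprD addrCA addrC; apply: le_trans (ler_normB _ _) _.
  have h := tail0 rho1 r t N Rr q01 r1rho.
  have hw n : (`|n| <= N)%N -> `|besselr k `|n|%N r / besselr k `|n|%N Rad| <= Q * 1 * s ^+ `|n|%N.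
    by move=> _; rewrite mulr1; exact: (ratio r n Rr).1.
  have := noise_growth se D0 eD s1 Q0 ler01 (c2^~ t) hw.
  rewrite mul1r -/s => h2; rewrite -/q in h.
  rewrite -/q -/s; apply: le_trans (lerD h h2) _; by rewrite mulrDr; apply: lerD; apply: ler_wpM2r.
- move=> r t v /[dup] Rr /andP[ra rb] v1.
  have rp : 0 < r by exact: lt_le_trans ra.
  have Rr' : Rad <= r < rho by rewrite ra (le_lt_trans rb).
  have rr : 0 < r < rho by rewrite rp (le_lt_trans rb).
  have [gx [gy [GV h1 h2]]] := wavesum_grad k Rad (har d) N t (ltW rp).
  exists (v.1 * gx + v.2 * gy); first exact: has_grad_dir.
  set x := circle r t in GV h1 h2 *.
  pose eR := radial ax ay x - (x.1 * gx + x.2 * gy).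
  pose eT := angularD ax ay x - (x.1 * gy - x.2 * gx).
  have Nn n (nN : (`|n| <= N)%N) := natr_le_double N0 nN.
  have Q20 : 0 <= 2 * Q by rewrite mulr_ge0.
  pose B := 4 * (C * G) * (N%:R * q ^+ N) + 4 * (2 * Q) * (s / (s - 1)) * (N%:R * s ^+ N * D).
  have bR : `|eR| <= B.
    rewrite /eR h1.
    have -> : symsum N (fun n => har d n * (besselr_radial k `|n|%N r / besselr k `|n|%N Rad) * casn n t)
      = symsum N (fun n => har e n * (besselr_radial k `|n|%N r / besselr k `|n|%N Rad) * casn n t)
        + harsum N (fun t => radial ax ay (circle r t)) t.
      rewrite /harsum -symsumD; apply: eq_symsum => n; rewrite hd.
      have -> : har (fun t => radial ax ay (circle r t)) n =
        har (fun t => a (circle Rad t)) n * besselr_radial k `|n|%N r / besselr k `|n|%N Rad.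
        by rewrite -(prop r n Rr').2 mulfK.
      by ring.
    rewrite opprD addrCA addrC; apply: le_trans (ler_normB _ _) _.
    apply: lerD; first exact: tailR.
    apply: noise_growth => // n nN; apply: le_trans (ratio r n Rr).2 _.
    rewrite ler_wpM2r ?exprn_ge0 ?(le_trans ler01) ?(ltW s1) //.
    by rewrite [2 * Q]mulrC -mulrA ler_wpM2l // (Nn n nN).1.
  have bT : `|eT| <= B.
    rewrite /eT h2.
    have -> : symsum N (fun n => har d n * (n%:~R * (besselr k `|n|%N r / besselr k `|n|%N Rad)) * casn (- n) t)
      = symsum N (fun n => har e n * (n%:~R * (besselr k `|n|%N r / besselr k `|n|%N Rad)) * casn (- n) t)
        + harsum N (fun t => angularD ax ay (circle r t)) t.
      (* The angular derivative carries cas(- n t), so the partial sum is reindexed by n -> - n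
         before comparing terms. *)
      rewrite /harsum -[X in _ = _ + X]symsumN -symsumD; apply: eq_symsum => n; rewrite hd.
      rewrite (har_angular (- n) rr A) rmorphN !opprK.
      have -> : har (fun t => a (circle r t)) n =
        har (fun t => a (circle Rad t)) n * besselr k `|n|%N r / besselr k `|n|%N Rad.
        by rewrite -(prop r n Rr').1 mulfK.
      by ring.
    rewrite opprD addrCA addrC; apply: le_trans (ler_normB _ _) _.
    apply: lerD; first exact: tailT.
    apply: (noise_growth se D0 eD s1 Q20 (ler0n _ N) (fun n => c2 (- n) t)) => n nN.
    rewrite normrM -intr_norm -[`|n|%:~R]/(`|n|%N%:R).
    rewrite [leRHS](_ : _ = (2 * N%:R) * (Q * s ^+ `|n|%N)); last by ring.
    by apply: ler_pM => //; [exact: (Nn n nN).2|exact: (ratio r n Rr).1].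
  have ex : enorm x = r by rewrite enorm_circle // ltW.
  apply: le_trans (gradient_from_polar rp ex v1 bR bT) _.
  have B0 : 0 <= B by apply: le_trans bR.
  apply: le_trans (_ : 4 / Rad * B <= _).
    by rewrite ler_wpM2r // ler_wpM2l // lef_pV2 ?posrE.
  apply: le_trans (_ : K0 * (N%:R * q ^+ N + N%:R * s ^+ N * D) <= _); last first.
    by rewrite ler_wpM2r // addr_ge0 // -?mulrA mulr_ge0.
  rewrite /K0 -[leRHS]mulrA ler_wpM2l ?divr_ge0 ?(ltW R0) // /B.
  have w1 : 0 <= N%:R * q ^+ N by rewrite mulr_ge0.
  have w2 : 0 <= N%:R * s ^+ N * D by rewrite -mulrA mulr_ge0.
  have := mulr_ge0 CG w2; have := mulr_ge0 Z3 w1.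
  by clear; move: (N%:R * q ^+ N) (N%:R * s ^+ N * D) => w w'; lra.
Qed.

End RealError.

(** * Curves, traces and complex fields *)

Section CavityGeometry.
Context {R : realType}.
Implicit Types (x y : R * R) (D : set (R * R)) (r Rad rho : R).

Lemma bdry_closure D x : bdry D x -> closure D x.
Proof. by case. Qed.

Lemma bdry_open_notin D x : open D -> bdry D x -> ~ D x.
Proof. by move=> oD [_]; rewrite ((interior_id _).1 oD). Qed.

(** The radial projection of [x] onto the outer circle is at distance [rho] - |x|, which bounds the
    infimum from above. *)
Lemma set_dist_bdry_disk rho D x : 0 < rho -> closure D `<=` disk rho ->
  bdry D x -> x != 0 -> enorm x <= rho - set_dist (bdry (disk rho)) (bdry D).
Proof.
move=> rho0 Drho Dx x0.
have xr : enorm x < rho by exact: Drho (bdry_closure Dx).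
have ex : 0 < enorm x.
  rewrite lt_neqAle enorm_ge0 andbT eq_sym; apply: contra x0 => /eqP e.
  have := ler_fst_enorm x; have := ler_snd_enorm x; rewrite e !normr_le0 => /eqP h2 /eqP h1.
  by apply/eqP; apply: injective_projections.
rewrite lerBrDr -lerBrDl; apply: ge_inf.
  by exists 0 => _ [y _ [z _ <-]]; exact: enorm_ge0.
exists ((rho / enorm x) *: x).
  rewrite bdry_diskE //= enorm_scale ger0_norm ?divr_ge0 ?(ltW rho0) ?enorm_ge0 //.
  by rewrite divfK // gt_eqF.
exists x => //.
have -> : (rho / enorm x) *: x - x = (rho / enorm x - 1) *: x.
  by rewrite scalerBl scale1r.
rewrite enorm_scale ger0_norm; last first.
  by rewrite subr_ge0 ler_pdivlMr // mul1r ltW.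
by rewrite mulrBl mul1r divfK // gt_eqF.
Qed.

(** A point of [closure D] of largest norm lies strictly inside the disk; by the triangle inequality
    its gap to [rho] is a lower bound for all the distances. *)
Lemma set_dist_gt0 rho D : 0 < rho -> closure D `<=` disk rho -> bdry D !=set0 ->
  0 < set_dist (bdry (disk rho)) (bdry D).
Proof.
move=> rho0 Drho [x0 Dx0].
have cD : compact (closure D).
  apply: (@subclosed_compact _ _ [set x : R * R | enorm x <= rho]).
  - exact: closed_closure.
  - exact: compact_cdisk.
  - by move=> x /Drho /ltW.
have ce : {within closure D, continuous (@enorm R)}.
  exact/continuous_subspaceT/enorm_continuous.
have [c Dc hc] := compact_EVT_max (ex_intro _ x0 (bdry_closure Dx0)) cD ce.
have cr : enorm c < rho by apply: Drho; exact/set_mem.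
apply: lt_le_trans (_ : rho - enorm c <= _); first by rewrite subr_gt0.
apply: lb_le_inf.
  exists (enorm ((rho, 0) - x0)); exists (rho, 0); last by exists x0.
  by rewrite bdry_diskE //= /enorm /= expr0n addr0 sqrtr_sqr gtr0_norm.
move=> _ [y yr [z Dz <-]]; rewrite bdry_diskE //= in yr.
have := hc z (mem_set (bdry_closure Dz)).
have := enormD (y - z) z; rewrite subrK yr; lra.
Qed.

End CavityGeometry.

(** * L^2 norms along curves *)

Section CurveNorms.
Context {R : realType}.
Notation mu := (@lebesgue_measure R).
Notation T := (measurableTypeR R).
Notation I := (`[0, 2 * pi]%classic : set T).

(** The integral of a nonnegative function is a supremum over simple functions below it, hence
    monotone in full generality. Measurability of integrands involving [nu] thus need not be
    established. *)
Lemma ge0_le_integral_any d (U : measurableType d) (m : {measure set U -> \bar R})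
    (A : set U) (f h : U -> \bar R) :
  (forall x, A x -> 0 <= f x)%E -> (forall x, A x -> f x <= h x)%E ->
  (\int[m]_(x in A) f x <= \int[m]_(x in A) h x)%E.
Proof.
move=> f0 fh; have h0 x : A x -> (0 <= h x)%E.
  by move=> Ax; exact: le_trans (f0 _ Ax) (fh _ Ax).
rewrite !(integral_mkcond A) !ge0_integralTE; [|exact: erestrict_ge0..].
apply: le_ereal_sup => _ [s sf <-]; exists s => // x.
by apply: le_trans (sf x) _; exact: lee_restrict.
Qed.

Lemma cabs_sqr (z : R[i]) : cabs z ^+ 2 = complex.Re z ^+ 2 + complex.Im z ^+ 2.
Proof. by case: z => a b /=; rewrite sqr_sqrtr // addr_ge0 ?sqr_ge0. Qed.

Lemma cabs_ge0 (z : R[i]) : 0 <= cabs z.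
Proof. by case: z => a b; exact: sqrtr_ge0. Qed.

Lemma cabs_le (z : R[i]) : cabs z <= `|complex.Re z| + `|complex.Im z|.
Proof. case: z => a b; exact: (@enorm_le_fst_snd R (a, b)). Qed.

Lemma curve_L2norm_le (g : R -> R * R) (f : R * R -> R[i]) (B S : R) :
  0 <= B -> 0 <= S ->
  (forall t, I t -> cabs (f (g t)) <= B) -> (forall t, I t -> speed g t <= S) ->
  (curve_L2norm g f <= (B * Num.sqrt (2 * pi * S))%:E)%E.
Proof.
move=> B0 S0 hB hS; rewrite /curve_L2norm.
have c0 : 0 <= B ^+ 2 * S * (2 * pi) by rewrite !mulr_ge0 ?pi_ge0 ?sqr_ge0.
have -> : (B * Num.sqrt (2 * pi * S))%:E = ((B ^+ 2 * S * (2 * pi))%:E `^ 2^-1)%E.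
  rewrite poweR_EFin powR12_sqrt //; congr EFin.
  have -> : B ^+ 2 * S * (2 * pi) = B ^+ 2 * (2 * pi * S) by ring.
  by rewrite [in RHS]sqrtrM ?sqr_ge0 // sqrtr_sqr ger0_norm.
apply: gt0_ler_poweR.
- by rewrite invr_ge0.
- rewrite in_itv /= leey andbT; apply: integral_ge0 => t _; rewrite lee_fin mulr_ge0 ?sqr_ge0 //.
  exact: enorm_ge0.
- by rewrite in_itv /= leey andbT lee_fin.
have h1 : (\int[mu]_(t in I) (cabs (f (g t)) ^+ 2 * speed g t)%:E <=
    \int[mu]_(t in I) (B ^+ 2 * S)%:E)%E.
  apply: ge0_le_integral_any => t It; rewrite lee_fin.
    by rewrite mulr_ge0 ?sqr_ge0 // enorm_ge0.
  apply: ler_pM; rewrite ?sqr_ge0 ?enorm_ge0 ?hS //.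
  by rewrite lerXn2r ?nnegrE ?cabs_ge0 ?hB.
apply: le_trans h1 _; rewrite integral_cst; last exact: measurable_I.
by rewrite [X in (_ * X)%E](_ : _ = (2 * pi)%:E) //; exact: mu_I.
Qed.

Lemma speed_circle r t : 0 <= r -> speed (@circle R r) t = r.
Proof.
move=> r0; rewrite /speed /velocity /circle /=.
have -> : (fun s => r * cos s)^`()%classic t = - r * sin t.
  have d : is_derive t (1 : R) (fun s => r * cos s) (- r * sin t).
    by apply: is_derive_eq; rewrite /GRing.scale /=; ring.
  by rewrite derive1E; have [_ ->] := d.
have -> : (fun s => r * sin s)^`()%classic t = r * cos t.
  have d : is_derive t (1 : R) (fun s => r * sin s) (r * cos t).
    by apply: is_derive_eq; rewrite /GRing.scale /=; ring.
  by rewrite derive1E; have [_ ->] := d.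
have := @enorm_circle R r (t + pi / 2) r0.
rewrite /circle /enorm /= cosDpihalf sinDpihalf => h; rewrite -[RHS]h.
by congr Num.sqrt; ring.
Qed.

Lemma ip_le_cabs (f : R -> R[i]) (B : R) :
  measurable_fun I (re_fun f : T -> R) -> measurable_fun I (im_fun f : T -> R) ->
  (\int[mu]_(t in I) (cabs (f t) ^+ 2)%:E <= B%:E)%E ->
  [/\ sqint (re_fun f), sqint (im_fun f), ip (re_fun f) (re_fun f) <= B &
      ip (im_fun f) (im_fun f) <= B].
Proof.
move=> mr mi hB.
have key (h : R -> R) : measurable_fun I (h : T -> R) ->
    (forall t, h t ^+ 2 <= cabs (f t) ^+ 2) -> sqint h /\ ip h h <= B.
  move=> mh hf.
  have h2 : (\int[mu]_(t in I) (h t ^+ 2)%:E <= B%:E)%E.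
    apply: le_trans hB; apply: ge0_le_integral_any => t _; rewrite lee_fin //.
    exact: sqr_ge0.
  have sh : sqint h.
    split => //; apply/integrableP; split.
      by apply/measurable_EFinP; exact: measurable_funX.
    apply: le_lt_trans (ltry B); apply: le_trans h2; apply: ge0_le_integral_any => t _ //.
    by rewrite /= ger0_norm ?sqr_ge0.
  split => //; rewrite /ip -lee_fin /Rintegral fineK; last first.
    by apply: integrable_fin_num; [exact: measurable_I|exact: (integrable_mul sh sh)].
  by apply: le_trans h2; apply: ge0_le_integral_any => t _; rewrite lee_fin -expr2 ?sqr_ge0.
have [|s1 i1] := key _ mr.
  by move=> t; rewrite cabs_sqr lerDl sqr_ge0.
have [|s2 i2] := key _ mi.
  by move=> t; rewrite cabs_sqr lerDr sqr_ge0.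
by split.
Qed.

Lemma curve_L2norm_circle r (f : R * R -> R[i]) (B : R) : 0 < r -> 0 <= B ->
  measurable_fun I (re_fun (f \o circle r) : T -> R) ->
  measurable_fun I (im_fun (f \o circle r) : T -> R) ->
  (curve_L2norm (circle r) f <= B%:E)%E ->
  (\int[mu]_(t in I) (cabs (f (circle r t)) ^+ 2)%:E <= (B ^+ 2 / r)%:E)%E.
Proof.
move=> r0 B0 mr mi; rewrite /curve_L2norm; set J := (\int[_]_(_ in _) _)%E.
have J0 : (0 <= J)%E.
  by apply: integral_ge0 => t _; rewrite lee_fin mulr_ge0 ?sqr_ge0 // enorm_ge0.
move=> h; have h2 : (J <= (B ^+ 2)%:E)%E.
  have := @gt0_ler_poweR R 2 (ler0n _ 2) (J `^ 2^-1)%E B%:E.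
  rewrite !in_itv /= !leey !andbT lee_fin poweR_ge0 => /(_ isT B0 h).
  by rewrite -poweRrM mulVf // poweRe1 // powR_mulrn.
have EJ : J = (r%:E * \int[mu]_(t in I) (cabs (f (circle r t)) ^+ 2)%:E)%E.
  rewrite -ge0_integralZl.
  - by apply: eq_integral => t _; rewrite speed_circle ?ltW // -EFinM mulrC.
  - exact: measurable_I.
  - apply/measurable_EFinP.
    rewrite (_ : (fun t => _) = (fun t => re_fun (f \o circle r) t ^+ 2 + im_fun (f \o circle r) t ^+ 2)).
      by apply: measurable_funD; apply: measurable_funX.
    by apply/funext => t; rewrite cabs_sqr.
  - by move=> t _; rewrite lee_fin sqr_ge0.
  - by rewrite lee_fin ltW.
by rewrite -(@lee_pmul2l _ r%:E) ?lte_fin // -EJ -EFinM mulrC divfK ?gt_eqF.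
Qed.

End CurveNorms.

(** * Complex fields through their real and imaginary parts *)

Section ComplexFields.
Context {R : realType}.
Notation mu := (@lebesgue_measure R).
Notation T := (measurableTypeR R).
Notation I := (`[0, 2 * pi]%classic : set T).
Implicit Types (k r s t rho Rad : R) (n : int) (N : nat).

Lemma ip_add_le (f g : R -> R) : sqint f -> sqint g ->
  ip (fun t => f t + g t) (fun t => f t + g t) <= 2 * ip f f + 2 * ip g g.
Proof.
move=> sf sg.
have E c : ip (fun t => f t + c * g t) (fun t => f t + c * g t) =
    ip f f + 2 * c * ip f g + c ^+ 2 * ip g g.
  have sc := sqintZ c sg; have sfc := sqintD sf sc.
  rewrite ipDl // ipZl // [ip f (fun _ => _)]ipC [ip g (fun _ => _)]ipC.
  by rewrite !ipDl // !ipZl // [ip g f]ipC; ring.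
have e1 : (fun t => f t + g t) = (fun t => f t + 1 * g t).
  by apply/funext => t; rewrite mul1r.
have := ip_ge0 (fun t => f t + -1 * g t); rewrite e1 !E; lra.
Qed.

(** Close to [rho] the field on the circle is within L^2 distance 1 of its trace, and a coefficient
    is controlled by the L^2 norm; the bound is therefore uniform in r and n. *)
Lemma trace_har_bound rho (u : R * R -> R[i]) : 0 < rho ->
  (forall r, 0 < r < rho -> continuous (fun t => re_fun u (circle r t)) /\
     continuous (fun t => im_fun u (circle r t))) ->
  has_L2_trace rho u -> exists r0 M, r0 < rho /\ forall r n, r0 < r < rho ->
    `|har (fun t => re_fun u (circle r t)) n| <= M /\
    `|har (fun t => im_fun u (circle r t)) n| <= M.
Proof.
move=> rho0 cu [w [[mr mi wfin] cvg0]].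
have w0 : (0 <= curve_L2norm (circle rho) w)%E by exact: poweR_ge0.
have wf : curve_L2norm (circle rho) w \is a fin_num by rewrite ge0_fin_numE.
pose B := fine (curve_L2norm (circle rho) w).
have B0 : 0 <= B by rewrite fine_ge0.
have hB : (curve_L2norm (circle rho) w <= B%:E)%E by rewrite /B fineK.
have [sw1 sw2 iw1 iw2] := ip_le_cabs (f := w \o circle rho) mr mi
  (curve_L2norm_circle rho0 B0 mr mi hB).
have near1 : \forall r \near rho^'-,
   (\int[mu]_(t in I) (cabs (u (circle r t) - w (circle rho t)) ^+ 2)%:E <= 1%:E)%E.
  have [fn fc] := (fine_cvgP _ _).1 cvg0.
  have h : \forall r \near rho^'-, fine (\int[mu]_(t in I)
      (cabs (u (circle r t) - w (circle rho t)) ^+ 2)%:E) < 1.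
    exact: (cvgr_lt _ fc _ ltr01).
  near=> r; rewrite -[leLHS]fineK; last by near: r; exact: fn.
  by rewrite lee_fin ltW //; near: r; exact: h.
have [e /= e0 he] := (nbhs_ballP _ _).1 near1.
(* The squared coefficient is at most 2 * 1 + 2 * (B^2 / rho), and x^2 <= y implies |x| <= 1 + y. *)
pose M := 1 + (2 + 2 * (B ^+ 2 / rho)).
exists (Num.max 0 (rho - e)), M; split; first by rewrite gt_max rho0 ltrBlDr ltrDl.
move=> r n /andP[]; rewrite gt_max => /andP[r0 re] rrho.
have hI : (\int[mu]_(t in I) (cabs (u (circle r t) - w (circle rho t)) ^+ 2)%:E <= 1%:E)%E.
  by apply: he => //; rewrite /ball /= gtr0_norm ?subr_gt0 //; lra.
have [cr ci] : continuous (fun t => re_fun u (circle r t)) /\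
     continuous (fun t => im_fun u (circle r t)) by apply: cu; rewrite r0.
pose f t := u (circle r t) - w (circle rho t).
have fr : re_fun f = (fun t => re_fun u (circle r t) - re_fun (w \o circle rho) t).
  by apply/funext => t; rewrite /re_fun /f /=; case: (u _) (w _) => [a b] [a' b'].
have fi : im_fun f = (fun t => im_fun u (circle r t) - im_fun (w \o circle rho) t).
  by apply/funext => t; rewrite /im_fun /f /=; case: (u _) (w _) => [a b] [a' b'].
have mfr : measurable_fun I (re_fun f : T -> R).
  by rewrite fr; apply: measurable_funB => //; exact: continuous_measurable_I.
have mfi : measurable_fun I (im_fun f : T -> R).
  by rewrite fi; apply: measurable_funB => //; exact: continuous_measurable_I.
have [sf1 sf2 if1 if2] := ip_le_cabs mfr mfi hI.
have fin (x y : R) : x ^+ 2 <= y -> `|x| <= 1 + y.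
  by move=> h; have := sqr_ge0 (`|x| - 1); rewrite sqrrB real_normK ?num_real //; nra.
have key (a d v : R -> R) : a = (fun t => d t + v t) -> sqint d -> sqint v ->
    ip d d <= 1 -> ip v v <= B ^+ 2 / rho -> `|har a n| <= M.
  move=> -> sd sv hd hv; apply: fin; apply: le_trans (har_sqr_le n (sqintD sd sv)) _.
  have p1 : (2 * pi)^-1 <= 1 :> R.
    rewrite invf_le1 ?mulr_gt0 ?pi_gt0 //; have := @pi_ge2 R; lra.
  apply: le_trans (_ : ip (fun t => d t + v t) (fun t => d t + v t) <= _).
    by rewrite ler_piMl ?ip_ge0.
  by apply: le_trans (ip_add_le sd sv) _; lra.
split.
- apply: (key _ _ _ _ sf1 sw1 if1 iw1).
  by apply/funext => t; rewrite fr subrK.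
- apply: (key _ _ _ _ sf2 sw2 if2 iw2).
  by apply/funext => t; rewrite fi subrK.
Unshelve. all: by end_near.
Qed.

(** The powers of k / 2 and, for negative n, the sign (-1)^n cancel between numerator and
    denominator. *)
Lemma besselJ_ratio k n r Rad : 0 < k ->
  besselJ n (k * r) / besselJ n (k * Rad) = besselr k `|n|%N r / besselr k `|n|%N Rad.
Proof.
move=> k0.
have E m : besselJ_nat m (k * r) / besselJ_nat m (k * Rad) = besselr k m r / besselr k m Rad.
  have e1 (x : R) : (k * x / 2) ^+ m = (k / 2) ^+ m * x ^+ m.
    by rewrite -exprMn; congr (_ ^+ _); ring.
  have km : (k / 2) ^+ m != 0 by rewrite expf_neq0 // mulf_neq0 ?invr_eq0 // gt_eqF.
  rewrite !besselJ_natE /besselr !e1 ![(k * _) ^+ 2]exprMn !invfM.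
  set x := (k / 2) ^+ m in km *.
  have e2 : x / x = 1 by rewrite divff.
  rewrite [LHS](_ : _ = (x / x) * (r ^+ m * besselG m (k ^+ 2 * r ^+ 2) *
     ((Rad ^+ m)^-1 * (besselG m (k ^+ 2 * Rad ^+ 2))^-1))); last by ring.
  by rewrite e2 mul1r.
case: n => m /=; first exact: E.
rewrite -E invfM mulrACA divff ?mul1r //.
by rewrite expf_neq0 // oppr_eq0 oner_eq0.
Qed.

(** With cosine coefficients [al], even in n, and sine coefficients [be], odd in n, both sides
    expand into products. As the ratio [Q] is even, their difference contains only odd products, and
    its symmetric sum vanishes. *)
Lemma fourier_bessel_wavesum k Rad (f : R * R -> R[i]) N r t : 0 < k -> 0 < r ->
  sqint (fun t => re_fun f (circle Rad t)) -> sqint (fun t => im_fun f (circle Rad t)) ->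
  fourier_bessel k Rad f N (circle r t) =
  (wavesum k Rad (har (fun t => re_fun f (circle Rad t))) N (circle r t) +i*
   wavesum k Rad (har (fun t => im_fun f (circle Rad t))) N (circle r t))%C.
Proof.
move=> k0 r0; set f1 := (fun t => re_fun f _); set f2 := (fun t => im_fun f _) => s1 s2.
pose al (h : R -> R) n := (2 * pi)^-1 * ip h (fun t => cos (n%:~R * t)).
pose be (h : R -> R) n := (2 * pi)^-1 * ip h (fun t => sin (n%:~R * t)).
have scos n : sqint (fun t : R => cos (n%:~R * t)).
  exact/sqint_continuous/continuous_cos_int.
have ssin n : sqint (fun t : R => sin (n%:~R * t)).
  exact/sqint_continuous/continuous_sin_int.
have cN n (x : R) : cos ((- n)%:~R * x) = cos (n%:~R * x) by rewrite rmorphN mulNr cosN.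
have sN n (x : R) : sin ((- n)%:~R * x) = - sin (n%:~R * x) by rewrite rmorphN mulNr sinN.
have alN h n : al h (- n) = al h n.
  by rewrite /al; congr (_ * ip h _); apply/funext => x; rewrite cN.
have beN h n : sqint h -> be h (- n) = - be h n.
  move=> sh; rewrite /be -mulrN; congr (_ * _).
  rewrite ipC [in RHS]ipC -[RHS]mulN1r -ipZl //; congr (ip _ h).
  by apply/funext => x; rewrite sN mulN1r.
have be0 h : be h 0 = 0.
  rewrite /be /ip (@eq_Rintegral _ _ _ _ _ (fun=> 0)) => [|x _].
    by rewrite (Rintegral_cst _ measurable_I) mul0r mulr0.
  by rewrite mul0r sin0 mulr0.
have harE h n : sqint h -> har h n = al h n + be h n.
  move=> sh; rewrite /har /al /be -mulrDr; congr (_ * _).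
  by rewrite ipC ipDl // [ip h _]ipC [X in _ = _ + X]ipC.
have FE n : fourier_coef Rad f n = ((al f1 n + be f2 n) +i* (al f2 n - be f1 n))%C.
  have E1 : Rintegral mu I (re_fun (fun t => f (circle Rad t) * cexp (- (n%:~R * t)))) =
      ip f1 (fun t => cos (n%:~R * t)) + ip f2 (fun t => sin (n%:~R * t)).
    rewrite /ip -RintegralD; [|exact: measurable_I|exact: integrable_mul..].
    apply: eq_Rintegral => x _; rewrite /re_fun /f1 /f2 /im_fun /re_fun /cexp cosN sinN.
    by case: (f _) => a b /=; ring.
  have E2 : Rintegral mu I (im_fun (fun t => f (circle Rad t) * cexp (- (n%:~R * t)))) =
      ip f2 (fun t => cos (n%:~R * t)) - ip f1 (fun t => sin (n%:~R * t)).
    rewrite /ip -RintegralB; [|exact: measurable_I|exact: integrable_mul..].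
    apply: eq_Rintegral => x _; rewrite /re_fun /f1 /f2 /im_fun /re_fun /cexp cosN sinN.
    by case: (f _) => a b /=; ring.
  rewrite /fourier_coef /cint E1 E2 /al /be.
  by apply/eqP; rewrite eq_complex /=; apply/andP; split; apply/eqP; ring.
pose Q n := besselr k `|n|%N r / besselr k `|n|%N Rad.
have QN n : Q (- n) = Q n by rewrite /Q abszN.
have FB : fourier_bessel k Rad f N (circle r t) =
    symsum N (fun n => ((al f1 n + be f2 n) +i* (al f2 n - be f1 n))%C * (Q n)%:C *
                       cexp (n%:~R * t))%C.
  rewrite fourier_bessel_polar // /symsum; apply: eq_bigr => j _ /=.
  by rewrite FE besselJ_ratio.
have ReS (F : int -> R[i]) : complex.Re (symsum N F) = symsum N (fun n => complex.Re (F n)).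
  by rewrite /symsum; apply: (big_morph _ _ _) => // - [a b] [c d].
have ImS (F : int -> R[i]) : complex.Im (symsum N F) = symsum N (fun n => complex.Im (F n)).
  by rewrite /symsum; apply: (big_morph _ _ _) => // - [a b] [c d].
have WE h : sqint h -> wavesum k Rad (har h) N (circle r t) =
    symsum N (fun n => Q n * (al h n + be h n) * (cos (n%:~R * t) + sin (n%:~R * t))).
  move=> sh; rewrite /wavesum; apply: eq_symsum => n.
  by rewrite bcas_circle ?(ltW r0) // harE // /Q /casn /cas; ring.
rewrite FB (WE _ s1) (WE _ s2); apply/eqP; rewrite eq_complex ReS ImS /=.
have z0 : sin ((0 : int)%:~R * t) = 0 by rewrite mul0r sin0.
apply/andP; split; apply/eqP; apply/subr0_eq.
- transitivity (symsum N (fun n => Q n * ((be f2 n - be f1 n) * cos (n%:~R * t)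
      - (al f1 n + al f2 n) * sin (n%:~R * t)))).
    rewrite /symsum -sumrB; apply: eq_bigr => j _ /=; ring.
  apply: symsum_odd => [|n]; first by rewrite !be0 z0; ring.
  by rewrite QN !beN // !alN cN sN; ring.
- transitivity (symsum N (fun n => Q n * ((al f1 n - al f2 n) * sin (n%:~R * t)
      - (be f1 n + be f2 n) * cos (n%:~R * t)))).
    rewrite /symsum -sumrB; apply: eq_bigr => j _ /=; ring.
  apply: symsum_odd => [|n]; first by rewrite !be0 z0; ring.
  by rewrite QN !beN // !alN cN sN; ring.
Qed.

End ComplexFields.

(** * Convergence rates *)

Section Rates.
Context {R : realType}.

Lemma expr_expR (x : R) n : 0 < x -> x ^+ n = expR (n%:R * ln x).
Proof. by move=> x0; rewrite expRM_natl lnK // posrE. Qed.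

(** The inequality N <= ln (1/d) / ln s1 controls the growing terms, with s3^N d <= d^(1 - ln s3 /
    ln s1). The decaying terms need the strict bound on N + 1, which costs the factors s1 and s2. *)
Lemma truncation_rates (s1 s2 s3 d : R) (N : nat) : s1 = s2 * s3 -> 1 < s2 -> 1 < s3 ->
  0 < d < 1 -> N%:R <= ln d^-1 / ln s1 < N.+1%:R ->
  [/\ s1 ^- N <= s1 * d,
      Num.sqrt N%:R * d <= Num.sqrt d / Num.sqrt (ln s1),
      s2 ^- N <= s2 * d `^ (ln s2 / ln s1),
      s3 ^+ N * d <= d `^ (ln s2 / ln s1) &
      N%:R <= `|ln d| / ln s1].
Proof.
move=> e12 s21 s31 /andP[d0 d1]; rewrite lnV ?posrE //.
have s20 : 0 < s2 by exact: lt_trans s21.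
have s30 : 0 < s3 by exact: lt_trans s31.
have s11 : 1 < s1 by rewrite e12 mulr_egt1.
have s10 : 0 < s1 by exact: lt_trans s11.
have l1 : 0 < ln s1 by exact: ln_gt0.
have l2 : 0 < ln s2 by exact: ln_gt0.
have l3 : 0 < ln s3 by exact: ln_gt0.
have l12 : ln s1 = ln s2 + ln s3 by rewrite e12 lnM ?posrE.
have ld : ln d < 0 by apply: ln_lt0; rewrite d0.
rewrite ler_pdivlMr // ltr_pdivrMr // => /andP[h1 h2].
have ed : d = expR (ln d) by rewrite lnK ?posrE.
have pd : d `^ (ln s2 / ln s1) = expR (ln s2 / ln s1 * ln d).
  by rewrite /powR gt_eqF.
have inv (x : R) : 0 < x -> x ^- N = expR (- (N%:R * ln x)).
  by move=> x0; rewrite expRN -expr_expR.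
have ex (x : R) : 0 < x -> x = expR (ln x) by move=> x0; rewrite lnK ?posrE.
rewrite -natr1 in h2.
split.
- rewrite inv // {2}(ex s1) // [X in _ <= _ * X]ed -expRD ler_expR; lra.
- rewrite ler_pdivlMr ?sqrtr_gt0 // mulrAC -sqrtrM //.
  have dd : d = Num.sqrt d * Num.sqrt d by rewrite -expr2 sqr_sqrtr // ltW.
  rewrite {1}dd mulrA ler_piMl ?sqrtr_ge0 // -sqrtrM; last by rewrite mulr_ge0 // ltW.
  apply: le_trans (_ : Num.sqrt 1 <= _); last by rewrite sqrtr1.
  rewrite ler_wsqrtr //; apply: le_trans (_ : - ln d * d <= _); first by rewrite ler_pM2r.
  (* The bound d ln (1/d) <= 1 is 1 + x <= exp x at x = ln (1/d). *)
  rewrite -ler_pdivlMr // mul1r -[leRHS]lnK ?posrE ?invr_gt0 // lnV ?posrE //.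
  by apply: le_trans (expR_ge1Dx _); rewrite lerDr.
- rewrite inv // pd {2}(ex s2) // -expRD ler_expR.
  have h : - ln d / ln s1 * ln s2 <= (N%:R + 1) * ln s2.
    by rewrite ler_pM2r // ler_pdivrMr // ltW.
  rewrite lerNl opprD -mulrN mulrAC in h *; lra.
- rewrite expr_expR // [X in _ * X <= _]ed -expRD pd ler_expR.
  have h : N%:R * ln s3 <= - ln d / ln s1 * ln s3.
    by rewrite ler_pM2r // ler_pdivlMr.
  have -> : ln s2 / ln s1 * ln d = ln d + - ln d / ln s1 * ln s3.
    by rewrite l12; field; rewrite -l12 gt_eqF.
  by rewrite [leRHS]addrC lerD2r.
- by rewrite ler_pdivlMr // ltr0_norm.
Qed.

(** The smallness of d says that ln (1/d) / ln s1 is at least the integer [N0], so rounding down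
    does not go below [N0]. *)
Lemma truncation_index (s1 d x : R) (N : nat) : 1 < s1 ->
  let N0 := Num.floor (Num.max x 1) in
  0 < d < s1 ^ (- N0) -> N%:Z = Num.floor (ln d^-1 / ln s1) ->
  [/\ d < 1, N0 <= N%:Z & N%:R <= ln d^-1 / ln s1 < N.+1%:R].
Proof.
move=> s11 N0 /andP[d0 dN] EN.
have N01 : 1 <= N0 by rewrite -[1]/(1%:Z) floor_ge_int le_max lexx orbT.
have [n0 En0] : exists n0 : nat, N0 = n0%:Z by exists `|N0|%N; lia.
have s10 : 0 < s1 by exact: lt_trans s11.
have l1 : 0 < ln s1 by exact: ln_gt0.
rewrite En0 -exprnN in dN.
have d1 : d < 1.
  apply: lt_le_trans dN _; rewrite invf_le1 ?exprn_gt0 //.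
  by apply: exprn_ege1; exact: ltW.
have h : n0%:R <= ln d^-1 / ln s1.
  rewrite ler_pdivlMr // -[_ * _](@expRK R) -expr_expR // ler_ln ?posrE ?exprn_gt0 ?invr_gt0 //.
  by rewrite -lef_pV2 ?posrE ?invr_gt0 ?exprn_gt0 // invrK ltW.
split => //.
- by rewrite EN En0 floor_ge_int.
- have := floor_itv (ln d^-1 / ln s1); rewrite -EN.
  by rewrite -[N%:Z + 1]/(N%:Z + 1%:Z) -PoszD addn1.
Qed.

Lemma speed_bounded (g : R -> R * R) : C2_fun (fun t => (g t).1) -> C2_fun (fun t => (g t).2) ->
  exists2 S, 0 <= S & forall t, `[0, 2 * pi]%classic t -> speed g t <= S.
Proof.
have bd (f : R -> R) : C2_fun f -> exists2 M, 0 <= M &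
    forall t, `[0, 2 * pi]%classic t -> `|f^`()%classic t| <= M.
  move=> [_ df2 _].
  have cf : {within `[0, 2 * pi], continuous (fun t => `|f^`()%classic t|)}.
    apply: continuous_subspaceT => t; apply: cvg_norm.
    by apply/differentiable_continuous/derivable1_diffP.
  have [|c _ hc] := EVT_max _ cf; first by rewrite mulr_ge0 // pi_ge0.
  by exists (`|f^`()%classic c|) => // t ht; apply: hc.
move=> /bd[M1 M10 h1] /bd[M2 M20 h2]; exists (M1 + M2); first exact: addr_ge0.
move=> t ht; apply: le_trans (enorm_le_fst_snd _) _.
by apply: lerD; [exact: h1|exact: h2].
Qed.

End Rates.

(** * The cavity and its complex fields *)

Section CavityError.
Context {R : realType}.
Notation mu := (@lebesgue_measure R).
Notation T := (measurableTypeR R).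
Notation I := (`[0, 2 * pi]%classic : set T).
Implicit Types (k r s t rho Rad : R) (n : int) (N : nat) (u : R * R -> R[i]).

(** Boundary points of the open set D avoid the closed inner disk. In particular they are nonzero,
    as the radial projection to the outer circle requires. *)
Lemma cavity_radii rho Rad (D : set (R * R)) g : 0 < Rad -> 0 < rho -> open D ->
  closure (disk Rad) `<=` D -> closure D `<=` disk rho -> jordan_param (bdry D) g ->
  let rho1 := rho - set_dist (bdry (disk rho)) (bdry D) in
  Rad < rho1 < rho /\ forall t, Rad <= enorm (g t) <= rho1.
Proof.
move=> R0 rho0 oD RD Drho [_ _ _ rg] rho1.
have gb t : bdry D (g t) by rewrite -rg; exists t.
have lower t : Rad < enorm (g t).
  rewrite ltNge; apply/negP => h; apply: (bdry_open_notin oD (gb t)).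
  by apply: RD; rewrite closure_diskE.
have upper t : enorm (g t) <= rho1.
  apply: set_dist_bdry_disk => //; apply/eqP => g0.
  by have := lower t; rewrite g0 /enorm /= expr0n addr0 sqrtr0 ltNge ltW.
split; last by move=> t; rewrite upper ltW.
rewrite (lt_le_trans (lower 0) (upper 0)) /= ltrBlDr ltrDl.
by apply: set_dist_gt0 => //; exists (g 0).
Qed.

Lemma helmholtz_in_parts k rho u : helmholtz k (disk rho) u ->
  helmholtz_in k rho (re_fun u) (partials [:: false] (re_fun u)) (partials [:: true] (re_fun u)) /\
  helmholtz_in k rho (im_fun u) (partials [:: false] (im_fun u)) (partials [:: true] (im_fun u)).
Proof.
move=> [[c1 c2] eq].
have key (f : R * R -> R) : Ck 2 (disk rho) f ->
    (forall p, disk rho p -> lap f p + k ^+ 2 * f p = 0) ->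
    helmholtz_in k rho f (partials [:: false] f) (partials [:: true] f).
  move=> cf lf; have [h1 h2] := Ck_C1on (@open_disk R rho) cf.
  exists (partials [:: false; false] f), (partials [:: true; false] f),
    (partials [:: false; true] f), (partials [:: true; true] f).
  split; [exact: h1|exact: (h2 false)|exact: (h2 true)|move=> p Up].
  have := lf p Up; rewrite /lap big_bool.
  move: (partials [:: true; true] f p) (partials [:: false; false] f p) (f p) => x y z /=; lra.
have e p : disk rho p -> lap (re_fun u) p + k ^+ 2 * re_fun u p = 0 /\
    lap (im_fun u) p + k ^+ 2 * im_fun u p = 0.
  move=> Up; have := eq p Up; rewrite /clap /re_fun /im_fun.
  case: (u p) => a b /= [h1 h2]; split.
  - by rewrite -h1; ring.
  - by rewrite -h2; ring.
by split; apply: key => // p Up; have [] := e p Up.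
Qed.

Lemma cabs_bound (z w : R[i]) (a b : R) : `|complex.Re z - complex.Re w| <= a ->
  `|complex.Im z - complex.Im w| <= b -> cabs (z - w) <= a + b.
Proof.
move=> h1 h2; apply: le_trans (cabs_le _) _; apply: lerD.
- by case: z w h1 h2 => [? ?] [? ?].
- by case: z w h1 h2 => [? ?] [? ?].
Qed.

Lemma fourier_bessel_error k rho Rad rho1 u :
  0 < k -> 0 < Rad -> Rad < rho1 < rho -> helmholtz k (disk rho) u ->
  has_L2_trace rho u -> (forall m, besselG m (k ^+ 2 * Rad ^+ 2) != 0) ->
  exists2 K, 0 < K & forall N (E : R) ud, (0 < N)%N -> 0 <= E ->
    measurable_fun I (re_fun (ud \o circle Rad) : T -> R) ->
    measurable_fun I (im_fun (ud \o circle Rad) : T -> R) ->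
    (curve_L2norm (circle Rad) (fun x => ud x - u x)%R <= E%:E)%E ->
    let uN := fourier_bessel k Rad ud N in
    [/\ forall t, cabs (u (circle Rad t) - uN (circle Rad t)) <=
          K * ((Rad / rho) ^+ N + Num.sqrt N%:R * E),
        forall x, Rad <= enorm x <= rho1 -> cabs (u x - uN x) <=
          K * ((rho1 / rho) ^+ N + (rho1 / Rad) ^+ N * E) &
        forall x v, Rad <= enorm x <= rho1 -> enorm v = 1 ->
          cabs (cderive u x v - cderive uN x v) <=
          K * (N%:R * (rho1 / rho) ^+ N + N%:R * (rho1 / Rad) ^+ N * E)].
Proof.
move=> k0 R0 rr Hu tru nz; have [H1 H2] := helmholtz_in_parts Hu.
have [Rr1 r1rho] := andP rr; have Rrho := lt_trans Rr1 r1rho.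
have rho0 : 0 < rho by exact: lt_trans Rrho.
have [axx [axy [ayx [ayy [A _ _ _]]]]] := H1.
have [bxx [bxy [byx [byy [B _ _ _]]]]] := H2.
have cu r : 0 < r < rho -> continuous (fun t => re_fun u (circle r t)) /\
    continuous (fun t => im_fun u (circle r t)).
  by move=> hr; split; [exact: continuous_circle_angle hr A|exact: continuous_circle_angle hr B].
have [r0 [M [r0rho hM]]] := trace_har_bound rho0 cu tru.
have [K1 K10 hK1] := wavesum_error R0 rr H1 nz r0rho (fun r n h => (hM r n h).1).
have [K2 K20 hK2] := wavesum_error R0 rr H2 nz r0rho (fun r n h => (hM r n h).2).
(* Arc length on |x| = Rad is Rad dt, so an L^2 bound E along the circle becomes E / w over
   [0, 2 pi]; the factor 1 + w^-1 in the constant pays for this. *)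
pose w := Num.sqrt Rad; have w0 : 0 < w by rewrite sqrtr_gt0.
have wi : 0 < w^-1 by rewrite invr_gt0.
exists ((K1 + K2 + 1) * (1 + w^-1)).
  by rewrite mulr_gt0 // ?ltr_wpDl ?addr_ge0 // ltW.
move=> N E ud N0 E0 mr mi hE uN.
have [ca cb] := cu Rad (introT andP (conj R0 Rrho)).
pose f t := ud (circle Rad t) - u (circle Rad t).
have fr : re_fun f = (fun t => re_fun (ud \o circle Rad) t - re_fun u (circle Rad t)).
  by apply/funext => t; rewrite /re_fun /f /=; case: (ud _) (u _) => [a b] [a' b'].
have fi : im_fun f = (fun t => im_fun (ud \o circle Rad) t - im_fun u (circle Rad t)).
  by apply/funext => t; rewrite /im_fun /f /=; case: (ud _) (u _) => [a b] [a' b'].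
have mfr : measurable_fun I (re_fun f : T -> R).
  by rewrite fr; apply: measurable_funB => //; exact: continuous_measurable_I.
have mfi : measurable_fun I (im_fun f : T -> R).
  by rewrite fi; apply: measurable_funB => //; exact: continuous_measurable_I.
have [sf1 sf2 if1 if2] := ip_le_cabs mfr mfi (curve_L2norm_circle R0 E0 mfr mfi hE).
pose D := E / w; have D0 : 0 <= D by rewrite divr_ge0 // ltW.
have DE : E ^+ 2 / Rad = D ^+ 2 by rewrite /D expr_div_n sqr_sqrtr // ltW.
rewrite fr DE in if1; rewrite fi DE in if2.
pose d1 t := re_fun ud (circle Rad t); pose d2 t := im_fun ud (circle Rad t).
have sd1 : sqint d1.
  have := sqintD sf1 (sqint_continuous ca); rewrite fr.
  by congr sqint; apply/funext => t; rewrite subrK.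
have sd2 : sqint d2.
  have := sqintD sf2 (sqint_continuous cb); rewrite fi.
  by congr sqint; apply/funext => t; rewrite subrK.
pose V1 := wavesum k Rad (har d1) N; pose V2 := wavesum k Rad (har d2) N.
have UN r t : 0 < r -> uN (circle r t) = (V1 (circle r t) +i* V2 (circle r t))%C.
  by move=> hr; exact: fourier_bessel_wavesum.
have UNx x : 0 < enorm x -> uN x = (V1 x +i* V2 x)%C.
  by move=> hx; have [t xt] := circle_surj x; have := UN _ t hx; rewrite -xt.
have [P1 P2 P3] := hK1 N d1 D N0 sd1 D0 if1.
have [Q1 Q2 Q3] := hK2 N d2 D N0 sd2 D0 if2.
have up (X Y Z1 Z2 : R) : 0 <= X -> 0 <= Y -> Z1 <= K1 * (X + Y * D) ->
    Z2 <= K2 * (X + Y * D) -> Z1 + Z2 <= (K1 + K2 + 1) * (1 + w^-1) * (X + Y * E).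
  move=> X0 Y0 h1 h2; apply: le_trans (lerD h1 h2) _; rewrite -mulrDl -mulrA.
  have K30 : 0 <= K1 + K2 + 1 by rewrite !addr_ge0.
  have XYD : X + Y * D <= (1 + w^-1) * (X + Y * E).
    have -> : (1 + w^-1) * (X + Y * E) = X + Y * D + (w^-1 * X + Y * E) by rewrite /D; ring.
    by rewrite lerDl addr_ge0 ?mulr_ge0 // ltW.
  have XY0 : 0 <= X + Y * D by rewrite addr_ge0 // mulr_ge0.
  apply: ler_pM => //; first by rewrite addr_ge0.
  by rewrite lerDl.
have rho10 : 0 < rho1 by exact: lt_trans Rr1.
have X1 : 0 <= (rho1 / rho) ^+ N by rewrite exprn_ge0 // divr_ge0 // ltW.
have X2 : 0 <= (rho1 / Rad) ^+ N by rewrite exprn_ge0 // divr_ge0 // ltW.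
split.
- move=> t; have := cabs_bound (z := u (circle Rad t)) (w := uN (circle Rad t)).
  rewrite UN // => h; apply: le_trans (h _ _ (P1 t) (Q1 t)) _.
  by apply: up; rewrite ?sqrtr_ge0 // exprn_ge0 // divr_ge0 // ltW.
- move=> x hx; have xp : 0 < enorm x by case/andP: hx => h _; exact: lt_le_trans h.
  have [t xt] := circle_surj x.
  have := cabs_bound (z := u x) (w := uN x); rewrite UNx // => h.
  have p := P2 _ t hx; have q := Q2 _ t hx; rewrite -xt in p q.
  apply: le_trans (h _ _ p q) _; exact: up.
- move=> x v hx v1; have xp : 0 < enorm x by case/andP: hx => h _; exact: lt_le_trans h.
  have xrho : disk rho x by case/andP: hx => _ h; exact: le_lt_trans h r1rho.
  have [t xt] := circle_surj x.
  have v1' : enorm v <= 1 by rewrite v1.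
  have [l1 dl1 p] := P3 _ t v hx v1'; have [l2 dl2 q] := Q3 _ t v hx v1'.
  rewrite -xt in dl1 dl2 p q.
  (* [fourier_bessel] agrees with the smooth wave sums only off the origin, because [angular]
     divides by |x|; agreement near [x] suffices to transfer derivatives. *)
  have nx : \forall y \near x, 0 < enorm y.
    exact: (cvgr_gt _ (@enorm_continuous R x) _ xp).
  have e1 : 'D_v (re_fun uN) x = l1.
    have [_ <-] := dl1; apply: near_eq_derive; near=> y.
    by rewrite /re_fun UNx //; near: y.
  have e2 : 'D_v (im_fun uN) x = l2.
    have [_ <-] := dl2; apply: near_eq_derive; near=> y.
    by rewrite /im_fun UNx //; near: y.
  have [GA _ _] := A x xrho; have [_ dA] := has_grad_dir v GA.
  have [GB _ _] := B x xrho; have [_ dB] := has_grad_dir v GB.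
  have := cabs_bound (z := cderive u x v) (w := cderive uN x v).
  rewrite /cderive /= e1 e2 dA dB => h; apply: le_trans (h _ _ p q) _.
  by apply: up; rewrite ?mulr_ge0.
Unshelve. all: by end_near.
Qed.

End CavityError.

(** * Choice of the constants and conclusion *)

Theorem theorem3p3 (R : realType) (k Rad rho : R) (D Om Gam GamR : set (R * R))
    (g : R -> R * R) (nu : R * R -> R * R) (bc : cavity_type)
    (z : R * R) (us : R * R -> R[i])
    (mu := set_dist (bdry (disk rho)) (bdry D))
    (N0 := Num.floor (Num.max (3 / 10 * (k * rho) ^+ 2 - 1) 1))
    (sigma1 := rho / Rad) (sigma2 := rho / (rho - mu))
    (sigma3 := (rho - mu) / Rad) :
  0 < k -> 0 < Rad -> 0 < rho ->
  domain D -> bounded_set D -> simply_connected D -> C2_boundary D g ->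
  outward_unit_normal D g nu ->
  ~ dirichlet_eigenvalue D (k ^+ 2) ->
  uniquely_solvable bc k D g nu ->
  closure (disk Rad) `<=` D -> closure D `<=` disk rho ->
  admissible k D Om Gam -> admissible k D (disk Rad) GamR ->
  closure Om `<=` disk Rad ->
  Gam z ->
  scattered_field bc k D g nu z us ->
  creal_analytic (disk rho) us -> helmholtz k (disk rho) us ->
  has_L2_trace rho us ->
  exists K1 K2 K3 K4 K5 K6 : R,
    [/\ 0 < K1, 0 < K2 & 0 < K3] /\ [/\ 0 < K4, 0 < K5 & 0 < K6] /\
    (forall (N : nat) (delta : R) (usd : R * R -> R[i]),
       N0 <= N%:Z -> 0 < delta < 1 ->
       curve_L2 (circle Rad) usd ->
       (curve_L2norm (circle Rad) (fun x => usd x - us x)%R <=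
          delta%:E * curve_L2norm (circle Rad) us)%E ->
       let uN := fourier_bessel k Rad usd N in
       [/\ (curve_L2norm (circle Rad) (fun x => us x - uN x)%R <=
              (K1 * sigma1 ^- N + K2 * Num.sqrt N%:R * delta)%:E)%E,
           (curve_L2norm g (fun x => us x - uN x)%R <=
              (K3 * sigma2 ^- N + K4 * sigma3 ^+ N * delta)%:E)%E &
           (curve_L2norm g
              (fun x => cderive us x (nu x) - cderive uN x (nu x))%R <=
              (K5 * N%:R * sigma2 ^- N + K6 * N%:R * sigma3 ^+ N * delta)%:E)%E
       ]) /\
    (forall (N : nat) (delta : R) (usd : R * R -> R[i]),
       0 < delta < sigma1 ^ (- N0) ->
       N%:Z = Num.floor (ln (delta^-1) / ln sigma1) ->
       curve_L2 (circle Rad) usd ->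
       (curve_L2norm (circle Rad) (fun x => usd x - us x)%R <=
          delta%:E * curve_L2norm (circle Rad) us)%E ->
       let uN := fourier_bessel k Rad usd N in
       [/\ (curve_L2norm (circle Rad) (fun x => us x - uN x)%R <=
              (K1 * delta
               + K2 / Num.sqrt (ln sigma1) * Num.sqrt delta)%:E)%E,
           (curve_L2norm g (fun x => us x - uN x)%R <=
              ((K3 + K4) * delta `^ (ln sigma2 / ln sigma1))%:E)%E &
           (curve_L2norm g
              (fun x => cderive us x (nu x) - cderive uN x (nu x))%R <=
              ((K5 + K6) / ln sigma1 * delta `^ (ln sigma2 / ln sigma1)
               * `|ln delta|)%:E)%E]).
Proof.
move=> k0 R0 rho0 [oD _ _] _ _ [jg C1g C2g] nug _ _ RD Drho _ [_ nev _ _ _] _ _ _ _ Hu tru.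
have [rr hg] := cavity_radii R0 rho0 oD RD Drho jg.
rewrite -/mu in rr hg; have [Rr1 r1rho] := andP rr.
have rho10 : 0 < rho - mu by exact: lt_trans Rr1.
have nz m := besselP_neq0 m k0 R0 nev.
have [K K0 hK] := fourier_bessel_error k0 R0 rr Hu tru nz.
have [S S0 hS] := speed_bounded C1g C2g.
have Rrho : Rad < rho by exact: lt_trans r1rho.
have [c1 c2] := Hu.1.
have sub p : enorm p <= Rad -> disk rho p by move=> h; exact: le_lt_trans Rrho.
have [|M1 M10 hM1] := @compact_bounded _ [set x | enorm x <= Rad] (re_fun us) (@compact_cdisk _ _).
  by move=> p /sub Up; have [] := c1 [::] isT p Up.
have [|M2 M20 hM2] := @compact_bounded _ [set x | enorm x <= Rad] (im_fun us) (@compact_cdisk _ _).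
  by move=> p /sub Up; have [] := c2 [::] isT p Up.
pose w1 := Num.sqrt (2 * pi * Rad); pose w2 := Num.sqrt (2 * pi * S).
have w10 : 0 <= w1 by exact: sqrtr_ge0.
have w20 : 0 <= w2 by exact: sqrtr_ge0.
(* A bound on the norm of [us] over the data circle; it converts the relative noise level [delta]
   into the absolute level [delta * U]. *)
pose U := (M1 + M2) * w1; have U0 : 0 <= U by rewrite mulr_ge0 // addr_ge0.
have ec t : enorm (circle Rad t) <= Rad by rewrite enorm_circle // ltW.
have hU : (curve_L2norm (circle Rad) us <= U%:E)%E.
  apply: curve_L2norm_le => [||t _|t _]; [exact: addr_ge0|exact: ltW| |].
  - apply: le_trans (cabs_le _) _; apply: lerD; [exact: hM1 (ec t)|exact: hM2 (ec t)].
  - by rewrite speed_circle // ltW.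
(* One constant for all three norms: 1 + U covers the relative noise, and 1 + w1 + w2 the passage
   from sup bounds to L^2 norms on the circle and on the boundary of D. *)
pose Kc := K * (1 + U) * (1 + w1 + w2).
have Kc0 : 0 < Kc by rewrite !mulr_gt0 // !ltr_pwDl // addr_ge0.
have s1 : sigma1 = sigma2 * sigma3.
  by rewrite /sigma1 /sigma2 /sigma3; field; rewrite !gt_eqF.
have s21 : 1 < sigma2 by rewrite ltr_pdivlMr // mul1r.
have s31 : 1 < sigma3 by rewrite ltr_pdivlMr // mul1r.
have s11 : 1 < sigma1 by rewrite ltr_pdivlMr // mul1r.
have base N delta usd : (0 < N)%N -> 0 < delta -> curve_L2 (circle Rad) usd ->
    (curve_L2norm (circle Rad) (fun x => usd x - us x)%R <=
       delta%:E * curve_L2norm (circle Rad) us)%E ->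
    let uN := fourier_bessel k Rad usd N in
    [/\ (curve_L2norm (circle Rad) (fun x => us x - uN x)%R <=
           (Kc * (sigma1 ^- N + Num.sqrt N%:R * delta))%:E)%E,
        (curve_L2norm g (fun x => us x - uN x)%R <=
           (Kc * (sigma2 ^- N + sigma3 ^+ N * delta))%:E)%E &
        (curve_L2norm g
           (fun x => cderive us x (nu x) - cderive uN x (nu x))%R <=
           (Kc * (N%:R * sigma2 ^- N + N%:R * sigma3 ^+ N * delta))%:E)%E].
  move=> N0' d0 [mr mi _] hd uN.
  have E0 : 0 <= delta * U by rewrite mulr_ge0 // ltW.
  have hE : (curve_L2norm (circle Rad) (fun x => usd x - us x)%R <= (delta * U)%:E)%E.
    by apply: le_trans hd _; rewrite EFinM lee_wpmul2l // lee_fin ltW.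
  have [P1 P2 P3] := hK N (delta * U) usd N0' E0 mr mi hE.
  have up (X Y w : R) : 0 <= X -> 0 <= Y -> 0 <= w <= 1 + w1 + w2 ->
      K * (X + Y * (delta * U)) * w <= Kc * (X + Y * delta).
    move=> X0 Y0 /andP[w0 ww]; have Yd : 0 <= Y * delta by rewrite mulr_ge0 // ltW.
    have h : X + Y * (delta * U) <= (1 + U) * (X + Y * delta).
      have -> : (1 + U) * (X + Y * delta) = X + Y * (delta * U) + (U * X + Y * delta) by ring.
      by rewrite lerDl addr_ge0 // mulr_ge0.
    have -> : Kc * (X + Y * delta) = K * ((1 + U) * (X + Y * delta)) * (1 + w1 + w2).
      by rewrite /Kc; ring.
    apply: ler_pM => //; last by rewrite ler_pM2l.
    by rewrite mulr_ge0 ?(ltW K0) // addr_ge0 // mulr_ge0.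
  have ww1 : 0 <= w1 <= 1 + w1 + w2 by rewrite w10 /= addrAC lerDr addr_ge0.
  have ww2 : 0 <= w2 <= 1 + w1 + w2 by rewrite w20 /= lerDr addr_ge0.
  have i1 : sigma1 ^- N = (Rad / rho) ^+ N by rewrite -exprVn invf_div.
  have i2 : sigma2 ^- N = ((rho - mu) / rho) ^+ N by rewrite -exprVn invf_div.
  have p1 : 0 <= (Rad / rho) ^+ N by rewrite exprn_ge0 // divr_ge0 // ltW.
  have p2 : 0 <= ((rho - mu) / rho) ^+ N by rewrite exprn_ge0 // divr_ge0 // ltW.
  have p3 : 0 <= sigma3 ^+ N by rewrite exprn_ge0 // (le_trans ler01) // ltW.
  have bd (X Y : R) : 0 <= X -> 0 <= Y -> 0 <= K * (X + Y * (delta * U)).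
    by move=> X0 Y0; rewrite mulr_ge0 ?(ltW K0) // addr_ge0 // mulr_ge0.
  rewrite i1 i2; split.
  - apply: le_trans (curve_L2norm_le (bd _ _ p1 (sqrtr_ge0 _)) (ltW R0) (fun t _ => P1 t) _) _.
      by move=> t _; rewrite speed_circle // ltW.
    by rewrite lee_fin; apply: up => //; exact: sqrtr_ge0.
  - apply: le_trans (curve_L2norm_le (bd _ _ p2 p3) S0 (fun t _ => P2 _ (hg t)) hS) _.
    by rewrite lee_fin; apply: up.
  - have nu1 t : enorm (nu (g t)) = 1 by have [] := nug t.
    apply: le_trans (curve_L2norm_le (bd _ _ (mulr_ge0 (ler0n _ N) p2) (mulr_ge0 (ler0n _ N) p3))
      S0 (fun t _ => P3 _ _ (hg t) (nu1 t)) hS) _.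
    by rewrite lee_fin; apply: up => //; rewrite mulr_ge0.
(* The maximum with 1 in [N0] ensures N > 0, which the bounds with factors sqrt N and N require. *)
have N0pos : 1 <= N0 by rewrite -[1]/(1%:Z) floor_ge_int le_max lexx orbT.
have s10 : 0 < sigma1 by exact: lt_trans s11.
have s20 : 0 < sigma2 by exact: lt_trans s21.
exists (Kc * sigma1), Kc, (Kc * sigma2), Kc, (Kc * sigma2), Kc.
split; first by split=> //; exact: mulr_gt0.
split; first by split=> //; exact: mulr_gt0.
have big (s : R) : 1 < s -> Kc <= Kc * s by move=> h; rewrite ler_peMr ?ltW.
split.
- move=> N delta usd NN /andP[d0 _] cd hd uN.
  have N1 : (0 < N)%N by have := le_trans N0pos NN.
  have [h1 h2 h3] := base N delta usd N1 d0 cd hd.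
  have v1 : 0 <= sigma1 ^- N by rewrite invr_ge0 exprn_ge0 // ltW.
  have v2 : 0 <= sigma2 ^- N by rewrite invr_ge0 exprn_ge0 // ltW.
  split.
  + apply: le_trans h1 _; rewrite lee_fin mulrDr mulrA lerD2r.
    by apply: ler_wpM2r => //; exact: big.
  + apply: le_trans h2 _; rewrite lee_fin mulrDr mulrA lerD2r.
    by apply: ler_wpM2r => //; exact: big.
  + apply: le_trans h3 _; rewrite lee_fin.
    rewrite [leLHS](_ : _ = Kc * N%:R * sigma2 ^- N + Kc * N%:R * sigma3 ^+ N * delta); last by ring.
    rewrite lerD2r.
    by do 2!apply: ler_wpM2r => //; exact: big.
- move=> N delta usd hdelta EN cd hd uN.
  have [d1 NN hN] := truncation_index s11 hdelta EN.
  have d0 : 0 < delta by case/andP: hdelta.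
  have N1 : (0 < N)%N by have := le_trans N0pos NN.
  have [h1 h2 h3] := base N delta usd N1 d0 cd hd.
  have d01 : 0 < delta < 1 by rewrite d0.
  have [r1 r2 r3 r4 r5] := truncation_rates s1 s21 s31 d01 hN.
  set p := delta `^ _ in r3 r4 *.
  have p0 : 0 <= p by exact: powR_ge0.
  split.
  + apply: le_trans h1 _; rewrite lee_fin mulrDr; apply: lerD.
      by rewrite -[leRHS]mulrA ler_pM2l.
    by rewrite [leRHS]mulrAC -[leRHS]mulrA ler_pM2l.
  + apply: le_trans h2 _; rewrite lee_fin.
    rewrite [leRHS](_ : _ = Kc * (sigma2 * p + p)); last by ring.
    by rewrite ler_pM2l // lerD.
  + apply: le_trans h3 _; rewrite lee_fin.
    rewrite [leLHS](_ : _ = Kc * (N%:R * (sigma2 ^- N + sigma3 ^+ N * delta))); last by ring.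
    (* Here K5 + K6 is Kc (sigma2 + 1): the two summands bound the truncation and the data term, and
       N <= |ln delta| / ln sigma1 bounds the common factor. *)
    rewrite [leRHS](_ : _ = Kc * (`|ln delta| / ln sigma1 * (sigma2 * p + p))); last by ring.
    rewrite ler_pM2l //; apply: ler_pM => //; last exact: lerD.
    rewrite addr_ge0 ?invr_ge0 ?exprn_ge0 ?(ltW s20) // mulr_ge0 ?(ltW d0) //.
    by rewrite exprn_ge0 // (le_trans ler01) // ltW.
Qed.
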